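(* Consider Activated Random Walks on $\mathbb{Z}^d$ with $d>2$ and a fixed jump distribution $p(\cdot)$, and let $\zeta_c=\zeta_c(\lambda)$ denote the critical density for sleep rate $\lambda$. Then $\zeta_c(\lambda)<1$ for every $\lambda\in(0,\infty)$, and $\zeta_c(\lambda)\to0$ as $\lambda\to0$.
   Context: Activated Random Walk (ARW) on $\mathbb{Z}^d$. Fix $d\geqslant1$, a sleep rate $0<\lambda<\infty$ and a jump distribution $p(\cdot)$, i.e. a probability distribution on $\mathbb{Z}^d$ supported on the nearest neighbors $\{\pm e_1,\dots,\pm e_d\}$ of the origin $\boldsymbol{0}$ and whose support generates the group $\mathbb{Z}^d$. Let $\mathbb{N}_0=\{0,1,2,\dots\}$ and $\mathbb{N}_{\mathfrak{s}}=\mathbb{N}_0\cup\{\mathfrak{s}\}$, ordered by $0<\mathfrak{s}<1<2<\cdots$, with $|\mathfrak{s}|=1$, $|n|=n$, $\mathfrak{s}+1=2$, $1\cdot\mathfrak{s}=\mathfrak{s}$ and $n\cdot\mathfrak{s}=n$ for $n\geqslant2$. A configuration is $\eta\in(\mathbb{N}_{\mathfrak{s}})^{\mathbb{Z}^d}$: site $x$ contains $\eta(x)$ active particles if $\eta(x)\in\mathbb{N}_0$ and one sleeping particle if $\eta(x)=\mathfrak{s}$. Evolution: at each site $x$ a clock rings at rate $(1+\lambda)\,\eta_t(x)\,\mathbf{1}_{\{\eta_t(x)\neq\mathfrak{s}\}}$. When it rings, with probability $\frac{\lambda}{1+\lambda}$ the value $\eta(x)$ is replaced by $\eta(x)\cdot\mathfrak{s}$;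 otherwise, with probability $\frac{p(y-x)}{1+\lambda}$ for each $y$, $\eta(x)$ is replaced by $\eta(x)-1$ and $\eta(y)$ by $\eta(y)+1$. For a translation-ergodic distribution $\nu$ on $(\mathbb{N}_{\mathfrak{s}})^{\mathbb{Z}^d}$ with finite density $\int|\eta(\boldsymbol{0})|\nu(\mathrm{d}\eta)<\infty$ there is a process $(\eta_t)_{t\geqslant0}$ with these rates and $\eta_0\sim\nu$; its law $\mathbf{P}^{\nu}$ is characterized by $\mathbf{P}^{\nu}(\mathcal{A})=\lim_{V\uparrow\mathbb{Z}^d}\mathbf{P}^{\nu}_V(\mathcal{A})$ for every event $\mathcal{A}$ determined by $(\eta_s(x))_{x\in B,\,s\in[0,t]}$ with $B$ finite and $t<\infty$, where $\mathbf{P}^{\nu}_V$ is the law of the (finite) system started from $\eta_0\cdot\mathbf{1}_V$, $V$ finite. The system stays active if, for each site, there are arbitrarily large times at which the site has at least one active particle. It fixates if, for each site, there is a (random) time after which the site is always either vacant or occupied by exactly one sleeping particle. Critical density: given $d$, $p(\cdot)$, $\lambda$, the critical density $\zeta_c$ is the unique number such that, for every translation-ergodic distribution $\nu$ supported on $(\mathbb{N}_0)^{\mathbb{Z}^d}$ (all particles initially active) with finite density $\zeta$, $\mathbf{P}^\nu(\text{system stays active})$ equals $0$ if $\zeta<\zeta_c$ and $1$ if $\zeta>\zeta_c$ (existence of such a number is a known theorem). *)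

(* Defs.v *)
From HB Require Import structures.
From mathcomp Require Import all_boot all_order all_algebra finmap.
From mathcomp Require Import all_classical all_reals all_analysis.
From mathcomp.analysis Require Import measurable_realfun showcase.summability.

Set Implicit Arguments.
Unset Strict Implicit.
Unset Printing Implicit Defensive.

Import Order.TTheory GRing.Theory Num.Theory.
Import numFieldNormedType.Exports.

Local Open Scope classical_set_scope.
Local Open Scope ring_scope.

(* [Act n] is n active particles, [Sleep] is the symbol s. *)
Inductive site_state := Act of nat | Sleep.

HB.instance Definition _ := gen_eqMixin site_state.
HB.instance Definition _ := gen_choiceMixin site_state.
HB.instance Definition _ := isPointed.Build site_state (Act 0).

Definition particles (a : site_state) : nat := if a is Act n then n else 1.

Definition active (a : site_state) : nat := if a is Act n then n else 0.

(* s + 1 = 2 *)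
Definition add_one (a : site_state) : site_state :=
  if a is Act n then Act n.+1 else Act 2.

(* Applied only to [Act n] with n > 0. *)
Definition sub_one (a : site_state) : site_state :=
  if a is Act n then Act n.-1 else Sleep.

(* a . s : only a lone particle falls asleep. *)
Definition mul_sleep (a : site_state) : site_state :=
  if a is Act 1 then Sleep else a.

Section Lattice.
Variable d : nat.

Definition unit_vec (i : 'I_d) : 'rV[int]_d := delta_mx 0 i.

Definition unit_steps : seq 'rV[int]_d :=
  [seq unit_vec i | i <- enum 'I_d] ++ [seq - unit_vec i | i <- enum 'I_d].

Record jump_distribution (R : realType) (p : 'rV[int]_d -> R) : Prop := {
  jump_ge0 : forall z, 0 <= p z ;
  jump_supp : forall z, p z != 0 -> z \in unit_steps ;
  jump_sum1 : \sum_(z <- unit_steps) p z = 1 ;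
  jump_generates : forall S : {pred 'rV[int]_d}, zmod_closed S ->
    (forall z, p z != 0 -> z \in S) -> forall z, z \in S }.

Definition config := 'rV[int]_d -> site_state.

HB.instance Definition _ := Pointed.on config.

Definition config_cylinders : set (set config) :=
  [set A | exists x a, A = [set eta : config | eta x = a]].

(* Configurations with the product sigma-algebra. *)
Definition configT := g_sigma_algebraType config_cylinders.

Definition translate (z : 'rV[int]_d) (eta : configT) : configT :=
  fun x => eta (x + z).

Definition restrict_config (V : {fset 'rV[int]_d}) (eta : configT) : configT :=
  fun x => if x \in V then eta x else Act 0.

Definition translation_ergodic (R : realType) (nu : probability configT R) :=
  (forall z (A : set configT), measurable A ->
     nu (translate z @^-1` A) = nu A) /\
  (forall A : set configT, measurable A ->
     (forall z, translate z @^-1` A = A) -> nu A = 0%E \/ nu A = 1%E).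

Definition density (R : realType) (nu : probability configT R) : \bar R :=
  (\int[nu]_eta (particles (eta 0))%:R%:E)%E.

Definition all_active (R : realType) (nu : probability configT R) :=
  nu [set eta : configT | forall x, eta x <> Sleep] = 1%E.

(* Trajectories are cadlag at every site, [site_state] being discrete. *)
Definition cadlag (R : realType) (w : R -> config) :=
  forall x,
    (forall t, 0 <= t -> \forall s \near t^'+, w s x = w t x) /\
    (forall t, 0 < t -> exists a, \forall s \near t^'-, w s x = a).

(* Only times t >= 0 are meaningful; freezing the path at negative times makes
   a trajectory a function on [0, +oo). *)
Record traj (R : realType) := Traj {
  traj_fun :> R -> config ;
  traj_cadlag : cadlag traj_fun ;
  traj_neg : forall t, t < 0 -> traj_fun t = traj_fun 0 }.

Definition const_fun (R : realType) : R -> config := fun _ _ => Act 0.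

Lemma const_cadlag (R : realType) : cadlag (@const_fun R).
Proof.
by move=> x; split=> [t _|t _]; [|exists (Act 0)]; apply: nearW.
Qed.

Section TrajectorySpace.
Variable R : realType.

HB.instance Definition _ := gen_eqMixin (traj R).
HB.instance Definition _ := gen_choiceMixin (traj R).
HB.instance Definition _ := isPointed.Build (traj R)
  (Traj (@const_cadlag R) (fun _ _ => erefl)).

Definition traj_cylinders : set (set (traj R)) :=
  [set A | exists t x a, 0 <= t /\ A = [set w : traj R | w t x = a]].

(* Trajectories with the sigma-algebra generated by the eta_t(x), t >= 0. *)
Definition trajT := g_sigma_algebraType traj_cylinders.

(* Events determined by (eta_s(x)) for x in B and s in [0, t]. *)
Definition window_event (B : {fset 'rV[int]_d}) (t : R) : set (set trajT) :=
  <<s [set A | exists s x a,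
        [/\ 0 <= s, s <= t, x \in B & A = [set w : traj R | w s x = a]]] >>.

Definition stays_active : set trajT :=
  [set w : traj R | forall x (T : R),
     exists t, [/\ 0 <= t, T <= t & (0 < active (w t x))%N]].

End TrajectorySpace.

Definition sleep_at (x : 'rV[int]_d) (eta : config) : config :=
  fun u => if u == x then mul_sleep (eta x) else eta u.

Definition move (x y : 'rV[int]_d) (eta : config) : config :=
  fun u => if u == x then sub_one (eta x)
           else if u == y then add_one (eta y) else eta u.

Section Dynamics.
Variables (R : realType) (p : 'rV[int]_d -> R) (lambda : R).

Definition ring_rate (eta : config) (x : 'rV[int]_d) : R :=
  (1 + lambda) * (active (eta x))%:R.

Definition total_rate (eta : config) : R :=
  \sum_(x \in [set: 'rV[int]_d]) ring_rate eta x.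

Definition ring_outcome (x : 'rV[int]_d) (eta eta' : config) : R :=
  lambda / (1 + lambda) * `[< eta' = sleep_at x eta >]%:R +
  \sum_(z <- unit_steps) p z / (1 + lambda) * `[< eta' = move x (x + z) eta >]%:R.

(* Transition probabilities of the chain of configurations at the successive
   ring times of a finite system (whose sums over x have finite support): the
   ringing clock is chosen proportionally to its rate.  If no clock can ring,
   the configuration is absorbing. *)
Definition ring_chain (eta eta' : config) : R :=
  if total_rate eta == 0 then `[< eta' = eta >]%:R
  else \sum_(x \in [set: 'rV[int]_d])
         ring_rate eta x / total_rate eta * ring_outcome x eta eta'.

(* [Q] is the law of the system whose initial configuration has law [mu],
   carried by configurations with finitely many particles.  [Y n] is the
   configuration after n rings and [H n] the time spent waiting for the
   following ring, exponential of parameter [total_rate (Y n)] given the chain;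
   it is +oo almost surely when that parameter is 0.  A ring need not change
   the configuration. *)
Definition arw_finite_law (mu : set configT -> \bar R)
    (Q : probability (trajT R) R) : Prop :=
  exists (disp : measure_display) (T : measurableType disp)
    (P : probability T R)
    (Y : nat -> T -> configT) (H : nat -> T -> \bar R) (X : T -> trajT R),
  [/\ (forall n, measurable_fun [set: T] (Y n)) /\
      (forall n, measurable_fun [set: T] (H n)) /\
      measurable_fun [set: T] X,
      forall (n : nat) (eta : nat -> config) (h : nat -> R),
        (forall i, 0 <= h i) ->
        P [set o | (forall i, (i <= n)%N -> Y i o = eta i) /\
                   (forall i, (i < n)%N -> ((h i)%:E < H i o)%E)] =
        (mu [set eta 0%N] *
         (\prod_(i < n) (ring_chain (eta i) (eta i.+1) *
                         expR (- (total_rate (eta i) * h i))))%:E)%E,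
      {ae P, forall o, forall (n : nat) (t : R),
        (\sum_(i < n) H i o <= t%:E)%E ->
        (t%:E < \sum_(i < n.+1) H i o)%E ->
        0 <= t -> (X o : traj R) t = Y n o} &
      forall A, measurable A -> Q A = P (X @^-1` A) ].

(* [P] is the law of the infinite system started from [nu]; [totally] is the
   filter of finite subsets of Z^d ordered by inclusion. *)
Definition arw_law (nu : probability configT R) (P : probability (trajT R) R) :=
  exists2 PV : {fset 'rV[int]_d} -> probability (trajT R) R,
    forall V, arw_finite_law (pushforward nu (restrict_config V)) (PV V) &
    forall (B : {fset 'rV[int]_d}) (t : R) (A : set (trajT R)),
      0 <= t -> window_event B t A -> PV V A @[V --> totally] --> P A.

(* The law of the process is unique; uniqueness of the critical number is also
   automatic, as every density is realized by some ergodic law. *)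
Definition critical_density (zc : R) : Prop :=
  forall (nu : probability configT R) (zeta : R),
    translation_ergodic nu -> all_active nu -> density nu = zeta%:E ->
    exists2 P : probability (trajT R) R, arw_law nu P &
      (zeta < zc -> P (@stays_active R) = 0%E) /\
      (zc < zeta -> P (@stays_active R) = 1%E).

End Dynamics.
End Lattice.

(* Main.v *)
Require Import Defs.
From HB Require Import structures.
From mathcomp Require Import all_boot all_order all_algebra finmap.
From mathcomp Require Import all_classical all_reals all_analysis.
From mathcomp.analysis Require Import measurable_realfun showcase.summability.
From mathcomp Require Import ring lra zify.

Set Implicit Arguments.
Unset Strict Implicit.
Unset Printing Implicit Defensive.

Import Order.TTheory GRing.Theory Num.Theory.
Import numFieldNormedType.Exports.

Local Open Scope classical_set_scope.
Local Open Scope ring_scope.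

(* Since d > 2 the walk is transient, with a finite Green function.  Start from a
   periodic pattern of active particles and stabilize a large region W.  The mean
   number of jumps from each site solves a Poisson equation in W, whose source is
   the initial density minus the probability that a sleeping particle is left
   there.  A site ends up without a sleeping particle with a probability
   that is bounded below uniformly in W: an additional particle at z causes at
   most F(0) further jumps from z when sleep is forbidden there, and by Jensen's
   inequality the instructions at z all avoid sleep with probability at least
   (1 + lambda)^{- F(0)}.  Hence at some density below 1 the source of the odometer
   is positive, and a second moment bound shows that the number of jumps from x
   exceeds any K with probability at least c > 0, uniformly in K.  For small lambda
   and a pattern of small density, a vacant site is visited by many particles
   before any of them sleeps, and the same argument applies.

   For the process, if x is eventually inactive then so is, almost surely, every
   site y that can reach x, since each jump from y activates its neighbour with a
   fixed probability.  So x is eventually inactive only if W gets stabilized with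
   finitely many jumps from x, and this has probability at most 1 - c; a site that
   reaches finitely many given sites handles all of them at once.  Hence the system
   stays active with probability at least c, so that the density of the pattern
   is at least the critical one. *)

(** No stacks of instructions are built: a stabilization enters only through means. Topplings at
    distinct sites commute in mean, so the best mean over all choices of [n] legal topplings
    increases with [n] to a limit that no legal toppling changes. Each fact about a stabilization
    thus reduces to a single toppling, and [minorant] replaces optional stopping, since the Green
    function bounds the mean number of topplings left.

    The jump law may be directed, so the regions consist of the sites from which a given site can be
    reached in a bounded number of steps. Their Green mass grows at least linearly and at most
    polynomially; hence at some scales an enlargement by [t] steps at most doubles it, and the
    second moment, computed in the larger region, matches the mean, computed in the smaller one.

    Periodic patterns with a uniform shift are ergodic laws with finitely many atoms, so every
    average is a finite sum. A positive probability of activity suffices, because below the critical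
    density it would be zero. It is transferred from finite systems by events on finitely many sites
    and a bounded time, hence by bounds uniform in the volume. *)

Lemma big_unit_steps (d : nat) (R : realType) (f : 'rV[int]_d -> R) :
  \sum_(s <- unit_steps d) f s =
  \sum_(i < d) (f (unit_vec i) + f (- unit_vec i)).
Proof.
rewrite /unit_steps big_cat /= big_map big_map big_enum big_enum -big_split.
exact: eq_bigl.
Qed.

(** * A finite Green function in dimension greater than two *)

Lemma rpow_neg_quarter_le (R : realType) (t : R) : `|t| <= 16^-1 ->
  (Num.sqrt (Num.sqrt (1 + t)))^-1 <= 1 - t / 4 + 3 / 16 * t ^+ 2.
Proof.
rewrite ler_norml => /andP[t1 t2].
have ha : 0 < 1 - t / 4 + 3 / 16 * t ^+ 2 by nra.
(* The second-order Taylor coefficients are 3/8 for the power -1/2 and 5/32 for the power -1/4; the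
   slack up to 13/32 and 3/16 absorbs the higher orders. *)
have hb : 0 < 1 - t / 2 + 13 / 32 * t ^+ 2 by nra.
have h1t : 0 < 1 + t by nra.
have hba : 1 - t / 2 + 13 / 32 * t ^+ 2 <= (1 - t / 4 + 3 / 16 * t ^+ 2) ^+ 2.
  rewrite -subr_ge0.
  have -> : (1 - t / 4 + 3 / 16 * t ^+ 2) ^+ 2 - (1 - t / 2 + 13 / 32 * t ^+ 2) =
    t ^+ 2 * (1 / 32 - 3 / 32 * t + 9 / 256 * t ^+ 2) by field.
  by apply: mulr_ge0; nra.
have h1b : 1 <= (1 + t) * (1 - t / 2 + 13 / 32 * t ^+ 2) ^+ 2.
  rewrite -subr_ge0.
  have -> : (1 + t) * (1 - t / 2 + 13 / 32 * t ^+ 2) ^+ 2 - 1 =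
    t ^+ 2 * (1 / 16 + 21 / 32 * t - 247 / 1024 * t ^+ 2 + 169 / 1024 * t ^+ 3).
    by field.
  apply: mulr_ge0; first exact: sqr_ge0.
  have : `|t ^+ 2| <= 256^-1 by rewrite ger0_norm ?sqr_ge0 //; nra.
  have : `|t ^+ 3| <= 256^-1.
    rewrite exprS normrM; have : `|t| <= 1 by rewrite ler_norml; lra.
    have : `|t ^+ 2| <= 256^-1 by rewrite ger0_norm ?sqr_ge0 //; nra.
    have := normr_ge0 t; have := normr_ge0 (t ^+ 2); nra.
  by rewrite !ler_norml => /andP[? ?] /andP[? ?]; lra.
have s1 : 1 <= Num.sqrt (1 + t) * (1 - t / 2 + 13 / 32 * t ^+ 2).
  rewrite -(@ler_pXn2r _ 2) ?nnegrE ?mulr_ge0 ?sqrtr_ge0 ?(ltW hb) //.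
  by rewrite expr1n exprMn sqr_sqrtr // ltW.
rewrite -div1r ler_pdivrMr ?sqrtr_gt0 ?sqrtr_gt0 //.
rewrite -(@ler_pXn2r _ 2) ?nnegrE ?mulr_ge0 ?sqrtr_ge0 ?(ltW ha) //.
rewrite expr1n exprMn sqr_sqrtr ?sqrtr_ge0 // mulrC.
by apply: le_trans s1 _; apply: ler_wpM2l hba; exact: sqrtr_ge0.
Qed.

Section Transience.
Variables (d : nat) (R : realType).
Local Notation site := 'rV[int]_d.

Lemma unit_vecE (i j : 'I_d) : unit_vec i 0 j = (j == i)%:R.
Proof. by rewrite mxE eqxx. Qed.

Lemma unit_vec_neq0 (i : 'I_d) : unit_vec i != 0.
Proof.
apply/eqP => /rowP /(_ i); rewrite unit_vecE eqxx mxE => /eqP.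
by rewrite oner_eq0.
Qed.

Lemma unit_steps_neq0 (s : site) : s \in unit_steps d -> s != 0.
Proof.
rewrite mem_cat => /orP[] /mapP[i _ ->]; last rewrite oppr_eq0;
exact: unit_vec_neq0.
Qed.

Variable q : 'I_d -> R.
Hypothesis q_gt0 : forall i, 0 < q i.
Hypothesis q_sum1 : \sum_i q i = 1.
Hypothesis d_gt2 : (2 < d)%N.

(** Since 272 = 16 ^ 2 + 16, one has [16 * (2 * |a| + 1) <= 272 + a ^ 2] for all [a], so that a step
    multiplies [lyap_quad] by [1 + t] with [|t| <= 1 / 16]. *)
Definition lyap_cst : R := 272 * \sum_i (q i)^-1.
Definition lyap_quad (u : site) : R := lyap_cst + \sum_i (u 0 i)%:~R ^+ 2 / q i.
(** [lyap_quad] is, up to a constant, the squared norm in which a walk moving along axis [i] with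
    probability [q i] is isotropic, and [lyap] the power -1/2 of that norm. The power [- a] is
    superharmonic far from the origin when [0 < a < d - 2]. *)
Definition lyap (u : site) : R := (Num.sqrt (Num.sqrt (lyap_quad u)))^-1.

Lemma lyap_cst_ge i : 272 <= lyap_cst * q i.
Proof.
rewrite /lyap_cst (bigD1 i) //= mulrDr mulrDl -!mulrA mulVf ?mulr1 ?gt_eqF //.
rewrite lerDl !mulr_ge0 ?(ltW (q_gt0 i)) //.
by apply: sumr_ge0 => j _; rewrite invr_ge0 ltW.
Qed.

Lemma sum_invq_gt0 : 0 < \sum_i (q i)^-1.
Proof.
rewrite (bigD1 (Ordinal (ltn_trans (isT : (0 < 2)%N) d_gt2))) //=.
apply: ltr_pwDl; first by rewrite invr_gt0.
by apply: sumr_ge0 => j _; rewrite invr_ge0 ltW.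
Qed.

Lemma lyap_quad_ge u i : 0 < lyap_quad u /\
  272 + (u 0 i)%:~R ^+ 2 <= lyap_quad u * q i.
Proof.
have h0 : 0 <= \sum_i (u 0 i)%:~R ^+ 2 / q i :> R.
  by apply: sumr_ge0 => j _; rewrite divr_ge0 ?sqr_ge0 ?(ltW (q_gt0 j)).
split.
  by apply: ltr_pwDl => //; rewrite mulr_gt0 ?sum_invq_gt0.
rewrite /lyap_quad mulrDl; apply: lerD; first exact: lyap_cst_ge.
rewrite (bigD1 i) //= mulrDl mulfVK ?gt_eqF // lerDl mulr_ge0 ?(ltW (q_gt0 i)) //.
by apply: sumr_ge0 => j _; rewrite divr_ge0 ?sqr_ge0 ?(ltW (q_gt0 j)).
Qed.

Lemma lyap_quadD u i (e : int) :
  lyap_quad (u + e *: unit_vec i) =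
  lyap_quad u + (2 * e%:~R * (u 0 i)%:~R + e%:~R ^+ 2) / q i.
Proof.
rewrite /lyap_quad -addrA; congr (_ + _).
rewrite (bigD1 i) //= [in RHS](bigD1 i) //= !mxE !eqxx mulr1 addrAC.
congr (_ + _).
  by rewrite -mulrDl intrD sqrrD; congr (_ / _); ring.
apply: eq_bigr => j ji; rewrite !mxE (negPf ji) andbF mulr0 addr0 //.
Qed.

Lemma lyapD u i (e : int) : `|e| = 1 ->
  lyap (u + e *: unit_vec i) <= lyap u *
   (1 - ((2 * e%:~R * (u 0 i)%:~R + 1) / (q i * lyap_quad u)) / 4
      + 3 / 16 * ((2 * e%:~R * (u 0 i)%:~R + 1) / (q i * lyap_quad u)) ^+ 2).
Proof.
move=> e1; have e2 : (e%:~R : R) ^+ 2 = 1.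
  by rewrite -rmorphXn /= -real_normK ?num_real // e1 expr1n.
have [r0 hr] := lyap_quad_ge u i.
have qr : 0 < q i * lyap_quad u by rewrite mulr_gt0.
rewrite /lyap lyap_quadD e2.
set t := (_ + 1) / (q i * _).
have -> : lyap_quad u + (2 * e%:~R * (u 0 i)%:~R + 1) / q i = lyap_quad u * (1 + t).
  by rewrite /t; field; rewrite !gt_eqF.
rewrite sqrtrM ?(ltW r0) // sqrtrM ?sqrtr_ge0 // invfM.
apply: ler_wpM2l; first by rewrite invr_ge0 sqrtr_ge0.
apply: rpow_neg_quarter_le; rewrite /t normrM normfV (gtr0_norm qr).
rewrite ler_pdivrMr // [leRHS]mulrC.
have : `|2 * e%:~R * (u 0 i)%:~R + 1| <= 2 * `|(u 0 i)%:~R : R| + 1.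
  apply: (le_trans (ler_normD _ _)); rewrite normr1 lerD2r !normrM.
  by rewrite -intr_norm e1 mulr1 ger0_norm.
have : `|(u 0 i)%:~R : R| ^+ 2 = (u 0 i)%:~R ^+ 2 by rewrite real_normK ?num_real.
move=> h1 h2; move: hr; rewrite -h1 [lyap_quad u * _]mulrC => h3.
have := sqr_ge0 (`|(u 0 i)%:~R : R| - 16); rewrite sqrrB; lra.
Qed.

Lemma lyap_gt0 u : 0 < lyap u.
Proof.
have [r0 _] := lyap_quad_ge u (Ordinal (ltn_trans (isT : (0 < 2)%N) d_gt2)).
by rewrite invr_gt0 !sqrtr_gt0.
Qed.

(** The terms of order [1 / r] add up to [- (d - 3) / (4 * r)], which vanishes in dimension three.
    The strict decrease comes from the constant in [lyap_quad], which contributes 204 = 3/16 * 4 *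
    272. *)
Lemma lyap_superharmonic u :
  \sum_i q i / 2 * (lyap (u + unit_vec i) + lyap (u - unit_vec i)) <=
  lyap u - lyap u * (\sum_i (q i)^-1) / lyap_quad u ^+ 2.
Proof.
have [r0 _] := lyap_quad_ge u (Ordinal (ltn_trans (isT : (0 < 2)%N) d_gt2)).
set r := lyap_quad u in r0 *; set S := \sum_i (q i)^-1.
have step i : q i / 2 * (lyap (u + unit_vec i) + lyap (u - unit_vec i)) <=
  lyap u * (q i - (4 * r)^-1
     + 3 / 16 * ((q i)^-1 + 4 * ((u 0 i)%:~R ^+ 2 / q i)) / r ^+ 2).
  have := @lyapD u i 1 erefl; rewrite scale1r => hp.
  have := @lyapD u i (-1) erefl; rewrite scaleN1r => hm.
  have k0 : 0 <= q i / 2 by rewrite divr_ge0 ?(ltW (q_gt0 i)).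
  apply: (le_trans (ler_wpM2l k0 (lerD hp hm))).
  rewrite -mulrDr mulrCA (ler_pM2l (lyap_gt0 u)) -/r le_eqVlt; apply/orP; left.
  by apply/eqP; field; rewrite !gt_eqF.
apply: (le_trans (ler_sum _ (fun i _ => step i))).
rewrite -mulr_sumr -mulrA -[X in X - _]mulr1 -mulrBr (ler_pM2l (lyap_gt0 u)).
have -> : \sum_i (q i - (4 * r)^-1
     + 3 / 16 * ((q i)^-1 + 4 * ((u 0 i)%:~R ^+ 2 / q i)) / r ^+ 2) =
  1 - d%:R / (4 * r) + 3 / 16 * (S + 4 * (r - lyap_cst)) / r ^+ 2.
  rewrite !big_split /= q_sum1; congr (_ + _ + _).
    by rewrite sumrN sumr_const card_ord [d%:R / _]mulr_natl.
  rewrite -mulr_suml -mulr_sumr big_split /= -mulr_sumr; congr (_ * (_ + 4 * _) / _).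
  by rewrite /r /lyap_quad addrAC subrr add0r.
have d3 : 3 <= d%:R :> R by rewrite (ler_nat _ 3).
rewrite -addrA lerD2l /lyap_cst -/S.
rewrite -subr_ge0.
have -> : - (S / r ^+ 2) - (- (d%:R / (4 * r)) + 3 / 16 * (S + 4 * (r - 272 * S)) / r ^+ 2)
  = ((d%:R - 3) * r / 4 + (204 - 19/16) * S) / r ^+ 2.
  by field; rewrite gt_eqF.
have := sum_invq_gt0; rewrite -/S => S0.
by rewrite divr_ge0 ?sqr_ge0 // addr_ge0 // !mulr_ge0 ?subr_ge0 ?(ltW S0) ?(ltW r0) //; lra.
Qed.

End Transience.

(* A dominates the return kernel of the walk: tilting by [tau ^ u] replaces the
   weights of the steps [e_i] and [- e_i] by at most the half of their sum, so
   that the superharmonic function of the symmetrized walk can be used. *)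
Lemma green_bound (d : nat) (R : realType) (p : 'rV[int]_d -> R) :
  (2 < d)%N -> jump_distribution p ->
  exists F : 'rV[int]_d -> R, (forall u, 0 <= F u) /\
    (forall u, (u == 0)%:R + \sum_(s <- unit_steps d) p s * F (u + s) <= F u).
Proof.
move=> d2 [p0 psupp p1 pgen].
pose a i := p (unit_vec i); pose b i := p (- unit_vec i).
pose q i := a i + b i.
have q1 : \sum_i q i = 1 by rewrite -p1 big_unit_steps.
(* Otherwise the support of [p] would lie in the subgroup of the points whose coordinate [i]
   vanishes. *)
have q0 i : 0 < q i.
  rewrite lt_neqAle addr_ge0 ?p0 // andbT eq_sym; apply/negP => /eqP qi.
  have ai : a i = 0 by have := p0 (unit_vec i); have := p0 (- unit_vec i); rewrite -/(a i) -/(b i) => ? ?; rewrite /q in qi; lra.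
  have bi : b i = 0 by rewrite /q ai add0r in qi.
  pose S : {pred 'rV[int]_d} := [pred z : 'rV[int]_d | z 0 i == 0].
  have Sz : zmod_closed S.
    split; first by rewrite inE mxE.
    by move=> x y; rewrite !inE !mxE => /eqP -> /eqP ->; rewrite subr0.
  have Sp z : p z != 0 -> z \in S.
    move=> pz; have := psupp _ pz; rewrite mem_cat => /orP[] /mapP[j _ zj];
    have [ij|ij] := eqVneq i j.
    - by move: pz; rewrite zj -ij -/(a i) ai eqxx.
    - by rewrite inE zj unit_vecE (negPf ij).
    - by move: pz; rewrite zj -ij -/(b i) bi eqxx.
    - by rewrite inE zj mxE unit_vecE (negPf ij) oppr0.
  by have := pgen S Sz Sp (unit_vec i); rewrite inE unit_vecE eqxx oner_eq0.
(* [tau = q / (2 * a)] turns the weight [a] into [q / 2], and [b] into [2 * a * b / q], which is at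
   most [q / 2] as [4 * a * b <= (a + b) ^ 2]. If [a = 0] then [q = b], and [tau = 2] does. *)
have /choice[tau htau] : forall i, exists t : R,
    [/\ 0 < t, a i * t <= q i / 2 & b i / t <= q i / 2].
  move=> i.
  have a0 : 0 <= a i by exact: p0.
  have b0 : 0 <= b i by exact: p0.
  have [az|an] := eqVneq (a i) 0.
    exists 2; split => //; first by rewrite az mul0r divr_ge0 ?(ltW (q0 i)).
    by rewrite /q az add0r.
  have {}a0 : 0 < a i by rewrite lt_neqAle eq_sym an.
  exists (q i / (2 * a i)); split.
  - by rewrite divr_gt0 // mulr_gt0.
  - by rewrite le_eqVlt; apply/orP; left; apply/eqP; field.
  - rewrite ler_pdivrMr ?divr_gt0 ?mulr_gt0 //.
    have -> : q i / 2 * (q i / (2 * a i)) = q i ^+ 2 / (4 * a i) by field.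
    rewrite ler_pdivlMr ?mulr_gt0 // /q; have := sqr_ge0 (a i - b i); lra.
pose chi (u : 'rV[int]_d) : R := \prod_i tau i ^ (u 0 i).
have tau0 i : 0 < tau i by case: (htau i).
have chi0 u : 0 < chi u by apply: prodr_gt0 => i _; rewrite exprz_gt0.
have chiD u i (e : int) : chi (u + e *: unit_vec i) = tau i ^ e * chi u.
  rewrite /chi (bigD1 i) //= [in RHS](bigD1 i) //= !mxE !eqxx mulr1 mulrA.
  congr (_ * _); first by rewrite addrC expfzDr ?gt_eqF.
  by apply: eq_bigr => j ji; rewrite !mxE (negPf ji) andbF mulr0 addr0.
(* A lower bound for the decrease at the origin; dividing by it leaves room for a unit source
   there. *)
pose c0 := lyap q 0 * (\sum_i (q i)^-1) / lyap_quad q 0 ^+ 2.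
have c00 : 0 < c0.
  have [r0 _] := lyap_quad_ge q0 d2 0 (Ordinal (ltn_trans (isT : (0 < 2)%N) d2)).
  apply: divr_gt0; last exact: exprn_gt0.
  by apply: mulr_gt0; [exact: lyap_gt0|exact: sum_invq_gt0].
exists (fun u => chi u * lyap q u / c0); split => u.
  apply: divr_ge0; last exact: ltW.
  by apply: mulr_ge0; apply: ltW; [exact: chi0|exact: lyap_gt0].
rewrite big_unit_steps.
have -> : (u == 0)%:R = chi u / c0 * ((u == 0)%:R * c0) :> R.
  have [->|_] := eqVneq u 0; last by rewrite mul0r mulr0.
  rewrite mul1r mulfVK ?gt_eqF // /chi big1 // => i _.
  by rewrite mxE expr0z.
have step i : a i * (chi (u + unit_vec i) * lyap q (u + unit_vec i) / c0) +
    b i * (chi (u - unit_vec i) * lyap q (u - unit_vec i) / c0) <=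
   chi u / c0 * (q i / 2 * (lyap q (u + unit_vec i) + lyap q (u - unit_vec i))).
  have := chiD u i 1; rewrite scale1r expr1z => ->.
  have := chiD u i (-1); rewrite scaleN1r exprN1 => ->.
  have [_ h1 h2] := htau i.
  have k0 : 0 < chi u / c0 by rewrite divr_gt0.
  have -> : a i * (tau i * chi u * lyap q (u + unit_vec i) / c0) =
    chi u / c0 * (a i * tau i * lyap q (u + unit_vec i)) by ring.
  have -> : b i * ((tau i)^-1 * chi u * lyap q (u - unit_vec i) / c0) =
    chi u / c0 * (b i / tau i * lyap q (u - unit_vec i)) by ring.
  rewrite -mulrDr (ler_pM2l k0) mulrDr lerD //; apply: ler_wpM2r => //;
    exact/ltW/lyap_gt0.
apply: (le_trans (lerD (lexx _) (ler_sum _ (fun i _ => step i)))).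
have k0 : 0 < chi u / c0 by exact: divr_gt0.
rewrite -mulr_sumr -mulrDr [leRHS]mulrAC (ler_pM2l k0).
have := lyap_superharmonic q0 q1 d2 u.
set X := \sum_i _; move=> hX.
apply: (le_trans (lerD (lexx _) hX)).
rewrite addrCA gerDl subr_le0.
have h0 : 0 <= lyap q u * (\sum_i (q i)^-1) / lyap_quad q u ^+ 2.
  apply: divr_ge0; last exact: sqr_ge0.
  by apply: mulr_ge0; apply: ltW; [exact: lyap_gt0|exact: sum_invq_gt0].
by have [->|_] := eqVneq u 0; rewrite ?mul1r ?mul0r.
Qed.

(** * Toppling operators *)

Section Toppling.
Variables (d : nat) (R : realType) (p : 'rV[int]_d -> R).
Hypothesis pJ : jump_distribution p.
Local Notation site := 'rV[int]_d.
Local Notation steps := (unit_steps d).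

(* A configuration together with the number of jumps made from a fixed site. *)
Definition state := (config d * nat)%type.

Definition legal (y : site) (S : state) : bool := (0 < active (S.1 y))%N.
Definition slp (y : site) (S : state) : state := (sleep_at y S.1, S.2).
Definition jump (o y s : site) (S : state) : state :=
  (move y (y + s) S.1, (S.2 + (y == o))%N).

(** The sleep probability may depend on the site, so that sleep can be forbidden at one of them. *)
Definition topple (o : site) (sl : site -> R) (y : site) (f : state -> R)
    (S : state) : R :=
  sl y * f (slp y S) + (1 - sl y) * \sum_(s <- steps) p s * f (jump o y s S).

Lemma moveE (y t : site) (eta : config d) u : move y t eta u =
  if u == y then sub_one (eta u) else if u == t then add_one (eta u) else eta u.
Proof. by rewrite /move; case: eqVneq => [->|_] //; case: eqVneq => [->|]. Qed.

Lemma sleep_atE (y : site) (eta : config d) u : sleep_at y eta u =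
  if u == y then mul_sleep (eta u) else eta u.
Proof. by rewrite /sleep_at; case: eqVneq => [->|]. Qed.

(** The abelian property at one site: as [s + 1 = 2], a sleep instruction commutes with the arrival
    of a particle wherever an active particle is present. At a vacant site it would not. *)
Lemma mul_sleep_add a : (0 < active a)%N ->
  mul_sleep (add_one a) = add_one (mul_sleep a).
Proof. by case: a => // -[|[|n]]. Qed.

Lemma sub_one_add a : (0 < active a)%N -> sub_one (add_one a) = add_one (sub_one a).
Proof. by case: a => // -[|n]. Qed.

Lemma slpC y y' S : y != y' -> slp y (slp y' S) = slp y' (slp y S).
Proof.
move=> yy'; congr pair; apply/funext => u; rewrite /= !sleep_atE.
by have [->|//] := eqVneq u y; rewrite (negPf yy').
Qed.

Lemma slp_jump o y y' s S : y != y' -> legal y S ->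
  slp y (jump o y' s S) = jump o y' s (slp y S).
Proof.
move=> yy' ly; congr pair; apply/funext => u.
rewrite /= sleep_atE !moveE sleep_atE.
have [->|//] := eqVneq u y; rewrite (negPf yy').
by case: ifP => // _; rewrite mul_sleep_add.
Qed.

Lemma jumpC o y y' s s' S : y != y' -> legal y S -> legal y' S ->
  jump o y s (jump o y' s' S) = jump o y' s' (jump o y s S).
Proof.
move=> yy' ly ly'; congr pair; last by rewrite /= addnAC.
apply/funext => u; rewrite /= !moveE.
have [->|uy] := eqVneq u y.
  by rewrite (negPf yy'); case: ifP => // _; rewrite sub_one_add.
have [->|uy'] := eqVneq u y'.
  by case: ifP => // _; rewrite sub_one_add.
by case: eqP => // _; case: eqP.
Qed.

Lemma legal_slp y y' S : y != y' -> legal y (slp y' S) = legal y S.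
Proof. by move=> yy'; rewrite /legal /= sleep_atE (negPf yy'). Qed.

Lemma active_add a : (active a <= active (add_one a))%N.
Proof. by case: a => [n|] //=. Qed.

Lemma legal_jump o y y' s S : y != y' -> legal y S -> legal y (jump o y' s S).
Proof.
move=> yy'; rewrite /legal /= moveE (negPf yy'); case: ifP => // _ h.
exact: leq_trans h (active_add _).
Qed.

Section Operator.
Variables (o : site) (sl : site -> R) (s0 : R).
Hypothesis sl_ge0 : forall y, 0 <= sl y.
Hypothesis s0_lt1 : s0 < 1.
Hypothesis sl_le : forall y, sl y <= s0.

Let osl_ge0 y : 0 <= 1 - sl y.
Proof. by rewrite subr_ge0 (le_trans (sl_le y)) ?ltW. Qed.

(** The sleep branch is compared only if it has positive weight: when sleep is forbidden at [z],
    this preserves comparisons that hold only while no particle sleeps at [z]. *)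
Lemma topple_le2 y f g S S' : (sl y != 0 -> f (slp y S) <= g (slp y S')) ->
  (forall s, s \in steps -> f (jump o y s S) <= g (jump o y s S')) ->
  topple o sl y f S <= topple o sl y g S'.
Proof.
move=> h1 h2; apply: lerD.
  have [->|sn] := eqVneq (sl y) 0; first by rewrite !mul0r.
  by apply: ler_wpM2l => //; exact: h1.
apply: ler_wpM2l => //.
rewrite big_seq [leRHS]big_seq; apply: ler_sum => s hs.
by apply: ler_wpM2l; [case: pJ => ? _ _ _|exact: h2].
Qed.

Lemma topple_le y f g S : (sl y != 0 -> f (slp y S) <= g (slp y S)) ->
  (forall s, s \in steps -> f (jump o y s S) <= g (jump o y s S)) ->
  topple o sl y f S <= topple o sl y g S.
Proof. exact: topple_le2. Qed.

Lemma topple_le_all y f g S : (forall S, f S <= g S) ->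
  topple o sl y f S <= topple o sl y g S.
Proof. by move=> h; apply: topple_le. Qed.

Lemma topple_lin y (a b : R) f S :
  topple o sl y (fun S' => a + b * f S') S = a + b * topple o sl y f S.
Proof.
rewrite /topple; under eq_bigr => s _ do rewrite mulrDr mulrCA.
rewrite big_split /= -mulr_suml -mulr_sumr; case: pJ => _ _ -> _.
by ring.
Qed.

Lemma topple_add y f g S : topple o sl y (fun S' => f S' + g S') S =
  topple o sl y f S + topple o sl y g S.
Proof.
rewrite /topple; under eq_bigr => s _ do rewrite mulrDr.
by rewrite big_split /=; ring.
Qed.

Lemma topple_sum (I : Type) (r : seq I) (f : I -> state -> R) y S :
  topple o sl y (fun S' => \sum_(i <- r) f i S') S =
  \sum_(i <- r) topple o sl y (f i) S.
Proof.
elim: r => [|i r IH].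
  by rewrite /topple !big_nil mulr0 add0r big1 ?mulr0 // => s _; rewrite big_nil mulr0.
rewrite big_cons -IH -topple_add; congr (topple _ _ _ _ _).
by apply/funext => S'; rewrite big_cons.
Qed.

Lemma topple2E y y' f S : topple o sl y (topple o sl y' f) S =
  sl y * sl y' * f (slp y' (slp y S))
  + sl y * (1 - sl y') * (\sum_(s <- steps) p s * f (jump o y' s (slp y S)))
  + (1 - sl y) * sl y' * (\sum_(s <- steps) p s * f (slp y' (jump o y s S)))
  + (1 - sl y) * (1 - sl y') * (\sum_(s <- steps) \sum_(s' <- steps)
       p s * p s' * f (jump o y' s' (jump o y s S))).
Proof.
have -> : topple o sl y (topple o sl y' f) S =
  sl y * topple o sl y' f (slp y S) + (1 - sl y) *
  (sl y' * (\sum_(s <- steps) p s * f (slp y' (jump o y s S))) +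
   (1 - sl y') * (\sum_(s <- steps) \sum_(s' <- steps)
       p s * p s' * f (jump o y' s' (jump o y s S)))).
  rewrite /(topple _ _ y); congr (_ + _ * _).
  rewrite !mulr_sumr -big_split; apply: eq_bigr => s _ /=.
  rewrite /topple mulrDr mulrCA [p s * ((1 - _) * _)]mulrCA; congr (_ + _ * _).
  by rewrite mulr_sumr; apply: eq_bigr => s' _; rewrite mulrA.
by rewrite /topple; ring.
Qed.

Lemma toppleC y y' f S : y != y' -> legal y S -> legal y' S ->
  topple o sl y (topple o sl y' f) S = topple o sl y' (topple o sl y f) S.
Proof.
move=> yy' ly ly'; have y'y : y' != y by rewrite eq_sym.
rewrite !topple2E (slpC _ yy').
have -> : \sum_(s <- steps) p s * f (jump o y' s (slp y S)) =
    \sum_(s <- steps) p s * f (slp y (jump o y' s S)).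
  by apply: eq_bigr => s _; rewrite slp_jump.
have -> : \sum_(s <- steps) p s * f (jump o y s (slp y' S)) =
    \sum_(s <- steps) p s * f (slp y' (jump o y s S)).
  by apply: eq_bigr => s _; rewrite slp_jump.
have -> : \sum_(s <- steps) \sum_(s' <- steps) p s * p s' * f (jump o y s' (jump o y' s S)) =
    \sum_(s <- steps) \sum_(s' <- steps) p s * p s' * f (jump o y' s' (jump o y s S)).
  rewrite exchange_big; apply: eq_bigr => s _; apply: eq_bigr => s' _ /=.
  by rewrite jumpC // [p s' * _]mulrC.
by ring.
Qed.

Section Value.
Variables (W : seq site) (f : state -> R).

(* Optimal mean of [f] when at most [n] legal topplings in [W] may be made.  For
   the [f] used below a toppling never decreases the mean of [f], so that [value]
   is the mean of [f] after the stabilization of [W], in whatever order. *)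
Fixpoint stopval (n : nat) (S : state) : R :=
  if n is n'.+1 then
    \big[Num.max/stopval n' S]_(y <- W | legal y S) topple o sl y (stopval n') S
  else f S.

Definition value (S : state) : R := limn (fun n => stopval n S).

Lemma stopval_S n S : stopval n S <= stopval n.+1 S.
Proof. exact: bigmax_ge_id. Qed.

Lemma stopval_homo S : {homo (fun n => stopval n S) : n m / (n <= m)%N >-> n <= m}.
Proof. by apply: homo_leq => // [? ? ?|n]; [exact: le_trans|exact: stopval_S]. Qed.

Lemma topple_stopval_le n y S : y \in W -> legal y S ->
  topple o sl y (stopval n) S <= stopval n.+1 S.
Proof.
move=> yW ly.
exact: (@Order.TotalTheory.le_bigmax_seq _ _ _ _ _ y (fun y => legal y S)
  (fun y => topple o sl y (stopval n) S)).
Qed.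

Lemma stopval_le n S b : (stopval n S <= b) ->
  (forall y, y \in W -> legal y S -> topple o sl y (stopval n) S <= b) ->
  stopval n.+1 S <= b.
Proof.
move=> h0 h; rewrite /= big_seq_cond; apply: bigmax_le => // y /andP[yW ly].
exact: h.
Qed.

Lemma stopval_stable n S : (forall y, y \in W -> ~~ legal y S) -> stopval n S = f S.
Proof.
move=> h; elim: n => // n IH; apply/eqP; rewrite eq_le -{2}IH stopval_S andbT.
by apply: stopval_le => [|y yW ly]; [rewrite IH|have := h _ yW; rewrite ly].
Qed.

Section Abelian.
Hypothesis fsub : forall y S, y \in W -> legal y S -> f S <= topple o sl y f S.

(* Topplings at distinct sites commute and one does not make the other illegal,
   so a legal toppling may be performed first. *)
Lemma stopval_le_topple n y S : y \in W -> legal y S ->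
  stopval n S <= topple o sl y (stopval n) S.
Proof.
elim: n y S => [|n IH] y S yW ly; first exact: fsub.
apply: stopval_le => [|y' y'W ly'].
  apply: (le_trans (IH _ _ yW ly)); apply: topple_le_all => S'; exact: stopval_S.
have [->|yy'] := eqVneq y' y.
  by apply: topple_le_all => S'; exact: stopval_S.
apply: (@le_trans _ _ (topple o sl y' (topple o sl y (stopval n)) S)).
  apply: topple_le => [_|s _]; apply: IH => //.
  - by rewrite legal_slp 1?eq_sym.
  - by apply: legal_jump; rewrite 1?eq_sym.
rewrite toppleC //; apply: topple_le => [_|s _]; apply: topple_stopval_le => //.
- by rewrite legal_slp.
- exact: legal_jump.
Qed.

Variable Xi : state -> R.
Hypothesis Xi_f : forall S, f S <= Xi S.
Hypothesis Xi_sup : forall y S, y \in W -> legal y S -> topple o sl y Xi S <= Xi S.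

Lemma stopval_le_sup n S : stopval n S <= Xi S.
Proof.
elim: n S => [|n IH] S; first exact: Xi_f.
apply: stopval_le => // y yW ly; apply: le_trans (Xi_sup yW ly).
exact: topple_le_all.
Qed.

Lemma value_cvg S : stopval n S @[n --> \oo] --> value S.
Proof.
apply: nondecreasing_is_cvgn; first exact: stopval_homo.
by exists (Xi S) => _ [n _ <-]; exact: stopval_le_sup.
Qed.

Lemma stopval_le_value n S : stopval n S <= value S.
Proof.
apply: (@nondecreasing_cvgn_le _ (fun n => stopval n S)); first exact: stopval_homo.
exact: cvgP (@value_cvg S).
Qed.

Lemma value_le S b : (forall n, stopval n S <= b) -> value S <= b.
Proof.
move=> h; apply: limr_le; first exact: cvgP (@value_cvg S).
exact: nearW.
Qed.

Lemma value_le_sup S : value S <= Xi S.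
Proof. by apply: value_le => n; exact: stopval_le_sup. Qed.

Lemma value_stable S : (forall y, y \in W -> ~~ legal y S) -> value S = f S.
Proof.
move=> h; apply/eqP; rewrite eq_le -{2}(stopval_stable 0 h) stopval_le_value andbT.
by apply: value_le => n; rewrite stopval_stable.
Qed.

Lemma topple_cvg y (F : nat -> state -> R) G S :
  (forall S, F n S @[n --> \oo] --> G S) ->
  topple o sl y (F n) S @[n --> \oo] --> topple o sl y G S.
Proof.
move=> h; apply: cvgD; first by apply: cvgM; [exact: cvg_cst|exact: h].
apply: cvgM; first exact: cvg_cst.
elim: steps => [|s r IH].
  by under eq_cvg => n do rewrite big_nil; rewrite big_nil; exact: cvg_cst.
under eq_cvg => n do rewrite big_cons; rewrite big_cons.
by apply: cvgD => //; apply: cvgM; [exact: cvg_cst|exact: h].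
Qed.

(** Abelian property in mean. Making a given toppling first loses nothing, by [stopval_le_topple],
    and gains nothing, being one of the choices over which [stopval] maximizes. *)
Lemma value_topple y S : y \in W -> legal y S -> value S = topple o sl y value S.
Proof.
move=> yW ly; have cT := @topple_cvg y stopval value S value_cvg.
apply/eqP; rewrite eq_le; apply/andP; split.
  apply: value_le => n; apply: (le_trans (stopval_le_topple n yW ly)).
  by apply: topple_le_all => S'; exact: stopval_le_value.
rewrite -(cvg_lim _ cT) //; apply: limr_le; first exact: cvgP cT.
apply: nearW => n; apply: (le_trans (topple_stopval_le n yW ly)).
exact: stopval_le_value.
Qed.

End Abelian.
End Value.
End Operator.

(** A function of the configuration alone does not see the counter, so the site at which jumps are
    counted may be changed. *)
Lemma stopval_cfg (o o' : site) (sl : site -> R) W (g : config d -> R) n eta m m' :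
  stopval o sl W (fun S => g S.1) n (eta, m) = stopval o' sl W (fun S => g S.1) n (eta, m').
Proof.
elim: n eta m m' => [|n IH] eta m m' //=.
rewrite (IH _ m m'); congr (bigop _ _ _); apply/funext => y; congr (BigBody _ _ _ _).
rewrite /topple /slp /jump /= (IH _ m m'); congr (_ + _ * _).
by apply: eq_bigr => s _; rewrite (IH _ _ (m' + (y == o'))%N).
Qed.

End Toppling.

(** * Monotonicity in the configuration and linear functionals of the particles *)

Section Order.
Variables (d : nat) (R : realType) (p : 'rV[int]_d -> R).
Hypothesis pJ : jump_distribution p.
Local Notation site := 'rV[int]_d.
Local Notation steps := (unit_steps d).

(* The rank realizes the order 0 < s < 1 < 2 < ... *)
Definition rank (a : site_state) : nat :=
  match a with Act 0 => 0 | Sleep => 1 | Act n => n.+1 end.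

Lemma rank_active a b : (rank a <= rank b)%N -> (0 < active a)%N -> (0 < active b)%N.
Proof. by case: a => [[|a]|]; case: b => [[|b]|]. Qed.

Lemma rank_add a b : (rank a <= rank b)%N -> (rank (add_one a) <= rank (add_one b))%N.
Proof. by case: a => [[|a]|]; case: b => [[|b]|]. Qed.

Lemma rank_sub a b : (rank a <= rank b)%N -> (0 < active a)%N ->
  (rank (sub_one a) <= rank (sub_one b))%N.
Proof. by case: a => [[|[|a]]|]; case: b => [[|[|b]]|]. Qed.

Lemma rank_mul a b : (rank a <= rank b)%N -> (rank (mul_sleep a) <= rank (mul_sleep b))%N.
Proof. by case: a => [[|[|a]]|]; case: b => [[|[|b]]|]. Qed.

Lemma rank_mul_sleep a : (rank (mul_sleep a) <= rank a)%N.
Proof. by case: a => [[|[|a]]|]. Qed.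

Lemma rank_add_one a : (rank a <= rank (add_one a))%N.
Proof. by case: a => [[|[|a]]|]. Qed.

Variable W : seq site.

(** Only [W] is compared, as no toppling is made elsewhere. *)
Definition leS (S S' : state d) : Prop :=
  (forall u, u \in W -> (rank (S.1 u) <= rank (S'.1 u))%N) /\ (S.2 <= S'.2)%N.

Lemma leS_slp y S S' : leS S S' -> leS (slp y S) (slp y S').
Proof.
move=> [h1 h2]; split => // u uW; rewrite /= !sleep_atE; case: ifP => _; last exact: h1.
exact/rank_mul/h1.
Qed.

Lemma leS_jump o y s S S' : y \in W -> legal y S -> leS S S' ->
  leS (jump o y s S) (jump o y s S').
Proof.
move=> yW ly [h1 h2]; split; last by rewrite /= leq_add2r.
move=> u uW; rewrite /= !moveE; case: eqVneq => [uy|_].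
  by apply: rank_sub; [exact: h1|rewrite uy].
by case: ifP => _; [apply: rank_add|]; exact: h1.
Qed.

Section Monotone.
Variables (o : site) (sl : site -> R) (s0 : R).
Hypothesis sl_ge0 : forall y, 0 <= sl y.
Hypothesis s0_lt1 : s0 < 1.
Hypothesis sl_le : forall y, sl y <= s0.

Lemma stopval_mono (g : nat -> R) n S S' : {homo g : a b / (a <= b)%N >-> a <= b} ->
  leS S S' ->
  stopval p o sl W (fun S => g S.2) n S <= stopval p o sl W (fun S => g S.2) n S'.
Proof.
move=> hg; elim: n S S' => [|n IH] S S' h; first by apply: hg; case: h.
apply: stopval_le => [|y yW ly]; first by apply: (le_trans (IH _ _ h)); exact: stopval_S.
have ly' : legal y S' by move: ly; apply: rank_active; case: h => h _; exact: h.
apply: le_trans (topple_stopval_le p o sl (fun S => g S.2) n yW ly').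
apply: (topple_le2 pJ sl_ge0 s0_lt1 sl_le) => [_|s _]; apply: IH.
  exact: leS_slp.
exact: leS_jump.
Qed.

Lemma stopval_shift_le n eta m : stopval p o sl W (fun S => S.2%:R) n (eta, m.+1) <=
  stopval p o sl W (fun S => S.2%:R) n (eta, m) + 1.
Proof.
elim: n eta m => [|n IH] eta m; first by rewrite /= -natr1.
apply: stopval_le => [|y yW ly].
  by apply: (le_trans (IH _ _)); rewrite lerD2r; exact: stopval_S.
apply: le_trans (lerD (topple_stopval_le p o sl (fun S => S.2%:R) n yW (ly : legal y (eta, m))) (lexx 1)).
have := topple_lin pJ o sl y 1 1 (stopval p o sl W (fun S => S.2%:R) n) (eta, m).
rewrite mul1r [1 + _]addrC => <-.
by apply: (topple_le2 pJ sl_ge0 s0_lt1 sl_le) => [_|s _]; rewrite mul1r addrC; exact: IH.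
Qed.

End Monotone.

Lemma particles_sleep y (S : state d) u :
  particles (sleep_at y S.1 u) = particles (S.1 u).
Proof. by rewrite sleep_atE; case: ifP => // _; case: (S.1 u) => // -[|[|n]]. Qed.

Lemma particles_move (y s : site) (eta : config d) u : (0 < active (eta y))%N ->
  s != 0 ->
  (particles (move y (y + s) eta u))%:R =
  (particles (eta u))%:R + (u == y + s)%:R - (u == y)%:R :> R.
Proof.
move=> ly s0; rewrite moveE; have [->|uy] := eqVneq u y.
  rewrite (_ : (y == y + s) = false); last first.
    by apply/negbTE; rewrite -subr_eq0 opprD addrA subrr sub0r oppr_eq0.
  by move: ly; case: (eta y) => // -[|n] //= _; rewrite addr0 -natr1 addrK.
rewrite subr0; case: ifP => _; last by rewrite addr0.
by case: (eta u) => [n|] /=; rewrite ?natr1 -?natrD.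
Qed.

Definition pot (w : site -> R) (eta : config d) : R :=
  \sum_(u <- W) (particles (eta u))%:R * w u.

Hypothesis W_uniq : uniq W.

Lemma sum_eq_mem (w : site -> R) a : \sum_(u <- W) (u == a)%:R * w u = (a \in W)%:R * w a.
Proof.
have [aW|aW] := boolP (a \in W).
  rewrite (bigD1_seq a) //= eqxx big1 ?addr0 // => u /negPf ->; by rewrite mul0r.
rewrite mul0r big_seq big1 // => u uW; case: eqVneq => [ua|]; last by rewrite mul0r.
by move: aW; rewrite -ua uW.
Qed.

Lemma pot_sleep w y (S : state d) : pot w (slp y S).1 = pot w S.1.
Proof. by apply: eq_bigr => u _; rewrite particles_sleep. Qed.

Lemma pot_jump w o y s (S : state d) : legal y S -> s \in steps -> y \in W ->
  pot w (jump o y s S).1 = pot w S.1 + (y + s \in W)%:R * w (y + s) - w y.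
Proof.
move=> ly hs yW; rewrite /pot /=.
under eq_bigr => u _ do rewrite particles_move ?unit_steps_neq0 // mulrBl mulrDl.
by rewrite sumrB big_split /= !sum_eq_mem yW mul1r.
Qed.

(** Particles leaving [W] disappear from [pot], so a toppling at [y] acts on [w] as the generator of
    the walk killed outside of [W]. *)
Lemma topple_pot w o sl y S : legal y S -> y \in W ->
  topple p o sl y (fun S => pot w S.1) S =
  pot w S.1 + (1 - sl y) * (\sum_(s <- steps) p s * ((y + s \in W)%:R * w (y + s)) - w y).
Proof.
move=> ly yW; rewrite /topple pot_sleep; set A := \sum_(s <- steps) p s * (_ * _).
suff -> : \sum_(s <- steps) p s * pot w (jump o y s S).1 = pot w S.1 + A - w y by ring.
have -> : pot w S.1 + A - w y = \sum_(s <- steps)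
    p s * (pot w S.1 + (y + s \in W)%:R * w (y + s) - w y).
  under [RHS]eq_bigr => s _ do rewrite mulrBr mulrDr.
  rewrite sumrB big_split /= -!mulr_suml; case: pJ => _ _ -> _.
  by rewrite !mul1r.
by apply: eq_big_seq => s hs; rewrite pot_jump.
Qed.

Lemma pot_ge0 w eta : (forall u, 0 <= w u) -> 0 <= pot w eta.
Proof. by move=> w0; apply: sumr_ge0 => u _; apply: mulr_ge0. Qed.

End Order.

(* [Phi] bounds the expected number of steps left before the inequality
   [0 <= Delta] is known, so a bounded [Delta] which dominates its mean after
   each step is nonnegative. *)
Lemma minorant (T : Type) (R : realType) (D : T -> Prop) (Phi Delta : T -> R) (C : R) :
  0 <= C -> (forall x, D x -> 1 <= Phi x) -> (forall x, D x -> - C <= Delta x) ->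
  (forall x, D x -> 0 <= Delta x \/ forall e, 0 <= e ->
     (forall x', D x' -> - (e * Phi x') <= Delta x') ->
     - (e * (Phi x - 1)) <= Delta x) ->
  forall x, D x -> 0 <= Delta x.
Proof.
move=> C0 Phi1 DC step.
(* If [n + 2 <= Phi x], the bound by [C] is already good enough. Otherwise one step multiplies the
   error by [(Phi x - 1) / Phi x], which is at most [(n + 1) / (n + 2)]. *)
have key n x : D x -> - (C / n.+1%:R * Phi x) <= Delta x.
  elim: n x => [|n IH] x Dx; have P1 := Phi1 x Dx.
    by apply: le_trans (DC _ Dx); rewrite divr1 lerN2; exact: ler_peMr.
  have [h|h] := step x Dx.
    apply: le_trans h; rewrite oppr_le0 mulr_ge0 ?divr_ge0 //.
    exact: le_trans P1.
  have n0 : 0 < n.+2%:R :> R by [].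
  have [Pn|Pn] := lerP n.+2%:R (Phi x).
    apply: le_trans (DC _ Dx); rewrite lerN2 mulrAC ler_pdivlMr //.
    exact: ler_wpM2l.
  apply: le_trans (h (C / n.+1%:R) _ IH); last by rewrite divr_ge0.
  rewrite lerN2 -subr_ge0 -(natr1 n.+1).
  have -> : C / (n.+1%:R + 1) * Phi x - C / n.+1%:R * (Phi x - 1) =
      C * (n.+1%:R + 1 - Phi x) / ((n.+1%:R + 1) * n.+1%:R).
    by field; rewrite -natr1 in n0; rewrite !gt_eqF //; have := ler0n R n; lra.
  have n1 : 0 <= n.+1%:R :> R by [].
  apply: divr_ge0; last by apply: mulr_ge0 => //; lra.
  by apply: mulr_ge0 => //; rewrite subr_ge0 natr1 ltW.
move=> x Dx; rewrite leNgt; apply/negP => Dl.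
have P1 := Phi1 x Dx.
have := archi_boundP (divr_ge0 (mulr_ge0 C0 (le_trans ler01 P1)) (ltW (_ : 0 < - Delta x))).
rewrite oppr_gt0 => /(_ Dl); set m := Num.bound _ => hm.
have := key m x Dx; rewrite leNgt => /negP; apply.
rewrite ltrNr mulrAC ltr_pdivrMr //; move: hm.
rewrite ltr_pdivrMr ?oppr_gt0 // => /lt_le_trans; apply.
rewrite [leRHS]mulrC; apply: ler_wpM2r; last by rewrite ler_nat.
by rewrite oppr_ge0 ltW.
Qed.

(** * Probability that a site ends up with a sleeping particle *)

Section Sleep.
Variables (d : nat) (R : realType) (p : 'rV[int]_d -> R).
Hypothesis pJ : jump_distribution p.
Local Notation site := 'rV[int]_d.
Local Notation steps := (unit_steps d).
Variable F : site -> R.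
Hypothesis F_ge0 : forall u, 0 <= F u.
Hypothesis F_sup : forall u, (u == 0)%:R + \sum_(s <- steps) p s * F (u + s) <= F u.
Variable lambda : R.
Hypothesis lambda_gt0 : 0 < lambda.
Variable W : seq site.
Hypothesis W_uniq : uniq W.

Let p_ge0 s : 0 <= p s. Proof. by case: pJ. Qed.
Let p_sum : \sum_(s <- steps) p s = 1. Proof. by case: pJ. Qed.

Definition sleep_prob : R := lambda / (1 + lambda).

Let l1_gt0 : 0 < 1 + lambda. Proof. by rewrite addr_gt0. Qed.

Lemma one_sub_sleep_prob : 1 - sleep_prob = (1 + lambda)^-1.
Proof. by rewrite /sleep_prob; field; rewrite gt_eqF. Qed.

Lemma sleep_prob_ge0 : 0 <= sleep_prob.
Proof. by rewrite divr_ge0 // ltW. Qed.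

Lemma sleep_prob_lt1 : sleep_prob < 1.
Proof. by rewrite -subr_gt0 one_sub_sleep_prob invr_gt0. Qed.

(** An upper bound for the mean time that the walk from [y] spends in [W]. *)
Definition exit_time (y : site) : R := \sum_(v <- W) F (y - v).

Lemma exit_time_ge0 y : 0 <= exit_time y. Proof. exact: sumr_ge0. Qed.

Lemma exit_time_sup y : y \in W ->
  1 + \sum_(s <- steps) p s * exit_time (y + s) <= exit_time y.
Proof.
move=> yW; apply: (@le_trans _ _ (\sum_(v <- W) ((y - v == 0)%:R +
  \sum_(s <- steps) p s * F (y - v + s)))); last exact: ler_sum.
rewrite big_split /=; apply: lerD.
  by rewrite (bigD1_seq y) //= subrr eqxx lerDl sumr_ge0.
rewrite exchange_big /=; under eq_bigr => s _ do rewrite mulr_sumr.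
by apply: ler_sum => s _; apply: ler_sum => v _; rewrite addrAC.
Qed.

(** A toppling is a jump with probability at least [1 / (1 + lambda)], whence the factor. The added
    one gives the lower bound that [minorant] requires of [Phi]. *)
Definition steps_left (S : state d) : R := 1 + (1 + lambda) * pot W exit_time S.1.

Lemma steps_left_ge1 S : 1 <= steps_left S.
Proof. by rewrite lerDl mulr_ge0 ?pot_ge0 //; [exact: ltW|exact: exit_time_ge0]. Qed.

Lemma topple_steps_left o sl y S : (forall y, sl y <= sleep_prob) ->
  y \in W -> legal y S ->
  topple p o sl y steps_left S <= steps_left S - 1.
Proof.
move=> hsl yW ly; rewrite /steps_left topple_lin // topple_pot //.
rewrite -subr_ge0.
set A := \sum_(s <- steps) _.
have hA : A - exit_time y <= -1.
  rewrite -(lerD2r 1) addrAC addNr subr_le0 addrC.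
  apply: le_trans (exit_time_sup yW); rewrite lerD2l.
  apply: ler_sum => s _; apply: ler_wpM2l => //; case: (_ \in _).
    by rewrite mul1r.
  by rewrite mul0r exit_time_ge0.
have h1 : 1 <= (1 + lambda) * (1 - sl y).
  rewrite -[leLHS](mulfV (lt0r_neq0 l1_gt0)); apply: ler_wpM2l; first exact: ltW.
  by rewrite -one_sub_sleep_prob lerB.
nra.
Qed.

Definition real_sleep (_ : site) : R := sleep_prob.
Definition strong_sleep (z y : site) : R := if y == z then 0 else sleep_prob.

Lemma strong_sleep_ge0 z y : 0 <= strong_sleep z y.
Proof. by rewrite /strong_sleep; case: ifP => // _; exact: sleep_prob_ge0. Qed.

Lemma strong_sleep_le z y : strong_sleep z y <= sleep_prob.
Proof. by rewrite /strong_sleep; case: ifP => // _; exact: sleep_prob_ge0. Qed.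

Lemma real_sleep_ge0 y : 0 <= real_sleep y. Proof. exact: sleep_prob_ge0. Qed.
Lemma real_sleep_le y : real_sleep y <= sleep_prob. Proof. exact: lexx. Qed.

Section Site.
Variable z : site.
Hypothesis zW : z \in W.

Definition jumps (S : state d) : R := (S.2)%:R.

(* Expected number of jumps from [z] when a particle never sleeps at [z]. *)
Definition strong_jumps : state d -> R := value p z (strong_sleep z) W jumps.

Let ssl0 := strong_sleep_ge0 z.
Let ssl1 := strong_sleep_le z.
Let s01 := sleep_prob_lt1.

Lemma jumps_sub y S : y \in W -> legal y S ->
  jumps S <= topple p z (strong_sleep z) y jumps S.
Proof.
move=> yW ly; rewrite -[leLHS]mul1r -[X in X * _](subrK (strong_sleep z y)) mulrDl addrC.
apply: lerD => //; apply: ler_wpM2l; first by rewrite subr_ge0 (le_trans (ssl1 y)) ?ltW.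
rewrite -[leLHS]mul1r -p_sum mulr_suml; apply: ler_sum => s _.
by apply: ler_wpM2l => //; rewrite /jumps ler_nat leq_addr.
Qed.

Definition jumps_bound (S : state d) : R := jumps S + pot W (fun u => F (u - z)) S.1.

Lemma jumps_le_bound S : jumps S <= jumps_bound S.
Proof. by rewrite lerDl pot_ge0. Qed.

Lemma topple_jumps o sl y S : topple p o sl y jumps S = jumps S + (1 - sl y) * (y == o)%:R.
Proof.
rewrite /topple /jumps /=; under eq_bigr => s _ do rewrite natrD.
by rewrite -mulr_suml p_sum; ring.
Qed.

Lemma jumps_bound_sup y S : y \in W -> legal y S ->
  topple p z (strong_sleep z) y jumps_bound S <= jumps_bound S.
Proof.
move=> yW ly; rewrite /jumps_bound topple_add // topple_jumps topple_pot //.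
rewrite -addrA lerD2l addrCA gerDl -mulrDr; apply: mulr_ge0_le0.
  by rewrite subr_ge0 (le_trans (ssl1 y)) ?ltW.
rewrite addrA subr_le0; apply: le_trans (F_sup (y - z)); rewrite subr_eq0 lerD2l.
apply: ler_sum => s _; apply: ler_wpM2l => //; case: (_ \in _).
  by rewrite mul1r addrAC.
by rewrite mul0r.
Qed.

Lemma strong_jumps_topple y S : y \in W -> legal y S ->
  strong_jumps S = topple p z (strong_sleep z) y strong_jumps S.
Proof. exact: (value_topple pJ ssl0 s01 ssl1 jumps_sub jumps_le_bound jumps_bound_sup). Qed.

Lemma strong_jumps_ge S : jumps S <= strong_jumps S.
Proof. exact: (stopval_le_value pJ ssl0 s01 ssl1 jumps_le_bound jumps_bound_sup 0). Qed.

Lemma strong_jumps_le_bound S : strong_jumps S <= jumps_bound S.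
Proof. exact: (value_le_sup pJ ssl0 s01 ssl1 jumps_le_bound jumps_bound_sup). Qed.

Lemma strong_jumps_stable S : (forall y, y \in W -> ~~ legal y S) ->
  strong_jumps S = jumps S.
Proof. exact: (value_stable pJ ssl0 s01 ssl1 jumps_le_bound jumps_bound_sup). Qed.

Lemma strong_jumps_mono S S' : leS W S S' -> strong_jumps S <= strong_jumps S'.
Proof.
move=> h; apply: (value_le pJ ssl0 s01 ssl1 jumps_le_bound jumps_bound_sup) => n.
apply: le_trans (stopval_le_value pJ ssl0 s01 ssl1 jumps_le_bound jumps_bound_sup n S').
have hg : {homo (fun a : nat => a%:R : R) : a b / (a <= b)%N >-> a <= b}.
  by move=> a b; rewrite ler_nat.
exact: (stopval_mono pJ z ssl0 s01 ssl1 n hg h).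
Qed.

Lemma strong_jumps_shift eta m : strong_jumps (eta, m.+1) <= strong_jumps (eta, m) + 1.
Proof.
apply: (value_le pJ ssl0 s01 ssl1 jumps_le_bound jumps_bound_sup) => n.
apply: (le_trans (stopval_shift_le pJ W z ssl0 s01 ssl1 n eta m)); rewrite lerD2r.
exact: (stopval_le_value pJ ssl0 s01 ssl1 jumps_le_bound jumps_bound_sup).
Qed.

Definition add_particle (y : site) (eta : config d) : config d :=
  fun u => if u == y then add_one (eta u) else eta u.

Lemma leS_bump y eta m : leS W (eta, m) (add_particle y eta, m).
Proof.
by split => // u uW; rewrite /= /add_particle; case: ifP => // _; exact: rank_add_one.
Qed.

Lemma bump_notin y eta m : y \notin W -> leS W (add_particle y eta, m) (eta, m).
Proof.
by move=> yW; split => // u uW; rewrite /= /add_particle; case: eqVneq uW yW => // -> ->.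
Qed.

Lemma move_bump y s eta : eta y <> Sleep -> s != 0 ->
  move y (y + s) (add_particle y eta) = add_particle (y + s) eta.
Proof.
move=> ey s0; apply/funext => u; rewrite moveE /add_particle.
have [->|uy] := eqVneq u y; last by case: ifP.
rewrite (_ : (y == y + s) = false); last first.
  by apply/negbTE; rewrite -subr_eq0 opprD addrA subrr sub0r oppr_eq0.
by case: (eta y) ey.
Qed.

Lemma legal_bump y eta m : legal y (add_particle y eta, m).
Proof. by rewrite /legal /= /add_particle eqxx; case: (eta y). Qed.

Lemma pot_bump (w : site -> R) y eta : (forall u, 0 <= w u) -> pot W w (add_particle y eta) <= pot W w eta + w y.
Proof.
move=> w0; have -> : pot W w (add_particle y eta) = \sum_(u <- W)
    ((particles (eta u))%:R * w u + (u == y)%:R * w u).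
  apply: eq_bigr => u _; rewrite -mulrDl; congr (_ * _); rewrite /add_particle.
  by case: ifP => // _; rewrite ?addr0 //; case: (eta u) => [n|] /=; rewrite -natrD ?addn1.
rewrite big_split lerD2l sum_eq_mem //; case: (_ \in _); rewrite ?mul1r // mul0r //.
Qed.

(* Move the extra particle until it leaves [W], overriding its sleep
   instructions: this can only increase the number of jumps. *)
Lemma strong_jumps_bump y eta : (forall u, u \in W -> eta u <> Sleep) ->
  strong_jumps (add_particle y eta, 0%N) - strong_jumps (eta, 0%N) <= F (y - z).
Proof.
move=> hns; rewrite -subr_ge0.
pose D y := F (y - z) - (strong_jumps (add_particle y eta, 0%N) - strong_jumps (eta, 0%N)).
apply: (@minorant _ _ (fun=> True) (fun y => 1 + exit_time y) D
  (pot W (fun u => F (u - z)) eta)) => //.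
- exact: pot_ge0.
- by move=> x _; rewrite lerDl exit_time_ge0.
- move=> x _; rewrite /D.
  have := strong_jumps_le_bound (add_particle x eta, 0%N).
  have := strong_jumps_ge (eta, 0%N).
  have := @pot_bump (fun u => F (u - z)) x eta (fun u => F_ge0 _).
  rewrite /jumps_bound /jumps /=; lra.
move=> x _; have [xW|xW] := boolP (x \in W); last first.
  left; rewrite /D subr_ge0; apply: le_trans (F_ge0 _); rewrite subr_le0.
  exact/strong_jumps_mono/bump_notin.
right=> e e0 IH.
apply: (@le_trans _ _ (\sum_(s <- steps) p s * D (x + s))).
  apply: (@le_trans _ _ (\sum_(s <- steps) p s * (- (e * (1 + exit_time (x + s)))))).
    rewrite lerNl -sumrN; under eq_bigr => s _ do rewrite mulrN opprK mulrCA mulrDr mulr1.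
    rewrite -mulr_sumr big_split /= p_sum addrAC subrr add0r.
    by apply: ler_wpM2l => //; exact: exit_time_sup.
  by apply: ler_sum => s _; apply: ler_wpM2l => //; exact: IH.
have hN : strong_jumps (add_particle x eta, 0%N) <= (x == z)%:R +
    \sum_(s <- steps) p s * strong_jumps (add_particle (x + s) eta, 0%N).
  have := strong_jumps_topple xW (legal_bump x eta 0).
  rewrite /topple.
  (* By monotonicity the sleep branch is at most the quantity being bounded; its weight is less than
     one, so it is absorbed in the left-hand side. *)
  have hb : strong_jumps (slp x (add_particle x eta, 0%N)) <= strong_jumps (add_particle x eta, 0%N).
    apply: strong_jumps_mono; split => // u uW; rewrite /= sleep_atE.
    by case: ifP => // _; exact: rank_mul_sleep.
  set A := \sum_(s <- steps) _.
  have hA : A <= (x == z)%:R + \sum_(s <- steps) p s * strong_jumps (add_particle (x + s) eta, 0%N).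
    have -> : (x == z)%:R = \sum_(s <- steps) p s * (x == z)%:R :> R.
      by rewrite -mulr_suml p_sum mul1r.
    rewrite -big_split /= /A.
    rewrite big_seq [leRHS]big_seq; apply: ler_sum => s hs.
    rewrite -mulrDr; apply: ler_wpM2l => //.
    rewrite /jump move_bump ?unit_steps_neq0 //; last exact: hns.
    case: eqVneq => _ /=; last by rewrite add0r.
    by rewrite [leRHS]addrC; exact: strong_jumps_shift.
  move=> heq; have sx := ssl1 x; have sx0 := ssl0 x; have s1 := s01.
  set B := strong_jumps (add_particle x eta, 0%N) in heq hb *.
  set X := (x == z)%:R + _ in hA *.
  nra.
rewrite /D.
under eq_bigr => s _ do rewrite mulrBr mulrBr.
rewrite !sumrB -mulr_suml p_sum mul1r.
have := F_sup (x - z); rewrite subr_eq0.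
under eq_bigr => s _ do rewrite addrAC.
lra.
Qed.

Definition stable (eta : config d) : bool := all (fun y => active (eta y) == 0%N) W.

Lemma stableP (S : state d) :
  reflect (forall y, y \in W -> ~~ legal y S) (stable S.1).
Proof.
by apply: (iffP allP) => h y /h; rewrite /legal -leqNgt leqn0.
Qed.

(** Zero until [W] is stable, so that a legal toppling cannot decrease its mean. *)
Definition ends_awake (eta : config d) : R := (stable eta && (eta z != Sleep))%:R.

(* Probability that the stabilization of [W] leaves no sleeping particle at [z]. *)
Definition awake_prob (o : site) : state d -> R :=
  value p o real_sleep W (fun S => ends_awake S.1).

Section Awake.
Variable o : site.
Let rsl0 := real_sleep_ge0.
Let rsl1 := real_sleep_le.

Lemma ends_awake_sub y S : y \in W -> legal y S ->
  ends_awake S.1 <= topple p o real_sleep y (fun S => ends_awake S.1) S.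
Proof.
move=> yW ly; rewrite {1}/ends_awake (_ : stable _ = false); last first.
  by apply/negP => st; have := elimT (stableP S) st _ yW; rewrite ly.
apply: addr_ge0; first by rewrite mulr_ge0.
rewrite mulr_ge0 ?subr_ge0 ?(ltW s01) //; apply: sumr_ge0 => s _; exact: mulr_ge0.
Qed.

Lemma ends_awake_le1 (S : state d) : ends_awake S.1 <= 1.
Proof. by rewrite /ends_awake; case: (_ && _). Qed.

Lemma topple_one y (S : state d) : topple p o real_sleep y (fun=> 1) S <= 1.
Proof. by have := topple_lin pJ o real_sleep y 1 0 (fun=> 0) S; rewrite !mul0r addr0 => ->. Qed.

Lemma awake_prob_topple y S : y \in W -> legal y S ->
  awake_prob o S = topple p o real_sleep y (awake_prob o) S.
Proof.
apply: (value_topple pJ rsl0 s01 rsl1 ends_awake_sub ends_awake_le1) => ? ? _ _.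
exact: topple_one.
Qed.

Lemma awake_prob_ge0 S : 0 <= awake_prob o S.
Proof.
apply: le_trans (stopval_le_value pJ rsl0 s01 rsl1 ends_awake_le1 (fun y S _ _ => topple_one y S) 0 S).
exact: ler0n.
Qed.

Lemma awake_prob_le1 S : awake_prob o S <= 1.
Proof. exact: (value_le_sup pJ rsl0 s01 rsl1 ends_awake_le1 (fun y S _ _ => topple_one y S)). Qed.

Lemma awake_prob_stable eta m : stable eta -> awake_prob o (eta, m) = (eta z != Sleep)%:R.
Proof.
move=> st; rewrite /awake_prob.
rewrite (value_stable pJ rsl0 s01 rsl1 ends_awake_le1 (fun y S _ _ => topple_one y S)).
  by rewrite /ends_awake /= st.
exact: (elimT (stableP (eta, m))).
Qed.

End Awake.

Lemma awake_prob_cfg o o' eta m m' : awake_prob o (eta, m) = awake_prob o' (eta, m').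
Proof.
have e : (fun n => stopval p o real_sleep W (fun S => ends_awake S.1) n (eta, m)) =
    (fun n => stopval p o' real_sleep W (fun S => ends_awake S.1) n (eta, m')).
  apply/funext => n; exact: (@stopval_cfg _ _ p o o' real_sleep W ends_awake n eta m m').
by rewrite /awake_prob /value e.
Qed.

Let ell := ln (1 + lambda).

Lemma expR_ell : expR (- ell) = (1 + lambda)^-1.
Proof. by rewrite expRN lnK // posrE. Qed.

Lemma ell_ge0 : 0 <= ell.
Proof. by apply: ln_ge0; rewrite lerDl ltW. Qed.

(** Jensen's inequality, from the tangent to the exponential at [a]: only linearity and monotonicity
    of [topple] are used. *)
Lemma topple_expR o sl y f S : (forall y, 0 <= sl y) -> (forall y, sl y <= sleep_prob) ->
  expR (- ell * topple p o sl y f S) <=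
  topple p o sl y (fun S' => expR (- ell * f S')) S.
Proof.
move=> sl0 sl1; set a := - ell * _.
have -> : expR a = topple p o sl y (fun S' => expR a * (1 - a) + expR a * (- ell) * f S') S.
  by rewrite topple_lin // -mulrA -/a; ring.
apply: (topple_le_all pJ _ sl0 s01 sl1) => S'.
rewrite -mulrA -mulrDr; set x := - ell * f S'.
rewrite (_ : expR x = expR a * expR (x - a)); last by rewrite -expRD addrC subrK.
apply: ler_wpM2l; first exact: expR_ge0.
by have := expR_ge1Dx (x - a); lra.
Qed.

Let no_sleep_slp y (S : state d) : y != z -> S.1 z <> Sleep -> (slp y S).1 z <> Sleep.
Proof. by move=> yz; rewrite /= sleep_atE eq_sym (negPf yz). Qed.

Let no_sleep_jump y s (S : state d) : S.1 z <> Sleep -> (jump z y s S).1 z <> Sleep.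
Proof. by rewrite /= moveE; case: (S.1 z) => // n _; case: ifP => // _; case: ifP. Qed.

Let strong_neq y : y != z -> strong_sleep z y = real_sleep y.
Proof. by rewrite /strong_sleep => /negPf ->. Qed.

Let strong_z : strong_sleep z z = 0.
Proof. by rewrite /strong_sleep eqxx. Qed.

Lemma topple_strongE y f S : y != z ->
  topple p z (strong_sleep z) y f S = topple p z real_sleep y f S.
Proof. by move=> yz; rewrite /topple strong_neq. Qed.

(* At each jump from [z] a lone particle would sleep there with probability
   [lambda / (1 + lambda)]; the bound follows from Jensen's inequality. *)
Lemma awake_prob_ge_jumps S : S.1 z <> Sleep ->
  expR (- ell * (strong_jumps S - jumps S)) <= awake_prob z S.
Proof.
move=> Sz; rewrite -subr_ge0.
pose E S := expR (- ell * (strong_jumps S - jumps S)).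
have E1 S' : E S' <= 1.
  by rewrite -expR0 ler_expR mulNr oppr_le0 mulr_ge0 ?ell_ge0 ?subr_ge0 ?strong_jumps_ge.
apply: (@minorant _ _ (fun S : state d => S.1 z <> Sleep) steps_left
  (fun S => awake_prob z S - E S) 1) => //.
- by move=> x _; exact: steps_left_ge1.
- by move=> x _; have := awake_prob_ge0 z x; have := E1 x; lra.
move=> [eta m] /= xz; have [st|/allPn[y yW]] := boolP (stable eta).
  left; rewrite awake_prob_stable //.
  by move/eqP: xz => -> ; rewrite subr_ge0.
rewrite -lt0n => ly; right=> e e0 IH; set S' := (eta, m).
have {}ly : legal y S' by [].
pose f S := strong_jumps S - jumps S.
have ET : E S' <= expR (- ell * (y == z)%:R) * topple p z (strong_sleep z) y E S'.
  rewrite /E {1}(strong_jumps_topple yW ly).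
  have -> : topple p z (strong_sleep z) y strong_jumps S' - jumps S' =
      (y == z)%:R + topple p z (strong_sleep z) y f S'.
    have -> : topple p z (strong_sleep z) y f S' =
        topple p z (strong_sleep z) y strong_jumps S' + (0 + - 1 * topple p z (strong_sleep z) y jumps S').
      rewrite -topple_lin // -topple_add //; congr (topple _ _ _ _ _ _).
      by apply/funext => ?; rewrite /f; ring.
    rewrite topple_jumps; case: eqVneq => [->|_] /=; first by rewrite strong_z; ring.
    by rewrite mulr0n; ring.
  rewrite mulrDr expRD; apply: ler_wpM2l; first exact: expR_ge0.
  exact: topple_expR.
have TE : - (e * (steps_left S' - 1)) <= topple p z (strong_sleep z) y (fun S => awake_prob z S - E S) S'.
  have -> : - (e * (steps_left S' - 1)) = 0 + (- e) * (steps_left S' - 1) by ring.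
  apply: (@le_trans _ _ (0 + - e * topple p z (strong_sleep z) y steps_left S')).
    rewrite lerD2l !mulNr lerN2; apply: ler_wpM2l => //; exact: topple_steps_left.
  rewrite -topple_lin //; apply: (topple_le pJ ssl0 s01 ssl1) => [sy|s _];
    rewrite add0r mulNr; apply: IH.
  - apply: no_sleep_slp => //; apply/eqP => yz; move: sy; by rewrite yz strong_z eqxx.
  - exact: no_sleep_jump.
have TA : topple p z (strong_sleep z) y (fun S => awake_prob z S - E S) S' =
    topple p z (strong_sleep z) y (awake_prob z) S' - topple p z (strong_sleep z) y E S'.
  rewrite -[- topple _ _ _ _ E _]mulN1r -[_ * topple _ _ _ _ E _]add0r -topple_lin // -topple_add //.
  by congr (topple _ _ _ _ _ _); apply/funext => ?; ring.
rewrite TA in TE.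
have E0 : 0 <= topple p z (strong_sleep z) y E S'.
  apply: addr_ge0; first by rewrite mulr_ge0 ?expR_ge0.
  rewrite mulr_ge0 ?subr_ge0 ?(le_trans (ssl1 y)) ?(ltW s01) //.
  by apply: sumr_ge0 => s _; rewrite mulr_ge0 ?expR_ge0.
have P1 := steps_left_ge1 S'.
(* At [z], [E] loses a factor [1 / (1 + lambda)] for the counted jump, which is the probability that
   the real instruction is a jump. Elsewhere both dynamics agree. *)
have [yz|yz] := eqVneq y z.
  move: ET; rewrite yz eqxx mulr1 expR_ell -one_sub_sleep_prob => ET.
  have := awake_prob_topple z zW (_ : legal z S'); rewrite -{1}yz => /(_ ly).
  rewrite /topple /real_sleep => hA.
  move: TE E0 ET; rewrite yz /topple strong_z !mul0r !add0r subr0 !mul1r => TE E0 ET.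
  have h1 := mulr_ge0 sleep_prob_ge0 (awake_prob_ge0 z (slp z S')).
  have h2 : 0 <= sleep_prob * (e * (steps_left S' - 1)).
    by rewrite mulr_ge0 ?sleep_prob_ge0 ?mulr_ge0 // subr_ge0.
  have h3 : 0 <= 1 - sleep_prob by rewrite subr_ge0 ltW.
  have := ler_wpM2l h3 TE; lra.
move: ET; rewrite (negPf yz) mulr0 expR0 mul1r => ET.
rewrite (awake_prob_topple z yW ly) -topple_strongE //; lra.
Qed.

Lemma topple_bumpE y f eta m : eta z <> Sleep -> legal y (eta, m) ->
  topple p z (strong_sleep z) y f (add_particle z eta, m) =
  topple p z (strong_sleep z) y (fun S => f (add_particle z S.1, S.2)) (eta, m).
Proof.
move=> ez ly; rewrite /topple; congr (_ + _ * _).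
  have [->|yz] := eqVneq y z; first by rewrite strong_z !mul0r.
  congr (_ * f (_, _)); apply/funext => u /=; rewrite /add_particle !sleep_atE.
  by case: eqVneq => // ->; rewrite (negPf yz).
apply: eq_bigr => s _; congr (_ * f (_, _)); apply/funext => u /=; rewrite /add_particle !moveE.
have [->|uy] := eqVneq u y; last by do 2!case: ifP.
by case: ifP => // _; rewrite sub_one_add.
Qed.

(** Set one particle at [z] aside and stabilize the others without letting them sleep at [z]; then
    put it back and apply [awake_prob_ge_jumps]. Only the jumps made after that moment count, so the
    exponent is a difference of values of [strong_jumps]; Jensen's inequality carries it through the
    first stage. *)
Lemma awake_prob_bump_ge eta m : eta z <> Sleep ->
  expR (- ell * (strong_jumps (add_particle z eta, m) - strong_jumps (eta, m)))
  <= awake_prob z (add_particle z eta, m).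
Proof.
pose b (S : state d) : state d := (add_particle z S.1, S.2).
pose E S := expR (- ell * (strong_jumps (b S) - strong_jumps S)).
suff h S : S.1 z <> Sleep -> 0 <= awake_prob z (b S) - E S.
  by move=> /(h (eta, m)); rewrite subr_ge0.
have E1 S' : E S' <= 1.
  rewrite -expR0 ler_expR mulNr oppr_le0 mulr_ge0 ?ell_ge0 // subr_ge0.
  by apply: strong_jumps_mono; case: S' => *; exact: leS_bump.
apply: (@minorant _ _ (fun S : state d => S.1 z <> Sleep) steps_left
  (fun S => awake_prob z (b S) - E S) 1) => //.
- by move=> x _; exact: steps_left_ge1.
- by move=> x _; have := awake_prob_ge0 z (b x); have := E1 x; lra.
move=> {S eta m} [eta m] /= xz; have [st|/allPn[y yW]] := boolP (stable eta).
  left; rewrite subr_ge0 /E [X in _ - X]strong_jumps_stable; last exact/(stableP (eta, m)).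
  rewrite (_ : jumps (eta, m) = jumps (b (eta, m))) //.
  apply: awake_prob_ge_jumps; rewrite /= /add_particle eqxx; by case: (eta z).
rewrite -lt0n => ly; right=> e e0 IH; set S' := (eta, m).
have {}ly : legal y S' by [].
have lby : legal y (b S').
  by apply: leq_trans ly _; rewrite /= /add_particle; case: ifP => // _; exact: active_add.
have ET : E S' <= topple p z (strong_sleep z) y E S'.
  rewrite /E (strong_jumps_topple yW lby) [X in _ - X](strong_jumps_topple yW ly).
  rewrite /b topple_bumpE //.
  rewrite -[- topple _ _ _ _ strong_jumps _]mulN1r -[_ * topple _ _ _ _ strong_jumps _]add0r -topple_lin // -topple_add //.
  apply: (@le_trans _ _ (expR (- ell * topple p z (strong_sleep z) y
      (fun S => strong_jumps (b S) - strong_jumps S) S'))); last exact: topple_expR.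
  rewrite le_eqVlt; apply/orP; left; apply/eqP; congr (expR (_ * _)).
  by congr (topple _ _ _ _ _ _); apply/funext => S; rewrite /b; ring.
have TE : - (e * (steps_left S' - 1)) <= topple p z (strong_sleep z) y (fun S => awake_prob z (b S) - E S) S'.
  have -> : - (e * (steps_left S' - 1)) = 0 + (- e) * (steps_left S' - 1) by ring.
  apply: (@le_trans _ _ (0 + - e * topple p z (strong_sleep z) y steps_left S')).
    rewrite lerD2l !mulNr lerN2; apply: ler_wpM2l => //; exact: topple_steps_left.
  rewrite -topple_lin //; apply: (topple_le pJ ssl0 s01 ssl1) => [sy|s _];
    rewrite add0r mulNr; apply: IH.
  - apply: no_sleep_slp => //; apply/eqP => yz; move: sy; by rewrite yz strong_z eqxx.
  - exact: no_sleep_jump.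
have TA : topple p z (strong_sleep z) y (fun S => awake_prob z (b S) - E S) S' =
    topple p z (strong_sleep z) y (awake_prob z) (b S') - topple p z (strong_sleep z) y E S'.
  rewrite -[- topple _ _ _ _ E _]mulN1r -[_ * topple _ _ _ _ E _]add0r -topple_lin //.
  rewrite /b topple_bumpE // -topple_add //.
  by congr (topple _ _ _ _ _ _); apply/funext => ?; rewrite /b; ring.
suff : topple p z (strong_sleep z) y (awake_prob z) (b S') <= awake_prob z (b S') by lra.
have [yz|yz] := eqVneq y z; last by rewrite topple_strongE // -awake_prob_topple.
(* In [b S'] there are at least two particles at [z], where a sleep instruction has no effect. Given
   that the instruction is a jump, both dynamics agree. *)
have := awake_prob_topple z zW (_ : legal z (b S')); rewrite -{1}yz => /(_ lby).
have -> : topple p z real_sleep z (awake_prob z) (b S') = sleep_prob * awake_prob z (b S') +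
    (1 - sleep_prob) * topple p z (strong_sleep z) z (awake_prob z) (b S').
  rewrite /topple strong_z mul0r add0r subr0 mul1r; congr (_ * awake_prob z (_, _) + _).
  apply/funext => u; rewrite /= sleep_atE /add_particle; case: eqVneq => // ->.
  by move: ly; rewrite yz /legal /=; case: (eta z) => // -[|[|n]].
rewrite yz => h; have h3 : 0 < 1 - sleep_prob by rewrite subr_gt0.
rewrite -(ler_pM2l h3); lra.
Qed.

(* The expected number of jumps that an additional particle at [z] causes is
   at most the Green function. *)
Lemma awake_prob_occupied eta m : (forall u, u \in W -> eta u <> Sleep) ->
  expR (- ell * F 0) <= awake_prob z (add_particle z eta, m).
Proof.
move=> ns; rewrite (awake_prob_cfg z z _ m 0).
apply: le_trans (awake_prob_bump_ge 0 (ns _ zW)).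
rewrite ler_expR !mulNr lerN2; apply: ler_wpM2l; first exact: ell_ge0.
by rewrite -(subrr z); exact: strong_jumps_bump.
Qed.

End Site.
End Sleep.

(** * Green functions *)

Lemma leq_exp2r_weak m n d : (m <= n)%N -> (m ^ d <= n ^ d)%N.
Proof. by case: d => // d; rewrite leq_exp2r. Qed.

Section Green.
Variables (d : nat) (R : realType) (p : 'rV[int]_d -> R).
Hypothesis pJ : jump_distribution p.
Local Notation site := 'rV[int]_d.
Local Notation steps := (unit_steps d).
Variable F : site -> R.
Hypothesis F_ge0 : forall u, 0 <= F u.
Hypothesis F_sup : forall u, (u == 0)%:R + \sum_(s <- steps) p s * F (u + s) <= F u.

Let p_ge0 s : 0 <= p s. Proof. by case: pJ. Qed.
Let p_sum : \sum_(s <- steps) p s = 1. Proof. by case: pJ. Qed.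

(* Expected number of visits to [x] during the first [n] steps from [y]. *)
Fixpoint gre (n : nat) (x y : site) : R :=
  (y == x)%:R + if n is n'.+1 then \sum_(s <- steps) p s * gre n' x (y + s) else 0.

Lemma gre_ge0 n x y : 0 <= gre n x y.
Proof.
elim: n y => [|n IH] y /=; first by rewrite addr0.
by rewrite addr_ge0 // sumr_ge0 // => s _; rewrite mulr_ge0.
Qed.

Lemma gre_S n x y : gre n x y <= gre n.+1 x y.
Proof.
elim: n y => [|n IH] y.
  by rewrite /= addr0 lerDl sumr_ge0 // => s _; rewrite mulr_ge0 ?addr0.
by rewrite /= lerD2l; apply: ler_sum => s _; exact: ler_wpM2l.
Qed.

Lemma gre_homo x y : {homo (fun n => gre n x y) : n m / (n <= m)%N >-> n <= m}.
Proof. by apply: homo_leq => // [? ? ?|n]; [exact: le_trans|exact: gre_S]. Qed.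

Lemma gre_le n x y : gre n x y <= F (y - x).
Proof.
elim: n y => [|n IH] y; apply: le_trans (F_sup _); rewrite subr_eq0 lerD2l.
  by apply: sumr_ge0 => s _; exact: mulr_ge0.
by apply: ler_sum => s _; apply: ler_wpM2l => //; rewrite addrAC.
Qed.

Lemma gre_shift n x s y : gre n (x - s) y = gre n x (y + s).
Proof.
have e y' : (y' == x - s) = (y' + s == x) by rewrite eq_sym subr_eq eq_sym.
elim: n y => [|n IH] y /=; rewrite e //; congr (_ + _).
by apply: eq_bigr => s' _; rewrite IH addrAC.
Qed.

Lemma gre_Sneq0 n x y s : s \in steps -> p s != 0 -> gre n x (y + s) != 0 ->
  gre n.+1 x y != 0.
Proof.
move=> hs ps h; rewrite gt_eqF //= ltr_wpDl //.
rewrite (big_rem s) //= ltr_pwDl //.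
  by rewrite mulr_gt0 // lt0r ?ps ?h //= gre_ge0.
by apply: sumr_ge0 => s' _; rewrite mulr_ge0 ?gre_ge0.
Qed.

Lemma gre_neq0 n x y : gre n x y != 0 -> y = x \/
  exists2 n', n = n'.+1 & exists2 s, s \in steps /\ 0 < p s & gre n' x (y + s) != 0.
Proof.
have [->|yx] := eqVneq y x; first by left.
case: n => [|n] /=; rewrite (negPf yx) ?add0r ?eqxx // => h; right; exists n => //.
have [/hasP[s hs /andP[ps gs]]|/hasPn hn] :=
  boolP (has (fun s => (0 < p s) && (gre n x (y + s) != 0)) steps).
  by exists s.
move: h; rewrite big_seq big1 ?eqxx // => s /hn.
rewrite negb_and negbK lt0r p_ge0 andbT negbK => /orP[/eqP ->|/eqP ->].
  by rewrite mul0r.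
by rewrite mulr0.
Qed.

Definition box (n : nat) (x : site) : seq site :=
  [seq x + \row_i ((c i : nat)%:Z - n%:Z) |
     c : {ffun 'I_d -> 'I_(2 * n + 1)} <- enum {ffun 'I_d -> 'I_(2 * n + 1)}].

Lemma size_box n x : size (box n x) = ((2 * n + 1) ^ d)%N.
Proof. by rewrite size_map -cardE card_ffun !card_ord. Qed.

Lemma mem_box n (x y : site) : (forall i, `|y 0 i - x 0 i| <= n%:Z) -> y \in box n x.
Proof.
move=> h; have c i : {k : 'I_(2 * n + 1) | (k%:Z - n%:Z = y 0 i - x 0 i)%R}.
  have := h i; rewrite ler_norml => /andP[h1 h2].
  have hk : (absz (y 0 i - x 0 i + n%:Z)%R < 2 * n + 1)%N by lia.
  by exists (Ordinal hk) => /=; lia.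
apply/mapP; exists [ffun i => sval (c i)]; first by rewrite mem_enum.
apply/rowP => i; by rewrite !mxE ffunE (svalP (c i)) addrC subrK.
Qed.

Lemma gre_box n (x y : site) : gre n x y != 0 -> forall i, `|y 0 i - x 0 i| <= n%:Z.
Proof.
elim: n y => [|n IH] y /gre_neq0[->|[n' nn' [s [hs ps] gs]]] i; try by rewrite subrr normr0.
  by [].
case: nn' gs => <- /IH/(_ i).
have hs1 : `|s 0 i| <= 1.
  move: hs; rewrite mem_cat => /orP[] /mapP[j _ ->]; rewrite !mxE ?normrN;
  by case: (_ && _).
rewrite !mxE; move: (y 0 i) (s 0 i) (x 0 i) hs1 => a b c hb; rewrite !ler_norml; lia.
Qed.

(* The sites from which [x] can be reached in at most [n] steps. *)
Definition back (n : nat) (x : site) : seq site :=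
  [seq y <- undup (box n x) | gre n x y != 0].

Lemma back_uniq n x : uniq (back n x).
Proof. by rewrite filter_uniq ?undup_uniq. Qed.

Lemma mem_back n x y : (y \in back n x) = (gre n x y != 0).
Proof.
rewrite mem_filter mem_undup andb_idr // => h; apply: mem_box; exact: gre_box.
Qed.

Lemma size_back n x : (size (back n x) <= (2 * n + 1) ^ d)%N.
Proof.
by rewrite -(size_box n x) size_filter (leq_trans (count_size _ _)) ?size_undup.
Qed.

Lemma back_homo n m x : (n <= m)%N -> {subset back n x <= back m x}.
Proof.
move=> nm y; rewrite !mem_back => h; rewrite gt_eqF //.
by apply: lt_le_trans (gre_homo x y nm); rewrite lt0r h gre_ge0.
Qed.

Lemma back_refl n x : x \in back n x.
Proof.
apply: (@back_homo 0) => //; by rewrite mem_back /= eqxx addr0 oner_eq0.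
Qed.

Lemma back_trans t n x z y : z \in back n x -> gre t z y != 0 -> y \in back (n + t) x.
Proof.
move=> zn; elim: t y => [|t IH] y /gre_neq0[->|[t' tt' [s [hs ps] gs]]].
- by rewrite addn0.
- by [].
- by apply: (@back_homo n); rewrite ?leq_addr.
case: tt' gs => <- /IH; rewrite !mem_back addnS; apply: gre_Sneq0 => //.
by rewrite gt_eqF.
Qed.

(** The walk leads from [y] to [x]. As the jump law need not be symmetric, this relation need not be
    either. *)
Inductive reach (x : site) : site -> Prop :=
| reach_refl : reach x x
| reach_step y s : s \in steps -> 0 < p s -> reach x (y + s) -> reach x y.

Lemma back_reach n x y : y \in back n x -> reach x y.
Proof.
rewrite mem_back; elim: n y => [|n IH] y /gre_neq0[->|[n' nn' [s [hs ps] gs]]];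
  try exact: reach_refl; first by [].
by case: nn' gs => <- /IH; exact: reach_step.
Qed.

Lemma reach_trans x y z : reach x y -> reach y z -> reach x z.
Proof. by move=> xy; elim=> // {}z s hs ps _; exact: reach_step. Qed.

Lemma reach_shift x y v : reach x y -> reach (x + v) (y + v).
Proof.
elim=> [|{}y s hs ps _ IH]; first exact: reach_refl.
by apply: (reach_step hs ps); rewrite addrAC.
Qed.

(** The [v] such that some site leads both to [0] and to [v] form a subgroup containing the support
    of [p], hence the whole lattice. *)
Lemma reach_common x1 x2 : exists y, reach x1 y /\ reach x2 y.
Proof.
case: pJ => _ psupp _ pgen.
pose S : {pred site} := [pred v : site | `[< exists y, reach 0 y /\ reach v y >]].
have S0 : zmod_closed S.
  split; first by apply/asboolP; exists 0; split; exact: reach_refl.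
  move=> u v /asboolP[a [a0 au]] /asboolP[b [b0 bv]]; apply/asboolP.
  exists (a + b - v); split.
    apply: (@reach_trans _ a).
      exact: a0.
    have := reach_shift (a - v) bv; rewrite addrC subrK.
    by rewrite [b + _]addrC addrAC.
  apply: (@reach_trans _ (u + b - v)).
    have := reach_shift (u - v) b0; rewrite add0r.
    by rewrite addrA [b + u]addrC.
  have := reach_shift (b - v) au; by rewrite !addrA.
have Ssupp v : p v != 0 -> v \in S.
  move=> pv; apply/asboolP; exists 0; split; first exact: reach_refl.
  apply: (@reach_step _ _ v); first exact: psupp.
    by rewrite lt0r pv p_ge0.
  by rewrite add0r; exact: reach_refl.
have := pgen S S0 Ssupp (x2 - x1) => /asboolP[y [y1 y2]].
exists (y + x1); split.
  by have := reach_shift x1 y1; rewrite add0r.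
by have := reach_shift x1 y2; rewrite subrK.
Qed.

Lemma reach_common_seq (xs : seq site) : exists y, forall x, x \in xs -> reach x y.
Proof.
elim: xs => [|x xs [y hy]]; first by exists 0.
have [z [zx zy]] := reach_common x y; exists z => u; rewrite inE => /orP[/eqP ->//|/hy].
by move=> h; exact: reach_trans h zy.
Qed.

(* Sum of [phi] along the first [n] steps of the walk run backwards from [x]. *)
Fixpoint back_sum (n : nat) (phi : site -> R) (x : site) : R :=
  phi x + if n is n'.+1 then \sum_(s <- steps) p s * back_sum n' phi (x - s) else 0.

(** By translation invariance, summing over the starting point amounts to running the walk backwards
    from [x]. *)
Lemma gre_dual n phi x (Y : seq site) : uniq Y -> {subset back n x <= Y} ->
  \sum_(y <- Y) phi y * gre n x y = back_sum n phi x.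
Proof.
move=> uY; elim: n x => [|n IH] x sub.
  rewrite /= addr0 (bigD1_seq x) ?sub ?back_refl //= eqxx addr0 mulr1.
  by rewrite big1 ?addr0 // => y /negPf ->; rewrite addr0 mulr0.
rewrite /=; under eq_bigr => y _ do rewrite mulrDr.
rewrite big_split /=; congr (_ + _).
  rewrite (bigD1_seq x) ?sub ?back_refl //= eqxx mulr1.
  by rewrite big1 ?addr0 // => y /negPf ->; rewrite mulr0.
under eq_bigr => y _ do rewrite mulr_sumr.
rewrite exchange_big /= big_seq [RHS]big_seq; apply: eq_bigr => s hs.
have [->|ps] := eqVneq (p s) 0.
  by rewrite mul0r big1 // => y _; rewrite mul0r mulr0.
rewrite -IH.
  by rewrite mulr_sumr; apply: eq_bigr => y _; rewrite gre_shift mulrCA.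
by move=> y hy; apply: sub; move: hy; rewrite !mem_back gre_shift; exact: gre_Sneq0.
Qed.

Lemma back_sum1 n x : back_sum n (fun=> 1) x = n.+1%:R.
Proof.
elim: n x => [|n IH] x /=; first by rewrite addr0.
under eq_bigr => s _ do rewrite IH.
by rewrite -mulr_suml p_sum mul1r addrC natr1.
Qed.

Section Killed.
Variables (W : seq site) (x : site).

Fixpoint kgre (k : nat) (y : site) : R :=
  if k is k'.+1 then
    if y \in W then (y == x)%:R + \sum_(s <- steps) p s * kgre k' (y + s) else 0
  else 0.

Lemma kgre_ge0 k y : 0 <= kgre k y.
Proof.
elim: k y => //= k IH y; case: ifP => // _.
by rewrite addr_ge0 // sumr_ge0 // => s _; rewrite mulr_ge0.
Qed.

Lemma kgre_S k y : kgre k y <= kgre k.+1 y.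
Proof.
elim: k y => [|k IH] y; first exact: kgre_ge0.
rewrite /=; case: ifP => // _; rewrite lerD2l; apply: ler_sum => s _; exact: ler_wpM2l.
Qed.

Lemma kgre_homo y : {homo (fun k => kgre k y) : n m / (n <= m)%N >-> n <= m}.
Proof. by apply: homo_leq => // [? ? ?|n]; [exact: le_trans|exact: kgre_S]. Qed.

Lemma kgre_le k y : kgre k y <= F (y - x).
Proof.
elim: k y => [|k IH] y /=; first exact: F_ge0.
case: ifP => _; last exact: F_ge0.
apply: le_trans (F_sup _); rewrite subr_eq0 lerD2l.
by apply: ler_sum => s _; apply: ler_wpM2l => //; rewrite addrAC.
Qed.

(* Green function of the walk killed outside of [W]. *)
Definition green (y : site) : R := limn (fun k => kgre k y).

Lemma green_cvg y : kgre k y @[k --> \oo] --> green y.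
Proof.
apply: nondecreasing_is_cvgn; first exact: kgre_homo.
by exists (F (y - x)) => _ [n _ <-]; exact: kgre_le.
Qed.

Lemma kgre_le_green k y : kgre k y <= green y.
Proof.
apply: (@nondecreasing_cvgn_le _ (fun k => kgre k y)); first exact: kgre_homo.
exact: cvgP (@green_cvg y).
Qed.

Lemma green_le y b : (forall k, kgre k y <= b) -> green y <= b.
Proof.
by move=> h; apply: limr_le; [exact: cvgP (@green_cvg y)|exact: nearW].
Qed.

Lemma green_ge0 y : 0 <= green y. Proof. exact: (kgre_le_green 0). Qed.

Lemma green_out y : y \notin W -> green y = 0.
Proof.
move=> yW; apply/eqP; rewrite eq_le green_ge0 andbT; apply: green_le => -[|k] //=.
by rewrite (negPf yW).
Qed.

Lemma green_in y : y \in W ->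
  green y = (y == x)%:R + \sum_(s <- steps) p s * green (y + s).
Proof.
move=> yW; have c : kgre k.+1 y @[k --> \oo] --> green y 
  by rewrite (cvg_shiftS (fun k => kgre k y)); exact: green_cvg.
rewrite -(cvg_lim _ c) //; apply/cvg_lim => //.
rewrite /= yW; apply: cvgD; first exact: cvg_cst.
elim: steps => [|s r IH].
  by under eq_cvg => n do rewrite big_nil; rewrite big_nil; exact: cvg_cst.
under eq_cvg => n do rewrite big_cons; rewrite big_cons.
by apply: cvgD => //; apply: cvgM; [exact: cvg_cst|exact: green_cvg].
Qed.

Hypothesis xW : x \in W.

Lemma green_ge1 : 1 <= green x.
Proof.
rewrite green_in // eqxx lerDl sumr_ge0 // => s _; rewrite mulr_ge0 ?green_ge0 //.
Qed.

(** Maximum principle: away from [x] the Green function is zero or an average of its neighbouring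
    values. *)
Lemma green_le_diag y : green y <= green x.
Proof.
apply: green_le => k; elim: k y => [|k IH] y /=; first exact: green_ge0.
case: ifP => _; last exact: green_ge0.
have [->|yx] := eqVneq y x.
  rewrite [leRHS]green_in // eqxx lerD2l; apply: ler_sum => s _; apply: ler_wpM2l => //.
  exact: kgre_le_green.
rewrite add0r -[leRHS]mul1r -p_sum mulr_suml; apply: ler_sum => s _; exact: ler_wpM2l.
Qed.

Lemma green_le_F0 y : green y <= F 0.
Proof.
apply: (le_trans (green_le_diag y)); apply: green_le => k.
by rewrite -(subrr x); exact: kgre_le.
Qed.

End Killed.

Lemma green_sub W W' x y : {subset W <= W'} -> green W x y <= green W' x y.
Proof.
move=> sub; apply: green_le => k; apply: le_trans (kgre_le_green W' x k y).
elim: k y => //= k IH y; case: ifP => yW; last by case: ifP => // _; rewrite addr_ge0 // sumr_ge0 // => s _; rewrite mulr_ge0 ?kgre_ge0.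
by rewrite (sub _ yW) lerD2l; apply: ler_sum => s _; exact: ler_wpM2l.
Qed.


Definition green_mass n x : R := \sum_(y <- back n x) green (back n x) x y.

(** A path of at most [n] steps from [y] to [x] stays in [back n x] and so is not killed. By
    reversal, the visits to [x] within [n] steps, summed over all starting points, number [n + 1] in
    mean. *)
Lemma green_mass_ge n x : n.+1%:R <= green_mass n x.
Proof.
rewrite -(back_sum1 n x) -(gre_dual _ (back_uniq n x)) //; apply: ler_sum => y _.
rewrite mul1r; apply: le_trans (kgre_le_green (back n x) x n.+1 y).
suff h k : (k <= n)%N -> gre k x y <= kgre (back n x) x k.+1 y by exact: h.
elim: k y => [|k IH] y kn; (have [yW|yW] := boolP (y \in back n x);
  [rewrite /= yW|rewrite [leLHS](_ : _ = 0); [exact: kgre_ge0|]; apply/eqP;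
   apply: contraNT yW; rewrite -mem_back; exact: back_homo]).
  by rewrite lerD2l; apply: sumr_ge0 => s _; rewrite mulr0.
rewrite lerD2l; apply: ler_sum => s _; apply: ler_wpM2l => //; apply: IH; exact: ltnW.
Qed.

Lemma green_mass_le n x : green_mass n x <= F 0 * ((2 * n + 1) ^ d)%:R.
Proof.
apply: (@le_trans _ _ (\sum_(y <- back n x) F 0)).
  by apply: ler_sum => y _; apply: green_le_F0; exact: back_refl.
rewrite big_const_seq count_predT iter_addr_0 -[_ *+ _]mulr_natr.
by apply: ler_wpM2l => //; rewrite ler_nat; exact: size_back.
Qed.

(* Otherwise it would double every [t] steps, while it grows at most polynomially. *)
Lemma green_mass_doubling t x (A : R) : exists n,
  A <= green_mass n x /\ green_mass (n + t) x <= 2 * green_mass n x.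
Proof.
apply: contrapT => /forallNP h.
pose n0 := Num.bound `|A|.
have hA n : (n0 <= n)%N -> A <= green_mass n x.
  move=> n0n; apply: le_trans (green_mass_ge n x).
  apply: le_trans (ler_norm A) _; apply/ltW/(lt_le_trans (archi_boundP (normr_ge0 A))).
  by rewrite ler_nat; exact: leqW.
have grow k : 2 ^+ k <= green_mass (n0 + k * t) x.
  elim: k => [|k IH].
    by rewrite mul0n addn0 expr0 (le_trans _ (green_mass_ge _ _)) // ler1n.
  rewrite mulSn [(t + _)%N]addnC addnA exprS.
  apply: (le_trans (ler_wpM2l _ IH)) => //.
  have := h (n0 + k * t)%N; have := hA (n0 + k * t)%N (leq_addr _ _) => h1 h2.
  by rewrite leNgt; apply/negP => h3; apply: h2; split => //; exact: ltW.
(* With [C < j] and [k = (d + 1) * j], the mass is at most [C * (j + 1) ^ d], which is less than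
   [(j + 1) ^ (d + 1) <= 2 ^ k]. *)
pose C : R := F 0 * ((2 * n0 + 2 * t + 1) ^ d)%:R * (d.+1 ^ d)%:R.
have C0 : 0 <= C by rewrite !mulr_ge0.
pose j := Num.bound C; pose k := (d.+1 * j)%N.
have := grow k; rewrite leNgt => /negP; apply.
apply: (le_lt_trans (green_mass_le _ _)).
apply: (@le_lt_trans _ _ (C * (j.+1 ^ d)%:R)).
  rewrite /C -!mulrA; apply: ler_wpM2l => //; rewrite -!natrM ler_nat -!expnMn.
  by apply: leq_exp2r_weak; nia.
have -> : (2 : R) ^+ k = (2 ^+ j) ^+ d.+1 by rewrite -exprM mulnC.
have jj : j.+1%:R <= 2 ^+ j :> R by rewrite -natrX ler_nat ltn_expl.
apply: (@lt_le_trans _ _ (j.+1%:R ^+ d.+1)); last by rewrite lerXn2r ?nnegrE.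
rewrite exprS natrX ltr_pM2r ?exprn_gt0 //.
apply: (lt_trans (archi_boundP C0)); by rewrite ltr_nat.
Qed.

End Green.

(** * Lower bound on the odometer *)

Lemma sq_jump_identity (R : comPzRingType) (a b c e g q r s G : R) :
  s * ((a + q - g + (b + e)) ^+ 2 + (c + ((2 * G - 1) * q - q ^+ 2) - r)) =
  s * ((a + b + e - g) ^+ 2 + c - r) + (2 * (a + b + e - g) + (2 * G - 1)) * (s * q).
Proof. by ring. Qed.

Section Odometer.
Variables (d : nat) (R : realType) (p : 'rV[int]_d -> R).
Hypothesis pJ : jump_distribution p.
Local Notation site := 'rV[int]_d.
Local Notation steps := (unit_steps d).
Variable F : site -> R.
Hypothesis F_ge0 : forall u, 0 <= F u.
Hypothesis F_sup : forall u, (u == 0)%:R + \sum_(s <- steps) p s * F (u + s) <= F u.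
Variable lambda : R.
Hypothesis lambda_gt0 : 0 < lambda.

Let p_ge0 s : 0 <= p s. Proof. by case: pJ. Qed.
Let p_sum : \sum_(s <- steps) p s = 1. Proof. by case: pJ. Qed.

Section Region.
Variables (W W' : seq site) (x : site) (K : nat).
Hypothesis W_uniq : uniq W.
Hypothesis W'_uniq : uniq W'.
Hypothesis WW' : {subset W <= W'}.
Hypothesis xW : x \in W.

Let xW' : x \in W'. Proof. exact: WW'. Qed.

Definition reached (S : state d) : R := (K <= S.2)%N%:R.

(* Probability of at least [K] jumps from [x] in the stabilization of [W']. *)
Definition reach_prob : state d -> R := value p x (real_sleep (d := d) lambda) W' reached.

Let rsl0 := real_sleep_ge0 (d := d) lambda_gt0.
Let rsl1 := real_sleep_le (d := d) lambda.
Let s01 := sleep_prob_lt1 lambda_gt0.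

Lemma reached_le1 S : reached S <= 1.
Proof. by rewrite /reached; case: (_ <= _)%N. Qed.

Lemma topple_cst o sl y (c : R) S : topple p o sl y (fun=> c) S = c.
Proof.
by rewrite /topple -mulr_suml p_sum; ring.
Qed.

Lemma reached_sub y S : y \in W' -> legal y S ->
  reached S <= topple p x (real_sleep lambda) y reached S.
Proof.
move=> yW ly; rewrite -[leLHS](topple_cst x (real_sleep lambda) y _ S).
apply: (topple_le pJ rsl0 s01 rsl1) => [_|s _] //.
rewrite /reached /= ler_nat; case: (leqP K S.2) => // h.
by rewrite (leq_trans h) ?leq_addr.
Qed.

Let topple_one y S : y \in W' -> legal y S ->
  topple p x (real_sleep lambda) y (fun=> 1) S <= 1.
Proof. by rewrite topple_cst. Qed.

Lemma reach_prob_topple y S : y \in W' -> legal y S ->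
  reach_prob S = topple p x (real_sleep lambda) y reach_prob S.
Proof. exact: (value_topple pJ rsl0 s01 rsl1 reached_sub reached_le1 topple_one). Qed.

Lemma reach_prob_ge0 S : 0 <= reach_prob S.
Proof.
apply: le_trans (stopval_le_value pJ rsl0 s01 rsl1 reached_le1 topple_one 0 S).
exact: ler0n.
Qed.

Lemma reach_prob_stable eta m : stable W' eta -> reach_prob (eta, m) = (K <= m)%N%:R.
Proof.
move=> st; rewrite /reach_prob (value_stable pJ rsl0 s01 rsl1 reached_le1 topple_one) //.
exact: (elimT (stableP W' (eta, m))).
Qed.

Lemma reach_prob_cvg S :
  stopval p x (real_sleep lambda) W' reached n S @[n --> \oo] --> reach_prob S.
Proof. exact: (value_cvg pJ rsl0 s01 rsl1 reached_le1 topple_one). Qed.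

Let g := green p W x.
Let g' := green p W' x.
Let G := g' x.
(** The variance of the number of visits to [x] by the walk from [y] killed outside of [W']. The
    mean is [g' y], and the second moment is [(2 * G - 1) * g' y], since the number of visits is
    geometric once [x] is hit. *)
Let w y := (2 * G - 1) * g' y - g' y ^+ 2.

Let g_out y : y \notin W -> g y = 0.
Proof. exact: (green_out pJ F_ge0 F_sup). Qed.
Let g'_out y : y \notin W' -> g' y = 0.
Proof. exact: (green_out pJ F_ge0 F_sup). Qed.
Let g_ge0 y : 0 <= g y. Proof. exact: (green_ge0 pJ F_ge0 F_sup). Qed.
Let g'_ge0 y : 0 <= g' y. Proof. exact: (green_ge0 pJ F_ge0 F_sup). Qed.
Let gg' y : g y <= g' y. Proof. exact: (green_sub pJ F_ge0 F_sup). Qed.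
Let g'G y : g' y <= G. Proof. exact: (green_le_diag pJ F_ge0 F_sup). Qed.
Let G1 : 1 <= G. Proof. exact: (green_ge1 pJ F_ge0 F_sup). Qed.
Let GF : G <= F 0. Proof. exact: (green_le_F0 pJ F_ge0 F_sup). Qed.

Let w_ge0 y : 0 <= w y.
Proof. by rewrite /w; have := g'_ge0 y; have := g'G y; have := G1; nra. Qed.

Let inW' (f : site -> R) y : (forall y, y \notin W' -> f y = 0) ->
  (y \in W')%:R * f y = f y.
Proof. by move=> h; have [yW|yW] := boolP (y \in W'); rewrite ?mul1r // h // mul0r. Qed.

Let inWg y : (y \in W')%:R * g y = g y.
Proof. by apply: inW' => u uW; apply: g_out; apply: contra uW; exact: WW'. Qed.

Let w_out u : u \notin W' -> w u = 0.
Proof. by move=> uW; rewrite /w g'_out //; ring. Qed.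

Let potW eta : pot W' g eta = pot W g eta.
Proof.
rewrite /pot (bigID (mem W)) /= [X in _ + X]big1 => [|y yW]; last first.
  by rewrite g_out ?mulr0.
rewrite addr0 -big_filter; apply: perm_big; apply: uniq_perm; rewrite ?filter_uniq //.
by move=> y; rewrite mem_filter /=; apply: andb_idr; exact: WW'.
Qed.

Let U z : state d -> R := awake_prob p lambda W' z x.

(** The Poisson equation of the odometer, as a submartingale. In a stable configuration every
    particle of [W'] sleeps, the last two terms cancel and the number of jumps remains. *)
Definition mean_jumps (S : state d) : R :=
  S.2%:R + pot W' g S.1 + \sum_(z <- W) g z * (U z S - 1).

(** The second moment of the final number of jumps if the particles walked independently, without
    sleeping, until they leave [W']. Real topplings conserve it in mean, and it is always at least
    the square of the number of jumps already made. *)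
Definition sq_jumps (S : state d) : R :=
  (pot W' g' S.1 + S.2%:R) ^+ 2 + pot W' w S.1.

(** Equality holds at the sites of [W]; outside, [g] vanishes and a jump into [W] can only help. The
    larger region [W'] leaves room for the walkers that bound [awake_prob] at the sites of [W]. *)
Lemma mean_jumps_sub y S : y \in W' -> legal y S ->
  mean_jumps S <= topple p x (real_sleep lambda) y mean_jumps S.
Proof.
move=> yW ly; rewrite /mean_jumps topple_add // topple_add // (topple_jumps pJ) topple_pot //.
rewrite topple_sum //.
have -> : \sum_(i <- W) topple p x (real_sleep lambda) y (fun S' => g i * (U i S' - 1)) S =
    \sum_(i <- W) g i * (U i S - 1).
  apply: eq_bigr => z _.
  have -> : (fun S' => g z * (U z S' - 1)) = (fun S' => - g z + g z * U z S').
    by apply/funext => S'; ring.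
  by rewrite topple_lin // -(awake_prob_topple pJ lambda_gt0 z x yW ly) /U; ring.
rewrite lerD2r /jumps.
under eq_bigr => s _ do rewrite inWg.
have hg : g y <= (y == x)%:R + \sum_(s <- steps) p s * g (y + s).
  have [yi|yi] := boolP (y \in W); first by rewrite /g (green_in pJ F_ge0 F_sup).
  by rewrite g_out // addr_ge0 // sumr_ge0 // => s _; exact: mulr_ge0.
have h1 : 0 <= 1 - real_sleep lambda y by rewrite subr_ge0 (le_trans (rsl1 y)) ?ltW.
have := mulr_ge0 h1 (_ : 0 <= (y == x)%:R + \sum_(s <- steps) p s * g (y + s) - g y).
by rewrite subr_ge0 => /(_ hg); lra.
Qed.

Lemma sq_jumps_topple y S : y \in W' -> legal y S ->
  topple p x (real_sleep lambda) y sq_jumps S = sq_jumps S.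
Proof.
move=> yW ly; rewrite /topple.
have -> : sq_jumps (slp y S) = sq_jumps S by rewrite /sq_jumps !pot_sleep.
suff -> : \sum_(s <- steps) p s * sq_jumps (jump x y s S) = sq_jumps S by ring.
set a := pot W' g' S.1 + S.2%:R; set e : R := (y == x)%:R.
have hg : g' y = e + \sum_(s <- steps) p s * g' (y + s).
  by rewrite /g' (green_in pJ F_ge0 F_sup).
set A := \sum_(s <- _) _ in hg.
pose B := \sum_(s <- steps) p s * g' (y + s) ^+ 2.
have -> : \sum_(s <- steps) p s * sq_jumps (jump x y s S) =
    (a + e - g' y) ^+ 2 + pot W' w S.1 - w y
    + (2 * (a + e - g' y) + (2 * G - 1)) * A.
  transitivity (\sum_(s <- steps) (p s * ((a + e - g' y) ^+ 2 + pot W' w S.1 - w y)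
      + (2 * (a + e - g' y) + (2 * G - 1)) * (p s * g' (y + s)))).
    apply: eq_big_seq => s hs; rewrite /sq_jumps !pot_jump // (inW' _ w_out) (inW' _ g'_out).
    rewrite /= natrD -/e /a [w (y + s)]/w.
    exact: sq_jump_identity.
  by rewrite big_split /= -mulr_suml p_sum mul1r -mulr_sumr.
rewrite /sq_jumps -/a [w y]/w hg.
have [yx|yx] := eqVneq y x; last by rewrite /e (negPf yx) /= mulr0n; ring.
have : e = 1 by rewrite /e yx eqxx.
have : G = e + A by rewrite -hg /G yx.
by move=> -> ->; ring.
Qed.

(** Second moment method in linear form: the indicator of [K <= m] is at least
    [2 * th * (m - K - th / 2 * m ^ 2)], which is at most [1 - (th * m - 1) ^ 2], and at most [0] if
    [m < K]. Linearity in the moments allows averaging over initial configurations before [th] is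
    chosen. *)
Lemma reach_prob_ge (th : R) eta : 0 <= th ->
  2 * th * (\sum_(z <- W) g z * ((particles (eta z))%:R - 1 + U z (eta, 0%N))
     - K%:R - th / 2 * (pot W' g' eta ^+ 2 + pot W' w eta))
  <= reach_prob (eta, 0%N).
Proof.
move=> th0.
pose h S := 2 * th * (mean_jumps S - K%:R - th / 2 * sq_jumps S).
have -> : 2 * th * (\sum_(z <- W) g z * ((particles (eta z))%:R - 1 + U z (eta, 0%N))
     - K%:R - th / 2 * (pot W' g' eta ^+ 2 + pot W' w eta)) = h (eta, 0%N).
  rewrite /h /mean_jumps /sq_jumps /= add0r addr0 potW /pot -big_split /=.
  congr (_ * (_ - _ - _)); apply: eq_bigr => z _; ring.
rewrite -subr_ge0.
apply: (@minorant _ _ (fun=> True) (steps_left F lambda W')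
  (fun S => reach_prob S - h S) 1) => //.
- by move=> S _; exact: (steps_left_ge1 F_ge0).
- move=> S _.
  have hm : mean_jumps S <= pot W' g' S.1 + S.2%:R.
    have h1 : pot W' g S.1 <= pot W' g' S.1.
      by apply: ler_sum => y _; exact: ler_wpM2l.
    have h2 : \sum_(z <- W) g z * (U z S - 1) <= 0.
      rewrite -oppr_ge0 -sumrN; apply: sumr_ge0 => z _.
      rewrite -mulrN mulr_ge0 // oppr_ge0 subr_le0.
      exact: (awake_prob_le1 pJ lambda_gt0).
    by rewrite /mean_jumps; lra.
  have := reach_prob_ge0 S; rewrite /h /sq_jumps.
  have := pot_ge0 W' S.1 w_ge0.
  set P := pot W' w _; set b := pot W' g' _ + _ in hm *; move: hm.
  set M := mean_jumps S => hm P0 r0.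
  have K0 : 0 <= K%:R :> R by [].
  have e1 := mulr_ge0 th0 (_ : 0 <= b - M + K%:R).
  have e2 := mulr_ge0 (mulr_ge0 th0 th0) P0.
  have := sqr_ge0 (th * b - 1).
  have : 0 <= th * (b - M + K%:R) by apply: e1; lra.
  by lra.
move=> [eta' m] _; have [st|/allPn[y yW]] := boolP (stable W' eta').
  left; rewrite reach_prob_stable // subr_ge0.
  have -> : h (eta', m) = 2 * th * (m%:R - K%:R - th / 2 * sq_jumps (eta', m)).
    rewrite /h; congr (_ * (_ - _ - _)); rewrite /mean_jumps /= potW /pot -addrA -big_split /=.
    rewrite big_seq big1 ?addr0 // => z zW.
    rewrite /U (awake_prob_stable pJ lambda_gt0) //.
    have hz : (particles (eta' z))%:R = 1 - (eta' z != Sleep)%:R :> R.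
      have := allP st z (WW' zW); case: (eta' z) => [n|] /=; last by move=> _; rewrite eqxx /= ?mulr0n subr0.
      by move=> /eqP ->; case: eqP => // _; rewrite /= mulr1n subrr.
    by rewrite hz; ring.
  have m0 : 0 <= m%:R :> R by [].
  have mm : m%:R ^+ 2 <= sq_jumps (eta', m).
    have := pot_ge0 W' eta' w_ge0; have := pot_ge0 W' eta' g'_ge0.
    by rewrite /sq_jumps /=; nra.
  have t2 := mulr_ge0 (mulr_ge0 th0 th0) (_ : 0 <= sq_jumps (eta', m) - m%:R ^+ 2).
  have {}t2 : 0 <= th * th * (sq_jumps (eta', m) - m%:R ^+ 2) by apply: t2; lra.
  case: leqP => [Km|]; last first.
    rewrite -(ltr_nat R) => mK; have := mulr_ge0 th0 (_ : 0 <= K%:R - m%:R).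
    rewrite subr_ge0 => /(_ (ltW mK)); have := sqr_ge0 (th * m%:R); rewrite /=; lra.
  have := mulr_ge0 th0 (ler0n R K); have := sqr_ge0 (th * m%:R - 1); rewrite /=; lra.
rewrite -lt0n => ly; right=> e e0 IH; set S' := (eta', m).
have {}ly : legal y S' by [].
have TE : - (e * (steps_left F lambda W' S' - 1)) <=
    topple p x (real_sleep lambda) y (fun S => reach_prob S - h S) S'.
  have -> : - (e * (steps_left F lambda W' S' - 1)) = 0 + (- e) * (steps_left F lambda W' S' - 1) by ring.
  apply: (@le_trans _ _ (0 + - e * topple p x (real_sleep lambda) y (steps_left F lambda W') S')).
    rewrite lerD2l !mulNr lerN2; apply: ler_wpM2l => //.
    exact: (topple_steps_left pJ F_ge0 F_sup).
  rewrite -topple_lin //; apply: (topple_le_all pJ x rsl0 s01 rsl1) => S.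
  by rewrite add0r mulNr; exact: IH.
have TA : topple p x (real_sleep lambda) y (fun S => reach_prob S - h S) S' =
    reach_prob S' - 2 * th * (topple p x (real_sleep lambda) y mean_jumps S'
      - K%:R - th / 2 * sq_jumps S').
  have -> : (fun S => reach_prob S - h S) = (fun S => reach_prob S +
     (2 * th * K%:R + (- (2 * th)) * (mean_jumps S + (0 + (- (th / 2)) * sq_jumps S)))).
    by apply/funext => S; rewrite /h; ring.
  rewrite topple_add // topple_lin // topple_add // topple_lin //.
  by rewrite -reach_prob_topple // sq_jumps_topple //; ring.
apply: (le_trans TE); rewrite TA lerD2l lerN2 /h; apply: ler_wpM2l.
  by rewrite mulr_ge0.
by rewrite !lerD2r; exact: mean_jumps_sub.
Qed.

Lemma reach_prob_avg (L : nat) (eta : 'I_L -> config d) (th delta : R) :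
  (0 < L)%N -> 0 <= th ->
  (forall j y, y \in W' -> (particles (eta j y) <= 1)%N) ->
  (forall z, z \in W -> delta <=
     (\sum_j ((particles (eta j z))%:R - 1 + awake_prob p lambda W' z x (eta j, 0%N))) / L%:R) ->
  2 * th * (delta * (\sum_(y <- W) green p W x y) - K%:R
     - th / 2 * ((\sum_(y <- W') green p W' x y) ^+ 2
          + 2 * F 0 * \sum_(y <- W') green p W' x y))
  <= (\sum_j reach_prob (eta j, 0%N)) / L%:R.
Proof.
move=> L0 th0 h1 hd.
rewrite -/g -/g'; set S' := \sum_(y <- W') g' y.
have L0' : 0 < L%:R :> R by rewrite ltr0n.
have pg' j : 0 <= pot W' g' (eta j) <= S'.
  rewrite pot_ge0 //= /pot big_seq [leRHS]big_seq; apply: ler_sum => y yW.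
  by apply: ler_piMl => //; rewrite -[1]/(1%:R) ler_nat h1.
have pw j : pot W' w (eta j) <= 2 * F 0 * S'.
  apply: (@le_trans _ _ (2 * F 0 * pot W' g' (eta j))); last first.
    by rewrite ler_wpM2l ?mulr_ge0 ?F_ge0 //; case/andP: (pg' j).
  rewrite /pot mulr_sumr; apply: ler_sum => y _; rewrite mulrCA; apply: ler_wpM2l => //.
  by rewrite /w; have := g'_ge0 y; have := g'G y; have := GF; nra.
rewrite ler_pdivlMr //.
apply: (@le_trans _ _ (\sum_j 2 * th * (\sum_(z <- W) g z *
   ((particles (eta j z))%:R - 1 + U z (eta j, 0%N)) - K%:R - th / 2 * (S' ^+ 2 + 2 * F 0 * S')))).
  rewrite -mulr_sumr [leLHS](_ : _ = 2 * th * ((delta * (\sum_(y <- W) g y) - K%:R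
     - th / 2 * (S' ^+ 2 + 2 * F 0 * S')) * L%:R)); last by rewrite mulrA.
  apply: ler_wpM2l; first by rewrite mulr_ge0.
  pose c := K%:R + th / 2 * (S' ^+ 2 + 2 * F 0 * S').
  have -> : \sum_j (\sum_(z <- W) g z * ((particles (eta j z))%:R - 1 + U z (eta j, 0%N))
       - K%:R - th / 2 * (S' ^+ 2 + 2 * F 0 * S')) =
      \sum_(z <- W) g z * (\sum_j ((particles (eta j z))%:R - 1 + U z (eta j, 0%N))) - c * L%:R.
    under eq_bigr => j _ do rewrite -addrA -opprD -/c.
    rewrite big_split /= sumr_const card_ord -[_ *+ L]mulr_natr mulNr exchange_big /=.
    by congr (_ - _); apply: eq_bigr => z _; rewrite mulr_sumr.
  rewrite -addrA -opprD -/c mulrBl lerD2r.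
  rewrite mulrAC mulr_sumr big_seq [leRHS]big_seq; apply: ler_sum => z zW.
  rewrite mulrC; apply: ler_wpM2l => //.
  by rewrite -ler_pdivlMr //; exact: hd.
apply: ler_sum => j _; apply: le_trans (reach_prob_ge _ th0).
apply: ler_wpM2l; first by rewrite mulr_ge0.
rewrite lerD2l lerN2; apply: ler_wpM2l; first by rewrite divr_ge0.
apply: lerD => //; have /andP[a b] := pg' j.
by apply: lerXn2r => //; rewrite nnegrE // (le_trans a).
Qed.

End Region.

(* Second moment method: in the region [back (n + t) x] the mean number of jumps
   from [x] is comparable to its standard deviation. *)
Lemma reach_prob_avg_ge (t : nat) (delta : R) x K : 0 < delta -> delta <= 1 ->
  exists n, forall (L : nat) (eta : 'I_L -> config d), (0 < L)%N ->
  (forall j y, y \in back p (n + t) x -> (particles (eta j y) <= 1)%N) ->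
  (forall z, z \in back p n x -> delta <=
     (\sum_j ((particles (eta j z))%:R - 1 +
        awake_prob p lambda (back p (n + t) x) z x (eta j, 0%N))) / L%:R) ->
  delta ^+ 2 / 8 <= (\sum_j reach_prob (back p (n + t) x) x K (eta j, 0%N)) / L%:R.
Proof.
move=> d0 d1.
have [n [hA hG]] := green_mass_doubling pJ F_ge0 F_sup t x (1 + 2 * F 0 + 8 * K%:R / delta).
exists n => L eta L0 h1 hd.
have G0 : 0 < green_mass p n x.
  by rewrite (lt_le_trans _ (green_mass_ge pJ F_ge0 F_sup n x)).
(* With [A] and [B] the Green masses of the two regions, [B <= 2 * A], [2 * F 0 <= A] and
   [K <= delta * A / 8], the bracket is at least [delta * A * (1 - 1/8 - 3/8)]; times [2 * th] this
   is [delta ^ 2 / 8]. *)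
have th0 : 0 <= delta / (8 * green_mass p n x).
  by rewrite divr_ge0 ?mulr_ge0 // ltW.
have sub : {subset back p n x <= back p (n + t) x}.
  by apply: back_homo => //; rewrite leq_addr.
apply: le_trans (reach_prob_avg K (back_uniq _ _ _) (back_uniq _ _ _) sub
  (back_refl pJ _ _) L0 th0 h1 hd).
rewrite -/(green_mass p n x) -/(green_mass p (n + t) x).
have G0' : 0 <= green_mass p (n + t) x.
  by rewrite (le_trans _ (green_mass_ge pJ F_ge0 F_sup _ x)).
set A := green_mass p n x in hA hG G0 th0 *; set B := green_mass _ _ _ in hG G0' *.
have F0 := F_ge0 0.
have KA : K%:R <= delta * A / 8.
  have : 8 * K%:R / delta <= A by apply: le_trans hA; rewrite lerDr; lra.
  by rewrite ler_pdivrMr //; lra.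
have BA : B ^+ 2 + 2 * F 0 * B <= 6 * A ^+ 2.
  have K8 : 0 <= 8 * K%:R / delta by rewrite divr_ge0 ?mulr_ge0 // ltW.
  have A2 : 2 * F 0 <= A by lra.
  nra.
have -> : delta ^+ 2 / 8 = 2 * (delta / (8 * A)) * (delta * A / 2).
  by field; rewrite gt_eqF.
apply: ler_wpM2l; first by rewrite mulr_ge0.
have : delta / (8 * A) / 2 * (B ^+ 2 + 2 * F 0 * B) <= 3 / 8 * (delta * A).
  apply: (@le_trans _ _ (delta / (8 * A) / 2 * (6 * A ^+ 2))).
    by apply: ler_wpM2l => //; rewrite divr_ge0.
  by rewrite le_eqVlt; apply/orP; left; apply/eqP; field; rewrite gt_eqF.
by have := mulr_ge0 (ltW d0) (ltW G0); lra.
Qed.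

End Odometer.

(** * Periodic initial configurations *)

Section Vacant.
Variables (d : nat) (R : realType) (p : 'rV[int]_d -> R).
Hypothesis pJ : jump_distribution p.
Local Notation site := 'rV[int]_d.
Local Notation steps := (unit_steps d).
Variable F : site -> R.
Hypothesis F_ge0 : forall u, 0 <= F u.
Hypothesis F_sup : forall u, (u == 0)%:R + \sum_(s <- steps) p s * F (u + s) <= F u.
Variable lambda : R.
Hypothesis lambda_gt0 : 0 < lambda.

Let p_ge0 s : 0 <= p s. Proof. by case: pJ. Qed.
Let p_sum : \sum_(s <- steps) p s = 1. Proof. by case: pJ. Qed.

Lemma green_bound_ge1 : 1 <= F 0.
Proof.
apply: le_trans (F_sup 0); rewrite eqxx lerDl; apply: sumr_ge0 => s _; exact: mulr_ge0.
Qed.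

Section Walkers.
Variables (W : seq site) (z : site).
Hypothesis W_uniq : uniq W.
Hypothesis zW : z \in W.

Let q := (1 + lambda)^-1.
Let kappa := expR (- ln (1 + lambda) * F 0).
Let U eta := awake_prob p lambda W z z (eta, 0%N).
Definition sleepless (eta : config d) := forall u, u \in W -> eta u <> Sleep.

Lemma sleepless_bump y eta : sleepless eta -> sleepless (add_particle y eta).
Proof. by move=> h u /h; rewrite /add_particle; case: ifP => // _; case: (eta u). Qed.

Lemma bumpC y y' (eta : config d) : add_particle y (add_particle y' eta) = add_particle y' (add_particle y eta).
Proof. by apply/funext => u; rewrite /add_particle; case: ifP; case: ifP. Qed.

(* Probability of visiting [z] within [t] steps of the walk killed outside [W]. *)
Fixpoint hit (t : nat) (y : site) : R :=
  if y == z then 1 else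
  if t is t'.+1 then if y \in W then \sum_(s <- steps) p s * hit t' (y + s) else 0
  else 0.

Lemma hit_ge0 t y : 0 <= hit t y.
Proof.
elim: t y => [|t IH] y /=; case: ifP => // _; case: ifP => // _.
by apply: sumr_ge0 => s _; exact: mulr_ge0.
Qed.

Lemma hit_le1 t y : hit t y <= 1.
Proof.
elim: t y => [|t IH] y /=; case: ifP => // _; case: ifP => // _.
rewrite -[leRHS]p_sum; apply: ler_sum => s _; exact: ler_piMr.
Qed.

Let q0 : 0 < q. Proof. by rewrite invr_gt0 addr_gt0. Qed.
Let q1 : q <= 1. Proof. by rewrite invf_le1 ?addr_gt0 // lerDl ltW. Qed.
Let k0 : 0 <= kappa. Proof. exact: expR_ge0. Qed.

(** Topple the added particle alone for up to [t] steps, paying [q] per step to exclude sleep. If it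
    meets [z], stop and use [awake_prob_occupied]; if not, leave it where it is and use [c], valid
    for every position. *)
Lemma walk_one t y xi c : sleepless xi -> 0 <= c -> c <= kappa ->
  (forall y', c <= U (add_particle y' xi)) ->
  q ^+ t * (hit t y * kappa + (1 - hit t y) * c) <= U (add_particle y xi).
Proof.
move=> ns c0 ck hc; have Uz : kappa <= U (add_particle z xi).
  exact: (awake_prob_occupied pJ F_ge0 F_sup).
have small t' (v : R) : 0 <= v -> q ^+ t' * v <= v.
  by move=> v0; apply: ler_piMl => //; apply: exprn_ile1 => //; exact: ltW.
elim: t y => [|t IH] y /=; have [->|yz] := eqVneq y z.
- by rewrite expr0 !mul1r subrr mul0r addr0.
- by rewrite expr0 mul1r mul0r add0r subr0 mul1r.
- rewrite mul1r subrr mul0r addr0; apply: le_trans Uz; exact: small.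
have [yW|yW] := boolP (y \in W); last first.
  by rewrite mul0r add0r subr0 mul1r; apply: le_trans (hc y); exact: small.
rewrite /U (awake_prob_topple pJ lambda_gt0 z z yW (legal_bump _ _ _)) /topple.
apply: ler_wpDl.
  by rewrite mulr_ge0 ?(awake_prob_ge0 pJ lambda_gt0) // (sleep_prob_ge0 lambda_gt0).
rewrite /real_sleep (one_sub_sleep_prob lambda_gt0) -/q exprS -mulrA ler_pM2l //.
have -> : q ^+ t * ((\sum_(s <- steps) p s * hit t (y + s)) * kappa +
      (1 - \sum_(s <- steps) p s * hit t (y + s)) * c) =
   \sum_(s <- steps) p s * (q ^+ t * (hit t (y + s) * kappa + (1 - hit t (y + s)) * c)).
  transitivity (\sum_(s <- steps) (q ^+ t * (kappa - c) * (p s * hit t (y + s)) + q ^+ t * c * p s)).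
    by rewrite big_split /= -!mulr_sumr p_sum; ring.
  by apply: eq_bigr => s _; ring.
rewrite big_seq [leRHS]big_seq; apply: ler_sum => s hs; apply: ler_wpM2l => //.
rewrite /jump move_bump ?unit_steps_neq0 //; last exact: ns.
by rewrite (awake_prob_cfg _ _ _ _ z z _ _ 0); exact: IH.
Qed.

(** The walkers are released one after the other. Those that miss [z] join the background, whence
    the induction over all sleepless [xi]. *)
Lemma walk_seq t ys xi : sleepless xi ->
  kappa * q ^+ (t * size ys) * (1 - \prod_(y <- ys) (1 - hit t y)) <=
  U (foldr (@add_particle d) xi ys).
Proof.
have pr ys' : 0 <= \prod_(y <- ys') (1 - hit t y) <= 1.
  elim: ys' => [|y ys' IH]; rewrite ?big_nil ?ler01 ?lexx // big_cons.
  have := hit_ge0 t y; have := hit_le1 t y => h1 h0; case/andP: IH => P0 P1.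
  by rewrite mulr_ge0 ?mulr_ile1 ?subr_ge0 // gerBl.
elim: ys xi => [|y ys IH] xi ns.
  by rewrite big_nil subrr mulr0 (awake_prob_ge0 pJ lambda_gt0).
have hns ys' xi' : sleepless xi' -> sleepless (foldr (@add_particle d) xi' ys').
  by move=> h; elim: ys' => //= y' ys' h'; exact: sleepless_bump.
have hcomm y' xi' ys' : add_particle y' (foldr (@add_particle d) xi' ys') = foldr (@add_particle d) (add_particle y' xi') ys'.
  by elim: ys' => //= y'' ys' <-; rewrite bumpC.
pose c := kappa * q ^+ (t * size ys) * (1 - \prod_(y <- ys) (1 - hit t y)).
have /andP[P0 P1] := pr ys.
have qt k : 0 <= q ^+ k <= 1 by rewrite exprn_ge0 ?exprn_ile1 // ltW.
have c0 : 0 <= c by rewrite !mulr_ge0 ?subr_ge0 //; case/andP: (qt (t * size ys)%N).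
have ck : c <= kappa.
  rewrite /c -mulrA; apply: ler_piMr => //; apply: mulr_ile1; rewrite ?subr_ge0 //.
  - by case/andP: (qt (t * size ys)%N).
  - by case/andP: (qt (t * size ys)%N).
  - by rewrite gerBl.
apply: le_trans (walk_one t y (hns ys xi ns) c0 ck _); last first.
  by move=> y'; rewrite hcomm; apply: IH; exact: sleepless_bump.
rewrite big_cons /= mulnS exprD.
have := hit_ge0 t y; have := hit_le1 t y => h1 h0.
set P := \prod_(_ <- _) _ in P0 P1 c c0 ck *; set Q := q ^+ (t * size ys).
have /andP[Q0 Q1] := qt (t * size ys)%N; rewrite -/Q in Q0 Q1.
have /andP[T0 _] := qt t; set T := q ^+ t in T0 *.
rewrite [leLHS](_ : _ = T * (kappa * Q * (1 - (1 - hit t y) * P))); last by ring.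
apply: ler_wpM2l => //.
rewrite /c -/Q -subr_ge0.
have -> : hit t y * kappa + (1 - hit t y) * (kappa * Q * (1 - P)) -
    kappa * Q * (1 - (1 - hit t y) * P) = hit t y * kappa * (1 - Q) by ring.
by rewrite !mulr_ge0 ?subr_ge0.
Qed.

(** Turns a large mean number of successes into a small probability of none. *)
Lemma prod_compl_le (ys : seq site) (h : site -> R) : (forall y, 0 <= h y <= 1) ->
  0 <= \prod_(y <- ys) (1 - h y) <= 1 /\
  (\prod_(y <- ys) (1 - h y)) * (1 + \sum_(y <- ys) h y) <= 1.
Proof.
move=> h01; elim: ys => [|y ys [/andP[P0 P1] PS]].
  by rewrite !big_nil ler01 lexx addr0 mulr1.
rewrite !big_cons; set P := \prod_(_ <- _) _ in P0 P1 PS *.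
have S0 : 0 <= \sum_(y <- ys) h y by apply: sumr_ge0 => u _; case/andP: (h01 u).
set S := \sum_(_ <- _) _ in S0 PS *; have /andP[a b] := h01 y.
split; first by rewrite mulr_ge0 ?mulr_ile1 ?subr_ge0 // gerBl.
have -> : (1 - h y) * P * (1 + (h y + S)) =
  (1 - h y) * (P * (1 + S)) + (1 - h y) * h y * P by ring.
have : (1 - h y) * (P * (1 + S)) <= (1 - h y) * 1 by apply: ler_wpM2l => //; lra.
have : (1 - h y) * h y * P <= (1 - h y) * h y * 1.
  by apply: ler_wpM2l => //; rewrite mulr_ge0 //; lra.
by have := sqr_ge0 (h y); lra.
Qed.

(** Strong Markov property: from [z] on, there are at most [F 0] visits to [z] in mean. *)
Lemma gre_le_hit t : (forall y, gre p t z y != 0 -> y \in W) ->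
  forall k y, (k <= t)%N -> gre p k z y <= F 0 * hit k y.
Proof.
move=> sub; have F0 := F_ge0 0; elim=> [|k IH] y kt /=.
  case: ifP => _; first by rewrite addr0 mulr1 green_bound_ge1.
  by rewrite addr0 mulr0.
have [yz|yz] := eqVneq y z.
  have := gre_le pJ F_ge0 F_sup k.+1 z y; rewrite /= yz eqxx subrr mulr1; exact.
have [yW|yW] := boolP (y \in W).
  rewrite add0r mulr_sumr; apply: ler_sum => s _; rewrite mulrCA.
  by apply: ler_wpM2l => //; exact/IH/ltnW.
have : gre p k.+1 z y = 0.
  apply/eqP; apply: contraNT yW => h; apply: sub; rewrite gt_eqF //.
  apply: lt_le_trans (gre_homo pJ z y kt); rewrite lt0r h; exact: gre_ge0.
by rewrite /= (negPf yz) mulr0 => ->.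
Qed.

(* If many walkers may reach [z], then one of them does so before any sleep
   instruction is used, with a probability close to one when [lambda] is small. *)
Lemma awake_prob_vacant t eta o (A : R) (M : nat) : sleepless eta ->
  (forall y, gre p t z y != 0 -> y \in W) ->
  0 <= A ->
  A <= \sum_(y <- back p t z) (eta y == Act 1)%:R * gre p t z y ->
  (size (back p t z) <= M)%N ->
  kappa * q ^+ (t * M) * (1 - F 0 / (F 0 + A)) <= awake_prob p lambda W z o (eta, 0%N).
Proof.
move=> ns sub A0 hA hM; rewrite (awake_prob_cfg _ _ _ _ o z _ _ 0).
pose ys := [seq y <- back p t z | eta y == Act 1].
pose xi : config d := fun u => if u \in ys then Act 0 else eta u.
have nsxi : sleepless xi by move=> u /ns; rewrite /xi; case: ifP.
have -> : eta = foldr (@add_particle d) xi ys.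
  have uys : uniq ys by rewrite filter_uniq ?back_uniq.
  have h l : uniq l -> forall u, foldr (@add_particle d) xi l u =
      if u \in l then add_one (xi u) else xi u.
    elim: l => //= y l IH /andP[yl ul] u; rewrite {1}/add_particle inE IH //.
    by have [->|] := eqVneq u y; rewrite ?(negPf yl).
  apply/funext => u; rewrite h // /xi; case: ifP => [uy|->//].
  by rewrite uy; move: uy; rewrite mem_filter => /andP[/eqP -> _].
apply: le_trans (walk_seq t ys nsxi).
have F1 := green_bound_ge1.
have [] := prod_compl_le ys (h := hit t) _; first by move=> y; rewrite hit_ge0 hit_le1.
set P := \prod_(_ <- _) _; set S := \sum_(_ <- _) _ => /andP[P0 P1] PS.
have SA : A <= F 0 * S.
  apply: (le_trans hA); rewrite /S [\sum_(y <- ys) _]big_filter mulr_sumr [leRHS]big_mkcond /=.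
  apply: ler_sum => y _; case: ifP => _; last by rewrite mul0r.
  by rewrite mul1r; exact: (gre_le_hit sub y (leqnn t)).
have FA : 0 < F 0 + A by lra.
have PF : P <= F 0 / (F 0 + A).
  rewrite ler_pdivlMr //; have := ler_wpM2l P0 SA => h.
  have : P * (1 + S) * F 0 <= 1 * F 0 by apply: ler_wpM2r => //; lra.
  by lra.
have qq : q ^+ (t * M) <= q ^+ (t * size ys).
  apply: ler_wiXn2l => //; first exact: ltW.
  rewrite leq_mul2l; apply/orP; right; apply: leq_trans hM.
  by rewrite size_filter count_size.
apply: ler_pM.
- by rewrite mulr_ge0 ?exprn_ge0 // ltW.
- by rewrite subr_ge0 ler_pdivrMr // mul1r lerDl.
- by apply: ler_wpM2l.
- by rewrite lerD2l lerN2.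
Qed.

End Walkers.
End Vacant.

Section Pattern.
Variables (d : nat) (R : realType) (p : 'rV[int]_d -> R).
Hypothesis pJ : jump_distribution p.
Hypothesis d_gt2 : (2 < d)%N.
Local Notation site := 'rV[int]_d.
Local Notation steps := (unit_steps d).

Let p_ge0 s : 0 <= p s. Proof. by case: pJ. Qed.
Let p_sum : \sum_(s <- steps) p s = 1. Proof. by case: pJ. Qed.

Definition coord0 : 'I_d := Ordinal (ltn_trans (isT : (0 < 2)%N) d_gt2).

Definition first_coord (y : site) : int := y 0 coord0.

Definition residue (L j : nat) (y : site) : nat := `|((first_coord y + j%:Z) %% L%:Z)%Z|%N.

(** Periodic in the first coordinate only: the translates are the [L] shifts [j], and at each site
    averaging over [j] amounts to averaging [b]. *)
Definition pattern (L : nat) (b : nat -> bool) (j : nat) : config d :=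
  fun y => Act (b (residue L j y)).

Lemma residue_lt L j y : (0 < L)%N -> (residue L j y < L)%N.
Proof.
move=> L0; have := @ltz_pmod (first_coord y + j%:Z) L%:Z.
have := @modz_ge0 (first_coord y + j%:Z) L%:Z.
rewrite /residue => h1 h2; have {}h1 := h1 (_ : L%:Z != 0); lia.
Qed.

Lemma residue_inj L y (i j : 'I_L) : residue L i y = residue L j y -> i = j.
Proof.
have L0 : (0 < L)%N by apply: leq_ltn_trans (ltn_ord i).
have h k : (residue L k y)%:Z = ((first_coord y + k%:Z) %% L%:Z)%Z.
  by rewrite /residue gez0_abs // modz_ge0 //; lia.
move=> /(congr1 Posz); rewrite !h => /eqP; rewrite eqz_modDl.
have hs (k : 'I_L) : (k%:Z %% L%:Z)%Z = k by rewrite modz_small //= ltz_nat.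
by rewrite !hs => /eqP[] ?; exact: val_inj.
Qed.

Lemma sum_residue L y (f : nat -> R) : \sum_(j < L) f (residue L j y) = \sum_(r < L) f r.
Proof.
case: L => [|L]; first by rewrite !big_ord0.
pose h (j : 'I_L.+1) : 'I_L.+1 := Ordinal (@residue_lt L.+1 j y isT).
have hb : bijective h.
  by apply: injF_bij => i j [] /residue_inj.
by rewrite [RHS](reindex h) //; exact: onW_bij.
Qed.

Lemma pattern_avg L b y :
  \sum_(j < L) (particles (pattern L b j y))%:R = \sum_(r < L) (b r)%:R :> R.
Proof. by rewrite -(sum_residue L y (fun r => (b r)%:R)). Qed.

Lemma pattern_restrict L b j (V : {fset site}) y :
  (particles (restrict_config V (pattern L b j) y) <= 1)%N.
Proof. by rewrite /restrict_config; case: ifP => // _; rewrite /= leq_b1. Qed.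

Lemma pattern_sleepless L b j (V : {fset site}) y :
  restrict_config V (pattern L b j) y <> Sleep.
Proof. by rewrite /restrict_config; case: ifP. Qed.

Lemma transverse_step : exists s, [/\ s \in steps, 0 < p s &
  first_coord s = 1 \/ first_coord s = -1].
Proof.
case: pJ => _ psupp _ pgen.
have [//|hn] := pselect (exists s, [/\ s \in steps, 0 < p s &
  first_coord s = 1 \/ first_coord s = -1]).
pose S : {pred site} := [pred z : site | first_coord z == 0].
have S0 : zmod_closed S.
  split; first by rewrite inE /first_coord mxE.
  by move=> u v; rewrite !inE /first_coord !mxE => /eqP -> /eqP ->; rewrite subr0.
have Ss s : p s != 0 -> s \in S.
  move=> ps; rewrite inE; apply/negPn/negP => sn; apply: hn; exists s.
  have hs := psupp _ ps; split => //; first by rewrite lt0r ps p_ge0.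
  move: hs sn; rewrite /first_coord mem_cat => /orP[] /mapP[i _ ->]; rewrite !mxE eqxx /=.
    by case: (coord0 == i) => //=; left.
  by case: (coord0 == i) => //=; right.
have := pgen S S0 Ss (unit_vec coord0).
by rewrite inE /first_coord unit_vecE eqxx.
Qed.

Lemma back_sum_ge0 n (phi : site -> R) u : (forall y, 0 <= phi y) -> 0 <= back_sum p n phi u.
Proof.
move=> h; elim: n u => [|n IH] u /=; first by rewrite addr0.
by rewrite addr_ge0 // sumr_ge0 // => s _; exact: mulr_ge0.
Qed.

Lemma back_sum_ge i n (phi : site -> R) u s : (forall y, 0 <= phi y) -> s \in steps ->
  (i <= n)%N -> p s ^+ i * phi (u - s *+ i) <= back_sum p n phi u.
Proof.
move=> h hs; elim: i n u => [|i IH] n u.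
  move=> _; rewrite mulr0n subr0 expr0 mul1r; case: n => [|n] /=; rewrite ?addr0 // lerDl.
  by apply: sumr_ge0 => s' _; rewrite mulr_ge0 ?back_sum_ge0.
case: n => // n /= /IH{}IH; apply: ler_wpDl => //.
rewrite (big_rem s) //= -[leLHS]addr0; apply: lerD; last first.
  by apply: sumr_ge0 => s' _; rewrite mulr_ge0 ?back_sum_ge0.
rewrite exprS -mulrA mulrS opprD addrA; apply: ler_wpM2l => //; exact: IH.
Qed.

Lemma back_sum_add n k (phi : site -> R) a : (forall u, a <= back_sum p k phi u) ->
  forall u, back_sum p n phi u + a <= back_sum p (n.+1 + k) phi u.
Proof.
move=> ha; have avg u : a <= \sum_(s <- steps) p s * back_sum p k phi (u - s).
  rewrite -[leLHS]mul1r -p_sum mulr_suml; apply: ler_sum => s _; exact: ler_wpM2l.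
elim: n => [|n IH] u; first by rewrite /= addr0 lerD2l.
rewrite /= -addrA lerD2l -[X in _ + X]mul1r -p_sum mulr_suml -big_split /=.
by apply: ler_sum => s _; rewrite -mulrDr; exact: ler_wpM2l.
Qed.

Definition residue0 (r : nat) : bool := r == 0%N.

Lemma residue0_cover L j u s : (0 < L)%N ->
  first_coord s = 1 \/ first_coord s = -1 ->
  exists2 i, (i < L)%N & residue L j (u - s *+ i) = 0%N.
Proof.
move=> L0 hs; set a : int := (first_coord u + j%:Z)%R.
have fc i : first_coord (u - s *+ i) = first_coord u - first_coord s * i%:Z.
  by rewrite /first_coord !mxE mulmxnE -mulr_natr natz.
have LZ : L%:Z != 0 by lia.
have e2 : exists2 e : int, first_coord s = e & e * e = 1 by case: hs => ->; eexists.
case: e2 => e se ee.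
(* As [e] is [1] or [-1], the congruence [a - e * i = 0] modulo [L] is solved by [i = e * a]. *)
exists `|((e * a) %% L%:Z)%Z|%N.
  by rewrite -ltz_nat gez0_abs ?modz_ge0 // ltz_pmod //; lia.
rewrite /residue fc se gez0_abs ?modz_ge0 // addrAC -/a.
have -> : (a - e * ((e * a) %% L%:Z)%Z)%R = (e * ((e * a) %/ L%:Z)%Z * L%:Z)%R.
  have := divz_eq (e * a) L%:Z; set Q := (_ %/ _)%Z; set r := (_ %% _)%Z => h.
  have -> : a = e * (Q * L%:Z + r) by rewrite -h mulrA ee mul1r.
  by ring.
by rewrite modzMl.
Qed.

(** In each stretch of [L] steps the reversed walk repeats the step [s] up to a hyperplane of
    residue [0] with probability at least [p s ^ L], from whatever site it starts. *)
Lemma back_sum_residue0 L : (0 < L)%N -> exists2 c : R, 0 < c & forall m j u,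
  c * m%:R <= back_sum p (m * L) (fun y => (residue0 (residue L j y))%:R) u.
Proof.
move=> L0; have [s [hs ps fs]] := transverse_step.
have p1 : p s <= 1.
  by rewrite -p_sum (big_rem s) //= lerDl sumr_ge0.
exists (p s ^+ L); first by rewrite exprn_gt0.
move=> m j; set phi := fun y => _.
have phi0 y : 0 <= phi y by [].
have one u : p s ^+ L <= back_sum p L.-1 phi u.
  have [i iL hi] := residue0_cover j u L0 fs.
  apply: le_trans (back_sum_ge u phi0 hs (_ : (i <= L.-1)%N)); last by lia.
  by rewrite /phi hi /residue0 eqxx mulr1; apply: ler_wiXn2l => //; lia.
elim: m => [|m IH] u; first by rewrite mulr0 back_sum_ge0.
rewrite -natr1 mulrDr mulr1 addrC mulSn.
apply: le_trans (lerD (one u) (lexx _)) _.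
by have := back_sum_add L.-1 IH u; rewrite prednK.
Qed.

Variable F : site -> R.
Hypothesis F_ge0 : forall u, 0 <= F u.
Hypothesis F_sup : forall u, (u == 0)%:R + \sum_(s <- steps) p s * F (u + s) <= F u.

(** The region may depend on [x] and [K], but [c] may not: this is what allows letting [K] tend to
    infinity and moving to another site. *)
Definition active_phase (lambda : R) (L : nat) (b : nat -> bool) : Prop :=
  exists2 c : R, 0 < c & forall x K, exists W : seq site,
  [/\ uniq W, x \in W, (forall y, y \in W -> reach p x y) &
   forall V : {fset site}, {subset W <= V} ->
     c <= (\sum_(j < L) reach_prob p lambda W x K
            (restrict_config V (pattern L b j), 0%N)) / L%:R].

Lemma active_phaseP lambda L b (t : nat) (delta : R) : 0 < lambda -> (0 < L)%N ->
  0 < delta -> delta <= 1 ->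
  (forall n x z (V : {fset site}), z \in back p n x -> {subset back p (n + t) x <= V} ->
   delta <= (\sum_(j < L) ((particles (restrict_config V (pattern L b j) z))%:R - 1 +
     awake_prob p lambda (back p (n + t) x) z x (restrict_config V (pattern L b j), 0%N)))
       / L%:R) ->
  active_phase lambda L b.
Proof.
move=> l0 L0 d0 d1 h; exists (delta ^+ 2 / 8).
  by rewrite divr_gt0 ?exprn_gt0.
move=> x K; have [n hn] := reach_prob_avg_ge pJ F_ge0 F_sup l0 t x K d0 d1.
exists (back p (n + t) x); split.
- exact: back_uniq.
- exact: (back_refl pJ).
- by move=> y; exact: (back_reach pJ).
- move=> V sub; apply: hn => // [j y _|z zn]; first exact: pattern_restrict.
  exact: h.
Qed.

Lemma awake_prob_pattern lambda W z o eta : 0 < lambda -> uniq W -> z \in W ->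
  (forall u, u \in W -> eta u <> Sleep) -> (particles (eta z) <= 1)%N ->
  (particles (eta z))%:R * expR (- ln (1 + lambda) * F 0) <=
  awake_prob p lambda W z o (eta, 0%N).
Proof.
move=> l0 uW zW ns; case ez : (eta z) => [[|[|n]]|] //= _.
- by rewrite mul0r (awake_prob_ge0 pJ l0).
- rewrite mul1r.
  pose xi : config d := fun u => if u == z then Act 0 else eta u.
  have -> : eta = add_particle z xi.
    by apply/funext => u; rewrite /add_particle /xi; case: eqVneq => // ->.
  rewrite (awake_prob_cfg _ _ _ _ o z _ _ 0).
  apply: (awake_prob_occupied pJ F_ge0 F_sup) => // u /ns; rewrite /xi.
  by case: ifP.
- by have := ns _ zW; rewrite ez.
Qed.

Lemma active_phase_lt1 (lambda : R) : 0 < lambda -> exists (L : nat) (b : nat -> bool), [/\ (0 < L)%N,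
  (\sum_(r < L) (b r)%:R) / L%:R < 1 :> R & active_phase lambda L b].
Proof.
move=> l0; set kappa := expR (- ln (1 + lambda) * F 0).
have k0 : 0 < kappa by exact: expR_gt0.
(* One residue out of [L] is left vacant. The source averaged over the shifts is at least
   [(1 + kappa) * (L - 1) / L - 1], which is positive once [kappa * (L - 1) > 1]. *)
pose L := (Num.bound (2 / kappa)).+2.
pose b r := r != 0%N.
have L0 : 0 < L%:R :> R by [].
have sb : \sum_(r < L) (b r)%:R = L%:R - 1 :> R.
  rewrite big_ord_recl /= add0r (eq_bigr (fun=> 1)) //.
  by rewrite sumr_const card_ord; apply/eqP; rewrite eq_sym subr_eq natr1.
have kL : 2 < kappa * L%:R.
  have := archi_boundP (divr_ge0 (ler0n R 2) (ltW k0)).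
  rewrite ltr_pdivrMr // => /lt_le_trans; apply.
  by rewrite [leRHS]mulrC; apply: ler_wpM2r; [exact: ltW|rewrite ler_nat; exact/leqW/leqW].
have L1 : 1 < L%:R :> R by rewrite ltr1n.
have k1 : kappa <= 1.
  rewrite /kappa -[leRHS]expR0 ler_expR mulNr oppr_le0; apply: mulr_ge0 => //.
  by apply: ln_ge0; rewrite lerDl ltW.
exists L, b; split => //; first by rewrite sb ltr_pdivrMr // mul1r gtrBl.
apply: (@active_phaseP _ _ _ 0 ((kappa * (L%:R - 1) - 1) / L%:R)) => //.
- by rewrite divr_gt0 //; nra.
- by rewrite ler_pdivrMr // mul1r; nra.
move=> n x z V zn sub; rewrite addn0 in sub *.
rewrite ler_pM2r ?invr_gt0 //.
have eqr j : restrict_config V (pattern L b j) z = pattern L b j z.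
  by rewrite /restrict_config (sub _ zn).
apply: (@le_trans _ _ (\sum_(j < L) ((1 + kappa) * (particles (pattern L b j z))%:R - 1))).
  rewrite big_split /= -mulr_sumr pattern_avg sb sumrN sumr_const card_ord; lra.
apply: ler_sum => j _; rewrite eqr.
have := @awake_prob_pattern lambda (back p n x) z x (restrict_config V (pattern L b j))
  l0 (back_uniq _ _ _) zn (fun u _ => @pattern_sleepless L b j V u) (@pattern_restrict L b j V z).
by rewrite eqr -/kappa; lra.
Qed.

Lemma Act_bool_eq1 (b : bool) : (Act b == Act 1) = b.
Proof. by case: b; [rewrite eqxx|apply/eqP]. Qed.

Lemma sum_residue0 L : (0 < L)%N -> \sum_(r < L) (residue0 r)%:R = 1 :> R.
Proof.
case: L => // L _; rewrite big_ord_recl /= big1 ?addr0 // => i _.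
Qed.

Lemma active_phase_small (eps : R) : 0 < eps -> exists (L : nat) (lambda0 : R),
  [/\ (0 < L)%N, 0 < lambda0, (\sum_(r < L) (residue0 r)%:R) / L%:R <= eps &
    forall lambda, 0 < lambda -> lambda < lambda0 -> active_phase lambda L residue0].
Proof.
move=> e0; pose L := (Num.bound eps^-1).+1.
have L0 : 0 < L%:R :> R by [].
have L1 : 1 <= L%:R :> R by rewrite ler1n.
have F1 := green_bound_ge1 pJ F_ge0 F_sup; have F0 : 0 < F 0 by apply: lt_le_trans F1.
have [c c0 hc] := @back_sum_residue0 L isT.
(* One residue out of [L] is occupied, so the averaged source is positive if [awake_prob] is at
   least [1 - 1 / (2 * L)]. The factors 8 here and in [lambda0] keep each of two losses, the absence
   of a walker at [z] and the price of sleep, below [1 / (8 * L)]. *)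
pose A := 8 * F 0 * L%:R.
have A0 : 0 < A by rewrite !mulr_gt0.
pose m := Num.bound (A / c).
have cm : A <= c * m%:R.
  have := archi_boundP (divr_ge0 (ltW A0) (ltW c0)).
  by rewrite ltr_pdivrMr // [X in _ < X]mulrC => /ltW.
pose t := (m * L)%N; pose M := ((2 * t + 1) ^ d)%N.
(* The price of sleep: [kappa * q ^ (t * M)] is [1 + lambda] to the power [- D], hence at least
   [1 - lambda * D]. *)
pose D := F 0 + (t * M)%:R.
have D0 : 0 < D by rewrite ltr_pwDl.
exists L, (8 * D * L%:R)^-1; split => //.
- by rewrite invr_gt0 !mulr_gt0.
- rewrite sum_residue0 // div1r -[leRHS]invrK lef_pV2 ?posrE ?invr_gt0 //.
  apply/ltW/(lt_le_trans (archi_boundP (ltW _))); first by rewrite invr_gt0.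
  by rewrite ler_nat.
move=> lambda l0 ll.
apply: (@active_phaseP _ _ _ t ((2 * L%:R)^-1)) => //.
- by rewrite invr_gt0 mulr_gt0.
- by rewrite invf_le1 ?mulr_gt0 //; lra.
move=> n x z V zn sub.
have eqr y j : y \in back p (n + t) x ->
    restrict_config V (pattern L residue0 j) y = pattern L residue0 j y.
  by move=> /sub h; rewrite /restrict_config h.
have zW : z \in back p (n + t) x by apply: back_homo zn => //; rewrite leq_addr.
have lD : lambda * D <= (8 * L%:R)^-1.
  apply: (@le_trans _ _ ((8 * D * L%:R)^-1 * D)); first by rewrite ler_pM2r // ltW.
  by rewrite le_eqVlt; apply/orP; left; apply/eqP; field; rewrite !gt_eqF.
have hU j : 1 - (2 * L%:R)^-1 <=
    awake_prob p lambda (back p (n + t) x) z x (restrict_config V (pattern L residue0 j), 0%N).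
  apply: le_trans (awake_prob_vacant pJ F_ge0 F_sup l0 (back_uniq _ _ _) zW (t := t)
    (A := A) (M := M) x _ _ _ _ _).
  - have -> : expR (- ln (1 + lambda) * F 0) * (1 + lambda)^-1 ^+ (t * M) = expR (- ln (1 + lambda) * D).
      rewrite mulrDr expRD; congr (_ * _).
      by rewrite expRM_natr expRN lnK // posrE addr_gt0.
    have h1 : 1 - (8 * L%:R)^-1 <= expR (- ln (1 + lambda) * D).
      apply: le_trans (expR_ge1Dx _); rewrite lerD2l mulNr lerN2.
      apply: le_trans lD; apply: ler_wpM2r; first exact: ltW.
      by apply: le_ln1Dx; apply: lt_trans l0; rewrite oppr_lt0.
    have h2 : F 0 / (F 0 + A) <= (8 * L%:R)^-1.
      rewrite ler_pdivrMr ?addr_gt0 // mulrC ler_pdivlMr ?mulr_gt0 // /A; lra.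
    have i1 : (8 * L%:R)^-1 <= 8^-1 :> R.
      by rewrite lef_pV2 ?posrE ?mulr_gt0 //; lra.
    have i2 : (2 * L%:R)^-1 = 4 * (8 * L%:R)^-1 :> R by field; rewrite gt_eqF.
    have i0 : 0 < (8 * L%:R)^-1 :> R by rewrite invr_gt0 mulr_gt0.
    rewrite i2; move: h1 h2 i1 i0; set X := expR _; set Y := F 0 / _; set Z := (8 * _)^-1.
    by move=> *; nra.
  - by move=> u _; exact: pattern_sleepless.
  - by move=> y; exact: (back_trans pJ zn).
  - exact: ltW.
  - apply: (le_trans cm); apply: (le_trans (hc m j z)).
    rewrite -(gre_dual pJ _ (back_uniq p t z)) //.
    rewrite big_seq [leRHS]big_seq; apply: ler_sum => y yz.
    rewrite eqr ?Act_bool_eq1 //; apply: (back_trans pJ zn); by rewrite -mem_back.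
  - exact: size_back.
have L2 : (2 * L%:R)^-1 * L%:R = 2^-1 :> R by field; rewrite gt_eqF.
rewrite ler_pdivlMr // L2.
apply: (@le_trans _ _ (\sum_(j < L) ((particles (pattern L residue0 j z))%:R - (2 * L%:R)^-1))).
  rewrite big_split /= pattern_avg sum_residue0 // sumrN sumr_const card_ord.
  by rewrite -[(2 * L%:R)^-1 *+ L]mulr_natr L2; lra.
by apply: ler_sum => j _; rewrite eqr //; have := hU j; lra.
Qed.

End Pattern.

(** * Discrete random variables *)

(** There is no sigma-algebra on [C]: every function of such a variable is again one. *)
Definition discrete_rv d (T : measurableType d) (C : Type) (f : T -> C) : Prop :=
  forall B : set C, measurable (f @^-1` B).

Section DiscreteRV.
Variables (d : measure_display) (T : measurableType d).

Lemma discrete_rvP (C : countType) (f : T -> C) :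
  (forall c, measurable (f @^-1` [set c])) -> discrete_rv f.
Proof.
move=> h B; pose G n : set T :=
  if (choice.unpickle n : option C) is Some c then [set o | f o = c /\ B c] else set0.
have -> : f @^-1` B = \bigcup_n G n.
  apply/seteqP; split => [ o Bo | o [n _]]; last first.
    by rewrite /G; case: (choice.unpickle n : option C) => [c /= [<-]|].
  by exists (choice.pickle (f o)) => //; rewrite /G choice.pickleK.
apply: bigcupT_measurable => n; rewrite /G; case: (choice.unpickle n : option C) => // c.
have [Bc|nBc] := pselect (B c).
  by rewrite (_ : [set _ | _] = f @^-1` [set c]) //; apply/seteqP; split => o //= [].
by rewrite (_ : [set _ | _] = set0) //; apply/seteqP; split => o //= [].
Qed.

Lemma discrete_rv_comp (C C' : Type) (f : T -> C) (g : C -> C') :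
  discrete_rv f -> discrete_rv (g \o f).
Proof. by move=> h B; rewrite comp_preimage; exact: h. Qed.

Lemma discrete_rv_cst (C : Type) (c : C) : discrete_rv (fun _ : T => c).
Proof.
move=> B; have [Bc|nBc] := pselect (B c).
  by rewrite (_ : _ @^-1` _ = setT) //; apply/seteqP; split.
by rewrite (_ : _ @^-1` _ = set0) //; apply/seteqP; split.
Qed.

Lemma discrete_rv_pair (C C' : countType) (f : T -> C) (g : T -> C') :
  discrete_rv f -> discrete_rv g -> discrete_rv (fun o => (f o, g o)).
Proof.
move=> hf hg; apply: discrete_rvP => -[c c'].
rewrite (_ : _ @^-1` _ = f @^-1` [set c] `&` g @^-1` [set c']).
  exact: measurableI.
by apply/seteqP; split => o /= [] -> ->.
Qed.

Lemma discrete_rv_map (I : Type) (C : countType) (l : seq I) (f : I -> T -> C) :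
  (forall i, discrete_rv (f i)) -> discrete_rv (fun o => [seq f i o | i <- l]).
Proof.
move=> h; elim: l => [|i l IH]; first exact: discrete_rv_cst.
exact: (discrete_rv_comp (fun x : C * seq C => x.1 :: x.2) (discrete_rv_pair (h i) IH)).
Qed.

Lemma discrete_rv_pred (C : Type) (f : T -> C) (P : C -> Prop) : discrete_rv f ->
  measurable [set o | P (f o)].
Proof. by move=> h; exact: (h [set c | P c]). Qed.

Lemma measurable_ex_count (C : countType) (F : C -> set T) :
  (forall c, measurable (F c)) -> measurable [set o | exists c, F c o].
Proof.
move=> mF; pose G n : set T := if (choice.unpickle n : option C) is Some c then F c else set0.
rewrite (_ : [set _ | _] = \bigcup_n G n).
  by apply: bigcupT_measurable => n; rewrite /G; case: choice.unpickle.
apply/seteqP; split => [ o [c Fo]|o [n _]].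
  by exists (choice.pickle c) => //; rewrite /G choice.pickleK.
by rewrite /G; case: choice.unpickle => // c Fo; exists c.
Qed.

Lemma measurable_all_count (C : countType) (F : C -> set T) :
  (forall c, measurable (F c)) -> measurable [set o | forall c, F c o].
Proof.
move=> mF; rewrite (_ : [set _ | _] = ~` [set o | exists c, (~` F c) o]).
  apply: measurableC; apply: measurable_ex_count => c; exact: measurableC.
by apply/seteqP; split => o /= h; [case=> c|move=> c; apply: contrapT => hc; apply: h; exists c].
Qed.

End DiscreteRV.

Section Pr.
Variables (d : measure_display) (T : measurableType d) (R : realType).
Variable P : probability T R.

Definition pr (A : set T) : R := fine (P A).

Lemma prE A : measurable A -> P A = (pr A)%:E.
Proof. by move=> mA; rewrite /pr fineK // fin_num_measure. Qed.

Lemma pr_ge0 A : 0 <= pr A. Proof. exact: fine_ge0. Qed.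

Lemma pr_set0 : pr set0 = 0. Proof. by rewrite /pr measure0. Qed.

Lemma pr_setT : pr setT = 1. Proof. by rewrite /pr probability_setT. Qed.

Lemma pr_le A B : measurable A -> measurable B -> A `<=` B -> pr A <= pr B.
Proof. by move=> mA mB AB; rewrite -lee_fin -!prE // le_measure ?inE. Qed.

Lemma pr_le_ae A B : measurable A -> measurable B -> {ae P, forall o, A o -> B o} ->
  pr A <= pr B.
Proof.
move=> mA mB [N [mN N0 hN]].
apply: (@le_trans _ _ (pr (B `|` N))).
  apply: pr_le => //; first exact: measurableU.
  by move=> o Ao; have [Bo|nB] := pselect (B o); [left|right; apply: hN => /(_ Ao)].
rewrite -lee_fin -!prE //; last exact: measurableU.
by apply: le_trans (measureU2 P mB mN) _; rewrite [X in (_ + X)%E]N0 adde0.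
Qed.

Lemma pr_disjU A B : measurable A -> measurable B -> A `&` B = set0 ->
  pr (A `|` B) = pr A + pr B.
Proof.
move=> mA mB AB; apply: EFin_inj; rewrite EFinD -!prE //; last exact: measurableU.
exact: measureU.
Qed.

Lemma pr_setID A B : measurable A -> measurable B ->
  pr A = pr (A `&` B) + pr (A `\` B).
Proof.
move=> mA mB; rewrite -{1}[A](setUIDK A B); apply: pr_disjU.
- exact: measurableI.
- exact: measurableD.
- by apply/seteqP; split => // x [[_ ?] [_ ?]].
Qed.

Lemma pr_setC A : measurable A -> pr (~` A) = 1 - pr A.
Proof.
move=> mA; apply/eqP; rewrite eq_sym subr_eq -pr_disjU ?setUCl ?pr_setT ?setICl //.
exact: measurableC.
Qed.

Lemma pr_bigcup_le (F : nat -> set T) b : (forall n, measurable (F n)) ->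
  {homo F : n m / (n <= m)%N >-> n `<=` m} -> (forall n, pr (F n) <= b) ->
  pr (\bigcup_n F n) <= b.
Proof.
move=> mF hF hb; have mU : measurable (\bigcup_n F n) by exact: bigcupT_measurable.
have hF' : {homo F : n m / (n <= m)%N >-> (n <= m)%O}.
  by move=> n m nm; rewrite subsetEset; exact: hF.
have := nondecreasing_cvg_mu (mu := P) mF mU hF' => cF.
rewrite -lee_fin -prE // -(cvg_lim _ cF) //.
apply: lime_le; first exact: cvgP cF.
by apply: nearW => n /=; rewrite prE // lee_fin.
Qed.

Lemma pr_bigcup0 (F : nat -> set T) : (forall n, measurable (F n)) ->
  (forall n, pr (F n) = 0) -> pr (\bigcup_n F n) = 0.
Proof.
move=> mF h; rewrite /pr (_ : P _ = 0%E) //.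
apply/negligibleP; first exact: bigcupT_measurable.
apply: negligible_bigcup => n; apply/negligibleP => //.
by apply: etrans (prE (mF n)) _; rewrite h.
Qed.

Lemma pr_bigU (I : eqType) (r : seq I) (F : I -> set T) : uniq r ->
  (forall i, measurable (F i)) ->
  (forall i j, i != j -> F i `&` F j = set0) ->
  pr [set o | exists2 i, i \in r & F i o] = \sum_(i <- r) pr (F i) /\
  measurable [set o | exists2 i, i \in r & F i o].
Proof.
move=> ur mF dF; elim: r ur => [|i r IH] /=.
  by move=> _; rewrite big_nil (_ : [set _ | _] = set0) ?pr_set0 //; apply/seteqP; split => o //= [].
move=> /andP[ir /IH[e m]]; rewrite big_cons -e.
have -> : [set o | exists2 j, j \in i :: r & F j o] =
    F i `|` [set o | exists2 j, j \in r & F j o].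
  apply/seteqP; split => o /=.
    by move=> [j]; rewrite inE => /orP[/eqP ->|jr] Fj; [left|right; exists j].
  move=> [Fi|[j jr Fj]]; first by exists i; rewrite ?mem_head.
  by exists j => //; rewrite inE jr orbT.
split; last exact: measurableU.
apply: pr_disjU => //; apply/seteqP; split => // o [Fi [j jr Fj]].
have ij : i != j by apply: contraNneq ir => ->.
by have := dF i j ij; rewrite -subset0; apply.
Qed.

(** Markov's inequality for a nonnegative combination of indicators, by splitting [A] along each
    [F i] instead of integrating. *)
Lemma pr_markov (I : Type) (r : seq I) (c : I -> R) (F : I -> set T) (A : set T) u :
  (forall i, 0 <= c i) -> (forall i, measurable (F i)) -> measurable A ->
  (forall o, A o -> u <= \sum_(i <- r) c i * (`[< F i o >])%:R) ->
  u * pr A <= \sum_(i <- r) c i * pr (F i).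
Proof.
move=> c0 mF mA hA; apply: (@le_trans _ _ (\sum_(i <- r) c i * pr (F i `&` A))); last first.
  apply: ler_sum => i _; apply: ler_wpM2l => //.
  by apply: pr_le => [|//|o []//]; exact: measurableI.
elim: r A u mA hA => [|i r IH] A u mA hA.
  rewrite big_nil; have [->|/set0P[ o /hA]] := eqVneq A set0; first by rewrite pr_set0 mulr0.
  by rewrite big_nil => u0; rewrite mulr_le0_ge0 // pr_ge0.
have mI : measurable (A `&` F i) by exact: measurableI.
have mD : measurable (A `\` F i) by exact: measurableD.
have h1 := IH _ (u - c i) mI _; have h2 := IH _ u mD _.
have {}h1 : (u - c i) * pr (A `&` F i) <= \sum_(j <- r) c j * pr (F j `&` (A `&` F i)).
  by apply: h1 => o [/hA]; rewrite big_cons => + Fi; rewrite asboolT //= mulr1; lra.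
have {}h2 : u * pr (A `\` F i) <= \sum_(j <- r) c j * pr (F j `&` (A `\` F i)).
  by apply: h2 => o [/hA]; rewrite big_cons => + Fi; rewrite asboolF //= mulr0; lra.
rewrite big_cons [F i `&` A]setIC (pr_setID mA (mF i)).
rewrite (eq_bigr (fun j => c j * pr (F j `&` (A `&` F i)) + c j * pr (F j `&` (A `\` F i)))).
  by rewrite big_split /=; lra.
move=> j _; rewrite -mulrDr; congr (_ * _).
by rewrite (pr_setID _ (mF i)) ?setIA ?setIDA //; exact: measurableI.
Qed.

Lemma measurable_weighted (u : R) (I : Type) (r : seq I) (c : I -> R) (F : I -> set T) :
  (forall i, measurable (F i)) ->
  measurable [set o | u <= \sum_(i <- r) c i * (`[< F i o >])%:R].
Proof.
move=> mF.
have h : discrete_rv (fun o => [seq `[< F i o >] | i <- r]).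
  apply: discrete_rv_map => i; apply: discrete_rvP => -[].
    rewrite (_ : _ @^-1` _ = F i) //; apply/seteqP; split => o /=; first by move/asboolP.
    by move=> ?; apply/asboolP.
  rewrite (_ : _ @^-1` _ = ~` F i); first exact: measurableC.
  by apply/seteqP; split => o /=; [move/asboolPn|move=> ?; exact/asboolPn].
have := discrete_rv_pred (fun l : seq bool => u <= \sum_(a <- zip (map c r) l) a.1 * a.2%:R) h.
rewrite (_ : [set o | u <= \sum_(a <- zip (map c r) [seq `[< F i o >] | i <- r]) a.1 * a.2%:R] =
  [set o | u <= \sum_(i <- r) c i * (`[< F i o >])%:R]) //.
by apply/seteqP; split => o /=; rewrite zip_map big_map.
Qed.

End Pr.

(** * The chain of configurations at ring times *)

Section Chain.
Variables (d : nat) (R : realType) (p : 'rV[int]_d -> R).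
Hypothesis pJ : jump_distribution p.
Local Notation site := 'rV[int]_d.
Local Notation steps := (unit_steps d).
Variable lambda : R.
Hypothesis lambda_gt0 : 0 < lambda.

Let p_ge0 s : 0 <= p s. Proof. by case: pJ. Qed.
Let p_sum : \sum_(s <- steps) p s = 1. Proof. by case: pJ. Qed.
Let l1_gt0 : 0 < 1 + lambda. Proof. by rewrite addr_gt0. Qed.

(** A property preserved by the dynamics that gives a finite support and bounds the rates. *)
Definition mass_le (N : nat) (eta : config d) : Prop :=
  forall D : seq site, uniq D -> (\sum_(u <- D) particles (eta u) <= N)%N.

Lemma active_le_particles a : (active a <= particles a)%N.
Proof. by case: a. Qed.

Lemma mass_le_finite N eta : mass_le N eta ->
  finite_set [set u | (0 < active (eta u))%N].
Proof.
move=> h; apply: contrapT => inf.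
have [B BA NB] := infinite_set_fset N.+1 inf.
have := h B (fset_uniq B); apply/negP; rewrite -ltnNge; apply: leq_trans NB _.
rewrite -sum1_size big_seq [X in (_ <= X)%N]big_seq; apply: leq_sum => u uB.
exact: leq_trans (BA u uB) (active_le_particles _).
Qed.

Definition supp (eta : config d) : seq site :=
  enum_fset (fset_set [set u | (0 < active (eta u))%N]).

Lemma supp_uniq eta : uniq (supp eta). Proof. exact: fset_uniq. Qed.

Lemma mem_supp N eta u : mass_le N eta -> (u \in supp eta) = (0 < active (eta u))%N.
Proof.
move=> /mass_le_finite fs; have := in_fset_set fs u; rewrite -topredE /= => ->.
by apply/idP/idP; rewrite inE.
Qed.

Lemma fsbig_supp N eta (f : site -> R) : mass_le N eta ->
  (forall x, active (eta x) = 0%N -> f x = 0) ->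
  \sum_(x \in [set: site]) f x = \sum_(x <- supp eta) f x.
Proof.
move=> h f0; rewrite (fsbigE (supp eta) f (supp_uniq eta)) //.
  by apply: eq_bigl => x; rewrite in_setT.
move=> x _; rewrite (mem_supp _ h) lt0n negbK => /eqP; exact: f0.
Qed.

Lemma total_rateE N eta : mass_le N eta ->
  total_rate lambda eta = \sum_(x <- supp eta) ring_rate lambda eta x.
Proof. by move=> h; apply: (fsbig_supp h) => x e; rewrite /ring_rate e mulr0. Qed.

Lemma ring_rate_ge0 (eta : config d) x : 0 <= ring_rate lambda eta x.
Proof. by rewrite mulr_ge0 // ltW. Qed.

Lemma total_rate_ge0 N eta : mass_le N eta -> 0 <= total_rate lambda eta.
Proof.
by move=> /total_rateE ->; apply: sumr_ge0 => x _; exact: ring_rate_ge0.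
Qed.

Lemma total_rate_le N eta : mass_le N eta -> total_rate lambda eta <= (1 + lambda) * N%:R.
Proof.
move=> h; rewrite (total_rateE h) -mulr_sumr; apply: ler_wpM2l; first exact: ltW.
rewrite -natr_sum ler_nat; apply: leq_trans (h _ (supp_uniq eta)).
by apply: leq_sum => x _; exact: active_le_particles.
Qed.

Lemma rate_le_total N eta x : mass_le N eta ->
  ring_rate lambda eta x <= total_rate lambda eta.
Proof.
move=> h; rewrite (total_rateE h); have [xs|xs] := boolP (x \in supp eta).
  rewrite (big_rem x) //= lerDl; apply: sumr_ge0 => y _; exact: ring_rate_ge0.
move: xs; rewrite (mem_supp _ h) lt0n negbK => /eqP e.
rewrite /ring_rate e mulr0; apply: sumr_ge0 => y _; exact: ring_rate_ge0.
Qed.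

Lemma mass_le_sleep N x eta : mass_le N eta -> mass_le N (sleep_at x eta).
Proof.
move=> h D uD; rewrite (eq_bigr (fun u => particles (eta u))) ?h // => u _.
exact: (@particles_sleep d x (eta, 0%N)).
Qed.

Lemma mass_le_move N x s eta : mass_le N eta -> (0 < active (eta x))%N -> s != 0 ->
  mass_le N (move x (x + s) eta).
Proof.
move=> h ax s0.
have : x + s != x by rewrite -subr_eq0 addrAC subrr add0r.
move: (x + s) => t xs.
have nle u : (particles (move x t eta u) + (u == x) =
    particles (eta u) + (u == t))%N.
  rewrite moveE; have [->|ux] := eqVneq u x.
    by rewrite eq_sym (negPf xs) addn0; move: ax; case: (eta x) => // -[|n] //= _; rewrite addn1.
  by rewrite addn0; case: ifP => _; rewrite ?addn0 //; case: (eta u) => [n|] /=; rewrite ?addn1.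
suff main D : uniq D -> x \in D ->
    (\sum_(u <- D) particles (move x t eta u) <= N)%N.
  move=> D uD; have [xD|xD] := boolP (x \in D); first exact: main.
  apply: leq_trans (main (x :: D) _ _); rewrite ?mem_head //= ?xD //.
  by rewrite big_cons leq_addl.
move=> uD xD; rewrite -(leq_add2r 1).
have e1 a : uniq D -> (\sum_(u <- D) (u == a) = (a \in D))%N.
  move=> _; have [aD|aD] := boolP (a \in D).
    by rewrite (bigD1_seq a) //= eqxx big1 // => u /negPf ->.
  by rewrite big_seq big1 // => u uD'; case: eqP aD => // <-; rewrite uD'.
have -> : (\sum_(u <- D) particles (move x t eta u) + 1 =
   \sum_(u <- D) particles (eta u) + (t \in D))%N.
  rewrite -{1}(e1 t) // -big_split /= -(eq_bigr _ (fun u _ => nle u)) big_split /=.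
  by rewrite e1 // xD.
by apply: leq_add; [exact: h|exact: leq_b1].
Qed.

(** [eta] itself is listed for the absorbing case. *)
Definition succs (eta : config d) : seq (config d) :=
  undup (eta :: flatten [seq sleep_at x eta :: [seq move x (x + s) eta | s <- steps]
                        | x <- supp eta]).

Lemma succs_uniq eta : uniq (succs eta). Proof. exact: undup_uniq. Qed.

Lemma succs_self eta : eta \in succs eta.
Proof. by rewrite mem_undup mem_head. Qed.

Lemma succs_sleep eta x : x \in supp eta -> sleep_at x eta \in succs eta.
Proof.
move=> xs; rewrite mem_undup inE; apply/orP; right; apply/flattenP.
by eexists; [exact: map_f xs|rewrite mem_head].
Qed.

Lemma succs_move eta x s : x \in supp eta -> s \in steps ->
  move x (x + s) eta \in succs eta.
Proof.
move=> xs hs; rewrite mem_undup inE; apply/orP; right; apply/flattenP.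
eexists; first exact: map_f xs.
by rewrite inE; apply/orP; right; apply: map_f.
Qed.

Lemma succs_mass N eta e : mass_le N eta -> e \in succs eta -> mass_le N e.
Proof.
move=> h; rewrite mem_undup inE => /orP[/eqP -> //|/flattenP[l /mapP[x xs ->]]].
rewrite inE => /orP[/eqP ->|/mapP[s hs ->]]; first exact: mass_le_sleep.
apply: mass_le_move => //; first by rewrite -(mem_supp _ h).
exact: unit_steps_neq0.
Qed.

Definition ring_mean (f : config d -> R) (x : site) (eta : config d) : R :=
  lambda / (1 + lambda) * f (sleep_at x eta) +
  \sum_(s <- steps) p s / (1 + lambda) * f (move x (x + s) eta).

Definition chain_mean (f : config d -> R) (eta : config d) : R :=
  if total_rate lambda eta == 0 then f eta else
  \sum_(x <- supp eta) ring_rate lambda eta x / total_rate lambda eta * ring_mean f x eta.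

Lemma sum_asbool_eq (r : seq (config d)) a (f : config d -> R) : uniq r -> a \in r ->
  \sum_(e <- r) `[< e = a >]%:R * f e = f a.
Proof.
move=> ur ar; rewrite (bigD1_seq a) //= asboolT // mul1r big1 ?addr0 // => e ea.
by rewrite asboolF ?mul0r //; apply/eqP.
Qed.

Lemma ring_chain_mean N eta f : mass_le N eta ->
  \sum_(e <- succs eta) ring_chain p lambda eta e * f e = chain_mean f eta.
Proof.
move=> h; rewrite /ring_chain /chain_mean; case: ifP => _.
  by rewrite sum_asbool_eq ?succs_uniq ?succs_self.
have supE e : \sum_(x \in [set: site])
      ring_rate lambda eta x / total_rate lambda eta * ring_outcome p lambda x eta e =
    \sum_(x <- supp eta)
      ring_rate lambda eta x / total_rate lambda eta * ring_outcome p lambda x eta e.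
  by apply: (fsbig_supp h) => x ex; rewrite /ring_rate ex mulr0 !mul0r.
under eq_bigr => e _ do rewrite supE mulr_suml.
rewrite exchange_big /= big_seq [RHS]big_seq; apply: eq_bigr => x xs.
under eq_bigr => e _ do rewrite -mulrA.
rewrite -mulr_sumr; congr (_ * _); rewrite /ring_outcome /ring_mean.
under eq_bigr => e _ do rewrite mulrDl -mulrA mulr_suml.
rewrite big_split /= -mulr_sumr sum_asbool_eq ?succs_uniq ?succs_sleep //; congr (_ + _).
rewrite exchange_big /= big_seq [RHS]big_seq; apply: eq_bigr => s hs.
under eq_bigr => e _ do rewrite -mulrA.
by rewrite -mulr_sumr sum_asbool_eq ?succs_uniq ?succs_move.
Qed.

Lemma ring_chain_ge0 N eta e : mass_le N eta -> 0 <= ring_chain p lambda eta e.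
Proof.
move=> h; rewrite /ring_chain; case: ifP => // _.
rewrite (fsbig_supp h); last by move=> x ex; rewrite /ring_rate ex mulr0 !mul0r.
apply: sumr_ge0 => x _; apply: mulr_ge0.
  by rewrite divr_ge0 ?ring_rate_ge0 ?(total_rate_ge0 h).
have l0 := ltW lambda_gt0; have l1 := ltW l1_gt0.
apply: addr_ge0; first by rewrite mulr_ge0 ?divr_ge0.
by apply: sumr_ge0 => s _; rewrite mulr_ge0 ?divr_ge0.
Qed.

Lemma ring_mean_le f g x eta : f (sleep_at x eta) <= g (sleep_at x eta) ->
  (forall s, s \in steps -> f (move x (x + s) eta) <= g (move x (x + s) eta)) ->
  ring_mean f x eta <= ring_mean g x eta.
Proof.
move=> h1 h2; apply: lerD.
  by apply: ler_wpM2l => //; rewrite divr_ge0 // ltW.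
rewrite big_seq [leRHS]big_seq; apply: ler_sum => s hs; apply: ler_wpM2l; last exact: h2.
by rewrite divr_ge0 // ltW.
Qed.

Lemma ring_mean_cst c x eta : ring_mean (fun=> c) x eta = c.
Proof.
rewrite /ring_mean -mulr_suml -mulr_suml p_sum; field; by rewrite gt_eqF.
Qed.

Lemma sum_rate_ratio N eta : mass_le N eta -> total_rate lambda eta != 0 ->
  \sum_(x <- supp eta) ring_rate lambda eta x / total_rate lambda eta = 1.
Proof. by move=> h t0; rewrite -mulr_suml -(total_rateE h) mulfV. Qed.

Lemma chain_mean_le_cst N f eta c : mass_le N eta -> f eta <= c ->
  (forall x, (0 < active (eta x))%N -> ring_mean f x eta <= c) ->
  chain_mean f eta <= c.
Proof.
move=> h fc hc; rewrite /chain_mean; case: ifP => // /negbT t0.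
rewrite -[leRHS]mul1r -(sum_rate_ratio h t0) mulr_suml.
rewrite big_seq [leRHS]big_seq; apply: ler_sum => x xs; apply: ler_wpM2l.
  by rewrite divr_ge0 ?ring_rate_ge0 ?(total_rate_ge0 h).
by apply: hc; rewrite -(mem_supp _ h).
Qed.

Lemma chain_mean_cst N c eta : mass_le N eta -> chain_mean (fun=> c) eta = c.
Proof.
move=> h; rewrite /chain_mean; case: ifP => // /negbT t0.
under eq_bigr => x _ do rewrite ring_mean_cst.
by rewrite -mulr_suml (sum_rate_ratio h t0) mul1r.
Qed.

Lemma ring_chain_sum1 N eta : mass_le N eta ->
  \sum_(e <- succs eta) ring_chain p lambda eta e = 1.
Proof.
move=> h; rewrite -(chain_mean_cst 1 h) -(ring_chain_mean _ h).
by apply: eq_bigr => e _; rewrite mulr1.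
Qed.

(* A ring at [y] is a jump with probability [1 / (1 + lambda)], so that [y]
   decreases at rate at least one. *)
Lemma chain_mean_drop N eta y : mass_le N eta -> (0 < active (eta y))%N ->
  (total_rate lambda eta)^-1 <=
  chain_mean (fun e => (active (e y) < active (eta y))%N%:R) eta.
Proof.
move=> h ay; have r0 : 0 < ring_rate lambda eta y by rewrite mulr_gt0 // ltr0n.
have t0 : 0 < total_rate lambda eta by exact: lt_le_trans (rate_le_total y h).
rewrite /chain_mean gt_eqF // (big_rem y) ?(mem_supp _ h) //=.
apply: ler_wpDr.
  apply: sumr_ge0 => x _; apply: mulr_ge0; first by rewrite divr_ge0 ?ring_rate_ge0 // ltW.
  by rewrite -(ring_mean_cst 0 x eta); apply: ring_mean_le.
rewrite mulrAC -[leLHS]mul1r; apply: ler_wpM2r; first by rewrite invr_ge0 ltW.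
have : (1 + lambda)^-1 <= ring_mean (fun e => (active (e y) < active (eta y))%N%:R) y eta.
  rewrite /ring_mean; apply: ler_wpDl; first by rewrite mulr_ge0 // divr_ge0 // ltW.
  apply: (@le_trans _ _ (\sum_(s <- steps) p s * (1 + lambda)^-1)).
    by rewrite -mulr_suml p_sum mul1r.
  apply: ler_sum => s _.
  have -> : (active (move y (y + s)%R eta y) < active (eta y))%N.
    by rewrite moveE eqxx; move: ay; case: (eta y) => // -[|n].
  by rewrite mulr1.
move=> /(ler_wpM2l (ltW r0)); apply: le_trans.
rewrite /ring_rate mulrAC mulfV ?gt_eqF // mul1r.
by rewrite ler1n.
Qed.

End Chain.

(** * Finite systems *)

Section FiniteSystem.
Variables (d : nat) (R : realType) (p : 'rV[int]_d -> R).
Hypothesis pJ : jump_distribution p.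
Local Notation site := 'rV[int]_d.
Local Notation steps := (unit_steps d).
Variable lambda : R.
Hypothesis lambda_gt0 : 0 < lambda.
Variables (disp : measure_display) (T : measurableType disp) (P : probability T R).
Variables (Y : nat -> T -> configT d) (H : nat -> T -> \bar R).
Hypothesis mY : forall n, measurable_fun [set: T] (Y n).
Hypothesis mH : forall n, measurable_fun [set: T] (H n).
Variables (L N : nat) (init : 'I_L -> config d).
Hypothesis L_gt0 : (0 < L)%N.
Hypothesis init_mass : forall j, mass_le N (init j).

Definition init_law (e : config d) : R := (\sum_j (init j == e)%:R) / L%:R.

Let rc (eta : nat -> config d) i := ring_chain p lambda (eta i) (eta i.+1).
Let rt (eta : nat -> config d) i := total_rate lambda (eta i).

Hypothesis law : forall (n : nat) (eta : nat -> config d) (h : nat -> R),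
  (forall i, 0 <= h i) ->
  P [set o | (forall i, (i <= n)%N -> Y i o = eta i) /\
             (forall i, (i < n)%N -> ((h i)%:E < H i o)%E)] =
  (init_law (eta 0%N) * \prod_(i < n) (rc eta i * expR (- (rt eta i * h i))))%:E.

Lemma measurable_Y_site n x a : measurable [set o | Y n o x = a].
Proof.
rewrite (_ : [set _ | _] = [set: T] `&` (Y n @^-1` [set eta : configT d | eta x = a])).
  by apply: mY => //; apply: sub_sigma_algebra; exists x, a.
by rewrite setTI.
Qed.

Lemma measurable_Y_eq n (e : config d) : measurable [set o | Y n o = e].
Proof.
pose G k : set T := if (choice.unpickle k : option site) is Some x
  then [set o | Y n o x = e x] else setT.
rewrite (_ : [set _ | _] = \bigcap_k G k).
  apply: bigcapT_measurable => k; rewrite /G; case: choice.unpickle => // x.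
  exact: measurable_Y_site.
apply/seteqP; split => [ o /= ye k _|o h].
  by rewrite /G; case: choice.unpickle => // x /=; rewrite ye.
by apply/funext => x; have := h (choice.pickle x) I; rewrite /G choice.pickleK.
Qed.

Lemma discrete_active n x : discrete_rv (fun o => active (Y n o x)).
Proof.
apply: discrete_rvP => c; case: c => [|c].
  rewrite (_ : _ @^-1` _ = [set o | Y n o x = Act 0] `|` [set o | Y n o x = Sleep]).
    by apply: measurableU; exact: measurable_Y_site.
  apply/seteqP; split => o /=; last by case=> ->.
  by case: (Y n o x) => [k|] /= => [->|]; [left|right].
rewrite (_ : _ @^-1` _ = [set o | Y n o x = Act c.+1]); first exact: measurable_Y_site.
by apply/seteqP; split => o /= => [|->//]; case: (Y n o x) => [k|] //= ->.
Qed.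

Lemma measurable_H_gt n h : measurable [set o | (h%:E < H n o)%E].
Proof.
rewrite (_ : [set _ | _] = [set: T] `&` [set o | (h%:E < H n o)%E]); last by rewrite setTI.
exact: (measurable_lte measurableT (measurable_cst h%:E) (mH n)).
Qed.

Lemma measurable_H_01 n : measurable [set o | (0%:E < H n o)%E /\ (H n o <= 1%:E)%E].
Proof.
rewrite (_ : [set _ | _] = [set o | (0%:E < H n o)%E] `\` [set o | (1%:E < H n o)%E]).
  by apply: measurableD; exact: measurable_H_gt.
apply/seteqP; split => o /= [h1 h2]; split => //; first by rewrite ltNge h2.
by rewrite leNgt; exact/negP.
Qed.

Lemma measurable_forall_lt n (G : nat -> set T) : (forall i, measurable (G i)) ->
  measurable [set o | forall i, (i < n)%N -> G i o].
Proof.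
move=> mG; rewrite (_ : [set _ | _] = \bigcap_i (if (i < n)%N then G i else setT)).
  by apply: bigcapT_measurable => i; case: ifP.
apply/seteqP; split => o /= h i => [_|ni]; first by case: ifP => // /h.
by have := h i I; rewrite ni.
Qed.

Definition cyl (n : nat) (eta : nat -> config d) : set T :=
  [set o | (forall i, (i <= n)%N -> Y i o = eta i) /\
           (forall i, (i < n)%N -> (0%:E < H i o)%E)].

Lemma measurable_path n eta : measurable [set o | forall i, (i <= n)%N -> Y i o = eta i].
Proof.
exact: (@measurable_forall_lt n.+1 (fun i => [set o | Y i o = eta i])
  (fun i => measurable_Y_eq i (eta i))).
Qed.

Lemma measurable_cyl n eta : measurable (cyl n eta).
Proof.
apply: measurableI; first exact: measurable_path.
by apply: measurable_forall_lt => i; exact: measurable_H_gt.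
Qed.

Definition weight n (eta : nat -> config d) : R :=
  init_law (eta 0%N) * \prod_(i < n) rc eta i.

Lemma pr_cyl n eta : pr P (cyl n eta) = weight n eta.
Proof.
rewrite /pr (law n eta (h := fun=> 0)) //=; congr (_ * _).
by apply: eq_bigr => i _; rewrite mulr0 oppr0 expR0 mulr1.
Qed.

Lemma pr_cyl_gt n eta h : 0 <= h ->
  pr P (cyl n.+1 eta `&` [set o | (h%:E < H n o)%E]) =
  weight n.+1 eta * expR (- (rt eta n * h)).
Proof.
move=> h0; pose hh i := if i == n then h else 0.
have -> : cyl n.+1 eta `&` [set o | (h%:E < H n o)%E] =
    [set o | (forall i, (i <= n.+1)%N -> Y i o = eta i) /\
             (forall i, (i < n.+1)%N -> ((hh i)%:E < H i o)%E)].
  apply/seteqP; split => o /= => [[[h1 h2] h3]|[h1 h2]].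
    by split => // i iN; rewrite /hh; case: eqP => [->|_] //; exact: h2.
  split; first split => //.
    move=> i iN; apply: le_lt_trans (h2 i iN); rewrite lee_fin /hh.
    by case: ifP.
  by have := h2 n (leqnn _); rewrite /hh eqxx.
rewrite /pr law /=; last by move=> i; rewrite /hh; case: ifP.
rewrite /weight -mulrA; congr (_ * _).
rewrite !big_ord_recr /= {2}/hh eqxx mulrA; congr (_ * _ * _).
apply: eq_bigr => i _; rewrite /hh ltn_eqF ?ltn_ord //.
by rewrite mulr0 oppr0 expR0 mulr1.
Qed.

(** The law describes only the events [h i < H i]. The event [0 < H i <= 1] is a difference of two
    of them, and the induction on [j] treats one index at a time. *)
Lemma pr_path_le1 (c : nat -> bool) j n eta h : (forall i, 0 <= h i) ->
  pr P [set o | (forall i, (i <= n)%N -> Y i o = eta i) /\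
    (forall i, (i < n)%N -> if (i < j)%N && c i then (0%:E < H i o)%E /\ (H i o <= 1%:E)%E
                            else ((h i)%:E < H i o)%E)] =
  init_law (eta 0%N) * \prod_(i < n) (rc eta i *
    (if (i < j)%N && c i then 1 - expR (- rt eta i) else expR (- (rt eta i * h i)))).
Proof.
pose G j h : set T := [set o | (forall i, (i <= n)%N -> Y i o = eta i) /\
    (forall i, (i < n)%N -> if (i < j)%N && c i then (0%:E < H i o)%E /\ (H i o <= 1%:E)%E
                            else ((h i)%:E < H i o)%E)].
have mG j' h' : measurable (G j' h').
  apply: measurableI; first exact: measurable_path.
  apply: (@measurable_forall_lt n (fun i o => if (i < j')%N && c i
    then (0%:E < H i o)%E /\ (H i o <= 1%:E)%E else ((h' i)%:E < H i o)%E)) => i.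
  case: ((i < j')%N && c i); last exact: measurable_H_gt.
  exact: measurable_H_01.
elim: j h => [|j IH] h h0; first exact: (congr1 fine (law n eta h0)).
have [/andP[jn cj]|hj] := boolP ((j < n)%N && c j); last first.
  have e i : (i < n)%N -> (i < j.+1)%N && c i = (i < j)%N && c i.
    move=> iN; rewrite ltnS leq_eqVlt; have [ij|//] := eqVneq i j.
    by move: hj; rewrite -ij iN /= => /negPf ->; rewrite andbF.
  transitivity (pr P (G j h)).
    congr (pr P _); apply/seteqP; split => o [h1 h2]; split => // i iN; have := h2 i iN; by rewrite e.
  rewrite /G IH //; congr (_ * _); apply: eq_bigr => i _; by rewrite e.
pose hz v i := if i == j then v else h i.
have hz0 v : 0 <= v -> forall i, 0 <= hz v i by move=> v0 i; rewrite /hz; case: ifP.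
have eG v o i : (i < n)%N -> i != j ->
  (if (i < j)%N && c i then (0%:E < H i o)%E /\ (H i o <= 1%:E)%E else ((hz v i)%:E < H i o)%E) =
  (if (i < j.+1)%N && c i then (0%:E < H i o)%E /\ (H i o <= 1%:E)%E else ((h i)%:E < H i o)%E).
  by move=> iN ij; rewrite /hz (negPf ij) ltnS [in RHS]leq_eqVlt (negPf ij).
have -> : [set o | (forall i, (i <= n)%N -> Y i o = eta i) /\
    (forall i, (i < n)%N -> if (i < j.+1)%N && c i then (0%:E < H i o)%E /\ (H i o <= 1%:E)%E
                            else ((h i)%:E < H i o)%E)] = G j (hz 0) `\` G j (hz 1).
  apply/seteqP; split => o.
    move=> [h1 h2]; split.
      split => // i iN; have [->|ij] := eqVneq i j; last by rewrite eG //; exact: h2.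
      by rewrite ltnn /= /hz eqxx; have := h2 j jn; rewrite ltnSn cj /= => -[].
    move=> [_ /(_ j jn)]; rewrite ltnn /= /hz eqxx => hj.
    by have := h2 j jn; rewrite ltnSn cj /= => -[_]; rewrite leNgt hj.
  move=> [[h1 h2] h3]; split => // i iN; have [->|ij] := eqVneq i j; last first.
    by rewrite -(eG 0) //; exact: h2.
  rewrite ltnSn cj /=; split; first by have := h2 j jn; rewrite ltnn /= /hz eqxx.
  rewrite leNgt; apply/negP => h4; apply: h3; split => // k kn.
  have [->|kj] := eqVneq k j; first by rewrite ltnn /= /hz eqxx.
  by rewrite eG // -(eG 0) //; exact: h2.
have sub : G j (hz 1) `<=` G j (hz 0).
  move=> o [h1 h2]; split => // i iN; have := h2 i iN; have [->|ij] := eqVneq i j.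
    rewrite ltnn /= /hz eqxx; apply: lt_trans; by rewrite lte_fin.
  by rewrite !eG.
have -> : pr P (G j (hz 0) `\` G j (hz 1)) = pr P (G j (hz 0)) - pr P (G j (hz 1)).
  rewrite (pr_setID P (mG j (hz 0)) (mG j (hz 1))) (_ : _ `&` _ = G j (hz 1)).
    by rewrite addrAC subrr add0r.
  by rewrite setIC; apply/setIidPl.
have IH0 := IH (hz 0) (hz0 _ (lexx 0)); have IH1 := IH (hz 1) (hz0 _ ler01).
rewrite (IH0 : pr P (G j (hz 0)) = _) (IH1 : pr P (G j (hz 1)) = _) -mulrBr; congr (_ * _).
rewrite (bigD1 (Ordinal jn)) //= [X in _ - X](bigD1 (Ordinal jn)) //= [RHS](bigD1 (Ordinal jn)) //=.
rewrite ltnn ltnSn cj /= /hz eqxx mulr0 oppr0 expR0 !mulr1.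
have e v : \prod_(i < n | i != Ordinal jn) (rc eta i * (if (i < j)%N && c i then
      1 - expR (- rt eta i) else expR (- (rt eta i * (if (i : nat) == j then v else h i))))) =
   \prod_(i < n | i != Ordinal jn) (rc eta i * (if (i < j.+1)%N && c i then
      1 - expR (- rt eta i) else expR (- (rt eta i * h i)))).
  apply: eq_bigr => i; rewrite -val_eqE /= => ij.
  by rewrite (negPf ij) ltnS [in RHS]leq_eqVlt (negPf ij).
rewrite !e; ring.
Qed.

Definition upd (eta : nat -> config d) (n : nat) (e : config d) : nat -> config d :=
  fun i => if (i <= n)%N then eta i else e.

Definition valid n (eta : nat -> config d) := forall i, (i <= n)%N -> mass_le N (eta i).

Lemma valid_upd n eta e : valid n eta -> e \in succs (eta n) -> valid n.+1 (upd eta n e).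
Proof.
move=> v es i _; rewrite /upd; have [iN|_] := leqP i n; first exact: v.
exact: succs_mass (v n (leqnn n)) es.
Qed.

Lemma weight_upd n eta e : weight n.+1 (upd eta n e) =
  weight n eta * ring_chain p lambda (eta n) e.
Proof.
rewrite /weight big_ord_recr /= mulrA; congr (_ * _ * _).
  by apply: eq_bigr => i _; rewrite /rc /upd !ifT // ltnW.
by rewrite /rc /upd leqnn ltnn.
Qed.

(** That [Y n.+1] lies in [succs] holds only almost surely: the weights of the successors add up to
    that of the cylinder. *)
Lemma cyl_split n eta E : measurable E -> mass_le N (eta n) ->
  pr P (cyl n eta `&` E) = \sum_(e <- succs (eta n)) pr P (cyl n.+1 (upd eta n e) `&` E).
Proof.
move=> mE me.
pose U : set T := [set o | exists2 e, e \in succs (eta n) & cyl n.+1 (upd eta n e) o].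
have disj e e' : e != e' -> cyl n.+1 (upd eta n e) `&` cyl n.+1 (upd eta n e') = set0.
  move=> ee'; apply/seteqP; split => // o [[h _] [h' _]]; case/eqP: ee'.
  have := h n.+1 (leqnn _); have := h' n.+1 (leqnn _); rewrite /upd ltnn => -> //.
have [prU mU] : pr P U = \sum_(e <- succs (eta n)) pr P (cyl n.+1 (upd eta n e)) /\ measurable U.
  by apply: pr_bigU => //; [exact: succs_uniq|move=> e; exact: measurable_cyl].
have Usub : U `<=` cyl n eta.
  move=> o [e _ [h1 h2]]; split => i iN.
    by rewrite h1 ?leqW // /upd iN.
  by apply: h2; exact: ltnW.
have null : pr P (cyl n eta `\` U) = 0.
  have := pr_setID P (measurable_cyl n eta) mU.
  rewrite (_ : cyl n eta `&` U = U); last by rewrite setIC; apply/setIidPl.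
  rewrite prU; under eq_bigr => e _ do rewrite pr_cyl weight_upd.
  by rewrite -mulr_sumr (ring_chain_sum1 pJ lambda_gt0 me) mulr1 pr_cyl; lra.
have [prUE mUE] : pr P [set o | exists2 e, e \in succs (eta n) & (cyl n.+1 (upd eta n e) `&` E) o]
    = \sum_(e <- succs (eta n)) pr P (cyl n.+1 (upd eta n e) `&` E) /\
    measurable [set o | exists2 e, e \in succs (eta n) & (cyl n.+1 (upd eta n e) `&` E) o].
  apply: pr_bigU; first exact: succs_uniq.
    by move=> e; apply: measurableI => //; exact: measurable_cyl.
  by move=> e e' ee'; rewrite setIACA disj // set0I.
rewrite -prUE; have mC := measurable_cyl n eta.
have mCE : measurable (cyl n eta `&` E) by exact: measurableI.
rewrite (pr_setID P mCE mU).
have -> : pr P ((cyl n eta `&` E) `\` U) = 0.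
  apply/eqP; rewrite eq_le pr_ge0 andbT -null; apply: pr_le; try exact: measurableD.
  by move=> o [[? ?] ?].
rewrite addr0; congr (pr P _); apply/seteqP; split => o.
  by move=> [[_ Eo] [e es ce]]; exists e.
by move=> [e es [ce Eo]]; split; [split => //; apply: Usub|]; exists e.
Qed.

Definition inits : seq (config d) := undup [seq init j | j <- enum 'I_L].

Lemma init_law_sum (f : config d -> R) :
  \sum_(e <- inits) init_law e * f e = (\sum_j f (init j)) / L%:R.
Proof.
under eq_bigr => e _ do rewrite /init_law mulrAC mulr_suml.
rewrite -mulr_suml exchange_big /=; congr (_ / _); apply: eq_bigr => j _.
rewrite (bigD1_seq (init j)) ?undup_uniq //=; last first.
  by rewrite mem_undup; apply: map_f; rewrite mem_enum.
rewrite eqxx mul1r big1 ?addr0 // => e ej.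
by rewrite eq_sym (negPf ej) mul0r.
Qed.

Lemma inits_mass e : e \in inits -> mass_le N e.
Proof. by rewrite mem_undup => /mapP[j _ ->]; exact: init_mass. Qed.

Lemma init_split E : measurable E ->
  pr P E = \sum_(e <- inits) pr P (cyl 0 (fun=> e) `&` E).
Proof.
move=> mE; pose U : set T := [set o | exists2 e, e \in inits & cyl 0 (fun=> e) o].
have disj e e' : e != e' -> cyl 0 (fun=> e) `&` cyl 0 (fun=> e') = set0.
  move=> ee'; apply/seteqP; split => // o [[h _] [h' _]]; case/eqP: ee'.
  by have := h 0%N isT; have := h' 0%N isT => -> //.
have [prU mU] : pr P U = \sum_(e <- inits) pr P (cyl 0 (fun=> e)) /\ measurable U.
  by apply: pr_bigU => //; [exact: undup_uniq|move=> e; exact: measurable_cyl].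
have U1 : pr P U = 1.
  rewrite prU; under eq_bigr => e _ do rewrite pr_cyl /weight big_ord0.
  rewrite init_law_sum sumr_const card_ord mulfV // pnatr_eq0; lia.
have [prUE mUE] : pr P [set o | exists2 e, e \in inits & (cyl 0 (fun=> e) `&` E) o]
    = \sum_(e <- inits) pr P (cyl 0 (fun=> e) `&` E) /\
    measurable [set o | exists2 e, e \in inits & (cyl 0 (fun=> e) `&` E) o].
  apply: pr_bigU; first exact: undup_uniq.
    by move=> e; apply: measurableI => //; exact: measurable_cyl.
  by move=> e e' ee'; rewrite setIACA disj // set0I.
rewrite -prUE (pr_setID P mE mU).
have -> : pr P (E `\` U) = 0.
  apply/eqP; rewrite eq_le pr_ge0 andbT.
  have <- : pr P (~` U) = 0 by rewrite pr_setC // U1 subrr.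
  by apply: pr_le; [exact: measurableD|exact: measurableC|move=> o []].
rewrite addr0; congr (pr P _); apply/seteqP; split => o.
  by move=> [Eo [e es ce]]; exists e.
by move=> [e es [ce Eo]]; split => //; exists e.
Qed.

Lemma pr_le_cyl n E b : measurable E ->
  (forall eta, valid n eta -> pr P (cyl n eta `&` E) <= weight n eta * b) ->
  pr P E <= b.
Proof.
move=> mE h.
have step k : (k <= n)%N -> forall eta, valid (n - k) eta ->
    pr P (cyl (n - k) eta `&` E) <= weight (n - k) eta * b.
  elim: k => [|k IH] kn eta v; first by rewrite subn0 in v *; exact: h.
  rewrite cyl_split //; last exact: v.
  have e1 : (n - k.+1).+1 = (n - k)%N by lia.
  apply: (@le_trans _ _ (\sum_(e <- succs (eta (n - k.+1)%N))
     weight (n - k) (upd eta (n - k.+1) e) * b)).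
    rewrite big_seq [leRHS]big_seq; apply: ler_sum => e es; rewrite e1.
    by apply: IH; [exact: ltnW|rewrite -e1; exact: valid_upd].
  rewrite -e1; under eq_bigr => e _ do rewrite weight_upd.
  by rewrite -mulr_suml -mulr_sumr (ring_chain_sum1 pJ lambda_gt0 (v _ (leqnn _))) mulr1.
rewrite init_split //.
apply: (@le_trans _ _ (\sum_(e <- inits) weight 0 (fun=> e) * b)).
  rewrite big_seq [leRHS]big_seq; apply: ler_sum => e es.
  have := step n (leqnn n) (fun=> e); rewrite subnn; apply=> i _; exact: inits_mass.
rewrite -mulr_suml; under eq_bigr => e _ do rewrite /weight big_ord0.
rewrite init_law_sum sumr_const card_ord mulfV ?mul1r // pnatr_eq0; lia.
Qed.

Lemma H_gt0_ae : pr P [set o | exists i, ~ (0%:E < H i o)%E] = 0.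
Proof.
rewrite (_ : [set _ | _] = \bigcup_i [set o | ~ (0%:E < H i o)%E]); last first.
  by apply/seteqP; split => [ o [i ?]|o [i _ ?]]; exists i.
have m i : measurable [set o | ~ (0%:E < H i o)%E].
  by apply: measurableC; exact: measurable_H_gt.
apply: pr_bigcup0 => // i; apply/eqP; rewrite eq_le pr_ge0 andbT.
apply: (@pr_le_cyl i.+1) => // eta _; rewrite (_ : _ `&` _ = set0) ?pr_set0 ?mulr0 //.
by apply/seteqP; split => // o [[_ /(_ i (leqnn _)) h] h'].
Qed.

(** No explosion: with at most [N] particles the total rate is bounded, so each waiting time exceeds
    one with a conditional probability bounded below, and infinitely many do. *)
Lemma H_large_ae : pr P [set o | exists k, forall i, (k <= i)%N -> (0%:E < H i o)%E /\ (H i o <= 1%:E)%E] = 0.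
Proof.
pose B k m : set T := [set o | forall i, (i < k + m)%N -> (k <= i)%N -> (0%:E < H i o)%E /\ (H i o <= 1%:E)%E].
have mB k m : measurable (B k m).
  apply: (@measurable_forall_lt (k + m) (fun i o => (k <= i)%N -> (0%:E < H i o)%E /\ (H i o <= 1%:E)%E)) => i.
  case: (leqP k i) => ki; last first.
    by rewrite (_ : (fun _ => _) = setT) //; apply/seteqP; split.
  rewrite (_ : (fun _ => _) = [set o | (0%:E < H i o)%E /\ (H i o <= 1%:E)%E]).
    exact: measurable_H_01.
  by apply/seteqP; split => o //=; exact.
rewrite (_ : [set _ | _] = \bigcup_k \bigcap_m B k m); last first.
  apply/seteqP; split => o => [[k h]|[k _ h]]; exists k => //.
    by move=> m _ i _; exact: h.
  by move=> i ki; apply: (h i.+1 I i) => //; rewrite addnS ltnS leq_addl.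
apply: pr_bigcup0 => k; first exact: bigcapT_measurable.
pose r : R := 1 - expR (- ((1 + lambda) * N%:R)).
have l1 : 0 <= 1 + lambda by rewrite addr_ge0 // ltW.
have r0 : 0 <= r by rewrite subr_ge0 -[leRHS]expR0 ler_expR oppr_le0 mulr_ge0.
have r1 : r < 1 by rewrite ltrBlDr ltrDl expR_gt0.
have hB m : pr P (B k m) <= r ^+ m.
  apply: (@pr_le_cyl (k + m)) => // eta v.
  have -> : cyl (k + m) eta `&` B k m = [set o | (forall i, (i <= k + m)%N -> Y i o = eta i) /\
    (forall i, (i < k + m)%N -> if (i < k + m)%N && (k <= i)%N then (0%:E < H i o)%E /\ (H i o <= 1%:E)%E
                            else (0%:E < H i o)%E)].
    apply/seteqP; split => o => [[[h1 h2] h3]|[h1 h2]].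
      split => // i iN; rewrite iN /=; case: ifP => ki; [exact: h3|exact: h2].
    split; first split => // i iN.
      by have := h2 i iN; rewrite iN /=; case: ifP => // _ [].
    by move=> i iN ki; have := h2 i iN; rewrite iN ki.
  rewrite (@pr_path_le1 (fun i => k <= i)%N (k + m) (k + m) eta (fun=> 0)) //.
  rewrite big_split /= mulrA -/(weight _ _); apply: ler_wpM2l.
    by rewrite -pr_cyl pr_ge0.
  rewrite big_split_ord /= big1 ?mul1r; last first.
    by move=> i _; rewrite [(k <= _)%N]leqNgt ltn_ord andbF mulr0 oppr0 expR0.
  rewrite -[m in r ^+ m]card_ord -prodr_const; apply: ler_prod => i _.
  rewrite ltn_add2l ltn_ord leq_addr /= subr_ge0 -[X in _ <= X]expR0 !ler_expR.
  have vi : mass_le N (eta (k + i)%N) by apply: v; rewrite leq_add2l ltnW.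
  rewrite oppr_le0 /rt; apply/andP; split; first exact: (total_rate_ge0 lambda_gt0 vi).
  by rewrite lerD2l lerN2 ler_expR lerN2; exact: (total_rate_le lambda_gt0 vi).
apply/eqP; rewrite eq_le pr_ge0 andbT.
have c : r ^+ m @[m --> \oo] --> (0 : R).
  by apply: cvg_expr; rewrite ger0_norm.
rewrite -(cvg_lim _ c) //; apply: limr_ge; first exact: cvgP c.
apply: nearW => m; apply: le_trans (hB m); apply: pr_le => //.
  exact: bigcapT_measurable.
by move=> o; apply.
Qed.


Definition history (o : T) : nat -> config d := fun i => Y i o.

(** Falling asleep counts as well, so [drops] is at least the number of jumps from [y]; unlike the
    latter it can be read off the trajectory. *)
Definition drops (y : site) (k : nat) (eta : nat -> config d) : nat :=
  (\sum_(i < k) (active (eta i.+1 y) < active (eta i y)))%N.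

Lemma drops_upd y k eta e : drops y k.+1 (upd eta k e) =
  (drops y k eta + (active (e y) < active (eta k y)))%N.
Proof.
rewrite /drops big_ord_recr /=; congr (_ + _)%N.
  by apply: eq_bigr => i _; rewrite /upd !ifT // ltnW.
by rewrite /upd leqnn ltnn.
Qed.

Lemma drops_eq y k eta eta' : (forall i, (i <= k)%N -> eta i = eta' i) ->
  drops y k eta = drops y k eta'.
Proof. by move=> h; apply: eq_bigr => i _; rewrite !h // ltnW. Qed.

Lemma discrete_drops y k : discrete_rv (fun o => drops y k (history o)).
Proof.
elim: k => [|k IH].
  rewrite (_ : (fun _ => _) = (fun=> 0%N)); first exact: discrete_rv_cst.
  by apply/funext => o; rewrite /drops big_ord0.
rewrite (_ : (fun _ => _) = (fun x : nat * (nat * nat) => (x.1 + (x.2.1 < x.2.2))%N) \o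
  (fun o => (drops y k (history o), (active (Y k.+1 o y), active (Y k o y))))).
  apply: discrete_rv_comp; apply: discrete_rv_pair => //.
  by apply: discrete_rv_pair; exact: discrete_active.
by apply/funext => o; rewrite /drops big_ord_recr.
Qed.

Section Hit.
Variables (G : nat -> (nat -> config d) -> Prop) (Psi : nat -> (nat -> config d) -> R).
Hypothesis G_eq : forall k eta eta', (forall i, (i <= k)%N -> eta i = eta' i) ->
  G k eta -> G k eta'.
Hypothesis mG : forall k, measurable [set o | G k (history o)].
Hypothesis Psi_ge0 : forall k eta, valid k eta -> 0 <= Psi k eta.
Hypothesis Psi_ge1 : forall k eta, valid k eta -> G k eta -> 1 <= Psi k eta.
Hypothesis Psi_sup : forall k eta, valid k eta ->
  chain_mean p lambda (fun e => Psi k.+1 (upd eta k e)) (eta k) <= Psi k eta.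

Lemma weight_ge0 k eta : 0 <= weight k eta.
Proof. by rewrite -pr_cyl pr_ge0. Qed.

Let E n m : set T := [set o | exists k, [/\ (n <= k)%N, (k <= n + m)%N & G k (history o)]].

Let mE n m : measurable (E n m).
Proof.
rewrite (_ : E n m = \bigcup_k (if (n <= k)%N && (k <= n + m)%N then
    [set o | G k (history o)] else set0)).
  by apply: bigcupT_measurable => k; case: ifP.
apply/seteqP; split => o => [[k [h1 h2 h3]]|[k _]]; first by exists k; rewrite ?h1 ?h2.
by case: ifP => // /andP[h1 h2] h3; exists k.
Qed.

Lemma pr_cyl_hit m n eta : valid n eta ->
  pr P (cyl n eta `&` E n m) <= weight n eta * Psi n eta.
Proof.
elim: m n eta => [|m IH] n eta v; have mC := measurable_cyl n eta;
  have [Gn|nG] := pselect (G n eta).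
- apply: (@le_trans _ _ (weight n eta)).
    by rewrite -pr_cyl; apply: pr_le => [||o []] //; exact: measurableI.
  by rewrite -[leLHS]mulr1; apply: ler_wpM2l; [exact: weight_ge0|exact: Psi_ge1].
- have -> : cyl n eta `&` E n 0 = set0.
    apply/seteqP; split => // o [[h1 h2] [k [nk kn Gk]]].
    have e : k = n by lia.
    by apply: nG; rewrite -e; apply: (G_eq _ Gk) => i ik; apply: h1; rewrite -e.
  by rewrite pr_set0; apply: mulr_ge0; [exact: weight_ge0|exact: Psi_ge0].
- apply: (@le_trans _ _ (weight n eta)).
    by rewrite -pr_cyl; apply: pr_le => [||o []] //; exact: measurableI.
  by rewrite -[leLHS]mulr1; apply: ler_wpM2l; [exact: weight_ge0|exact: Psi_ge1].
apply: (@le_trans _ _ (pr P (cyl n eta `&` E n.+1 m))).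
  apply: pr_le; [exact: measurableI|exact: measurableI|].
  move=> o [ho [k [nk km Gk]]]; split => //; exists k; split => //; last by rewrite addSnnS.
  rewrite ltn_neqAle nk andbT; apply/eqP => nk'; apply: nG; case: ho => h1 _.
  by rewrite nk'; apply: (G_eq _ Gk) => i ik; apply: h1; rewrite nk'.
rewrite cyl_split //; last exact: v.
apply: (@le_trans _ _ (\sum_(e <- succs (eta n)) weight n eta *
   (ring_chain p lambda (eta n) e * Psi n.+1 (upd eta n e)))).
  rewrite big_seq [leRHS]big_seq; apply: ler_sum => e es.
  by rewrite mulrA -weight_upd; apply: IH; exact: valid_upd.
rewrite -mulr_sumr; apply: ler_wpM2l; first exact: weight_ge0.
rewrite (ring_chain_mean p _ _ (v _ (leqnn _))); exact: Psi_sup.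
Qed.

(** Maximal inequality for the nonnegative supermartingale [Psi], which is at least one on [G]; an
    induction on the horizon replaces stopping times. *)
Lemma pr_hit_le :
  pr P [set o | exists k, G k (history o)] <= (\sum_j Psi 0%N (fun=> init j)) / L%:R.
Proof.
rewrite (_ : [set _ | _] = \bigcup_m E 0 m); last first.
  apply/seteqP; split => o => [[k Gk]|[m _ [k [_ _ Gk]]]]; last by exists k.
  by exists k => //; exists k.
apply: pr_bigcup_le => // [n m nm o [k [k0 kn Gk]]|m].
  by exists k; split => //; exact: leq_trans kn _.
rewrite init_split // -(init_law_sum (fun e => Psi 0%N (fun=> e))) big_seq [leRHS]big_seq; apply: ler_sum => e es.
have := @pr_cyl_hit m 0 (fun=> e) _; rewrite /weight big_ord0 mulr1; apply=> i _.
exact: inits_mass.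
Qed.

End Hit.

Lemma measurable_stable (W : seq site) k :
  measurable [set o | stable W (history o k)].
Proof.
have h := discrete_rv_map W (discrete_active k).
have := discrete_rv_pred (fun l => all (fun a => a == 0%N) l) h.
rewrite (_ : [set _ | _] = [set o | stable W (history o k)]) //.
by apply/seteqP; split => o /=; rewrite all_map.
Qed.

(* Least action principle: the topplings of the chain, once they have stabilized
   [W], include those of the stabilization of [W]. *)
Lemma pr_stable_few_drops (W : seq site) (x : site) (K : nat) :
  pr P [set o | exists k, stable W (history o k) /\ (drops x k (history o) < K)%N] <=
  1 - (\sum_j reach_prob p lambda W x K (init j, 0%N)) / L%:R.
Proof.
set A := pr _ _.
pose SV n := stopval p x (real_sleep lambda) W (reached (d := d) R K) n.
have rsl0 := real_sleep_ge0 (d := d) lambda_gt0.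
have rsl1 := real_sleep_le (d := d) lambda.
have s01 := sleep_prob_lt1 lambda_gt0.
have SV1 n S : SV n S <= 1.
  apply: (stopval_le_sup pJ rsl0 s01 rsl1 (Xi := fun=> 1) (reached_le1 R K)) => y S' _ _.
  by rewrite topple_cst.
have SVm n S S' : leS W S S' -> SV n S <= SV n S'.
  move=> h; apply: (stopval_mono (g := fun m => (K <= m)%N%:R) pJ x rsl0 s01 rsl1 n _ h).
  move=> a b ab; rewrite ler_nat; case: (leqP K a) => // Ka.
  by rewrite (leq_trans Ka ab).
have hn n : A <= 1 - (\sum_j SV n (init j, 0%N)) / L%:R.
  have -> : 1 - (\sum_j SV n (init j, 0%N)) / L%:R = (\sum_j (1 - SV n (init j, 0%N))) / L%:R.
    rewrite sumrB sumr_const card_ord mulrBl mulfV // pnatr_eq0; lia.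
  pose Psi k eta := 1 - SV n (eta k, drops x k eta).
  have -> : \sum_j (1 - SV n (init j, 0%N)) = \sum_j Psi 0%N (fun=> init j).
    by apply: eq_bigr => j _; rewrite /Psi /drops big_ord0.
  apply: (@pr_hit_le (fun k eta => stable W (eta k) /\ (drops x k eta < K)%N) Psi)
    => [k eta eta' h [h1 h2]|k|k eta _|k eta _ [st cK]|k eta v].
  - by rewrite -(drops_eq _ h) -(h k (leqnn _)).
  - apply: measurableI; first exact: measurable_stable.
    exact: (discrete_rv_pred (fun c => (c < K)%N) (discrete_drops x k)).
  - by rewrite subr_ge0.
  - rewrite /Psi /SV stopval_stable; last exact: (elimT (stableP W (eta k, _))).
    by rewrite /reached /= leqNgt cK subr0.
  have me := v k (leqnn k).
  apply: (chain_mean_le_cst lambda_gt0 me).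
    by rewrite /Psi drops_upd ltnn addn0 /upd ltnn.
  move=> z az; set S : state d := (eta k, drops x k eta).
  have SVT : SV n S <= topple p x (real_sleep lambda) z (SV n) S.
    have [zW|zW] := boolP (z \in W).
      apply: (stopval_le_topple pJ rsl0 s01 rsl1) => // y S' yW ly.
      exact: (reached_sub pJ lambda_gt0 x K yW ly).
    (* The chain also topples outside of [W]; this can only add particles to [W], which does not
       lower [SV n]. *)
    rewrite -[leLHS](topple_cst pJ x (real_sleep lambda) z _ S).
    apply: (topple_le pJ rsl0 s01 rsl1) => [_|s _]; apply: SVm; split => //=.
    + by move=> u uW; rewrite sleep_atE; case: eqVneq uW zW => // -> ->.
    + move=> u uW; rewrite moveE; case: eqVneq uW zW => [-> ->//|_ _ _].
      by case: ifP => // _; exact: rank_add_one.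
    + exact: leq_addr.
  apply: (@le_trans _ _ (topple p x (real_sleep lambda) z (fun S' => 1 + (- 1) * SV n S') S));
    last by rewrite topple_lin // mulN1r lerD2l lerN2.
  rewrite /ring_mean /topple /real_sleep (one_sub_sleep_prob lambda_gt0) /Psi.
  have l0 := ltW lambda_gt0; have l1 : 0 <= (1 + lambda)^-1 by rewrite invr_ge0 addr_ge0.
  have p_ge0 s : 0 <= p s by case: pJ.
  apply: lerD.
    apply: ler_wpM2l; first exact: mulr_ge0.
    rewrite mulN1r lerD2l lerN2; apply: SVm; split.
      by move=> u uW /=; rewrite /upd ltnn.
    by rewrite drops_upd /= leq_addr.
  rewrite mulr_sumr; apply: ler_sum => s _; rewrite mulrA [_^-1 * _]mulrC.
  apply: ler_wpM2l; first exact: mulr_ge0.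
  rewrite mulN1r lerD2l lerN2; apply: SVm; split.
    by move=> u uW /=; rewrite /upd ltnn.
  rewrite drops_upd /= leq_add2l; case: eqP => // zx.
  rewrite -zx moveE eqxx; move: az; case: (eta k z) => // -[|m] //= _.
  by rewrite ltnSn.
have c : 1 - (\sum_j SV n (init j, 0%N)) / L%:R @[n --> \oo] -->
    1 - (\sum_j reach_prob p lambda W x K (init j, 0%N)) / L%:R.
  apply: cvgB; first exact: cvg_cst.
  apply: cvgMl; apply: (@cvg_big _ _ +%R) => [|j _]; [exact: add_continuous|]; exact: (reach_prob_cvg pJ lambda_gt0).
rewrite -(cvg_lim _ c) //; apply: limr_ge; first exact: cvgP c.
exact: nearW.
Qed.

Lemma ring_mean_ge (f : config d -> R) z s eta : s \in steps -> (forall e, 0 <= f e) ->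
  p s / (1 + lambda) * f (move z (z + s) eta) <= ring_mean p lambda f z eta.
Proof.
move=> hs f0; have l0 := ltW lambda_gt0; have l1 : 0 <= 1 + lambda by rewrite addr_ge0.
have p_ge0 t : 0 <= p t by case: pJ.
rewrite /ring_mean -[leLHS]add0r; apply: lerD.
  by rewrite mulr_ge0 ?divr_ge0.
rewrite (big_rem s hs) /= lerDl; apply: sumr_ge0 => t _.
by rewrite mulr_ge0 ?divr_ge0.
Qed.

Lemma ring_mean_le_sub (f g : config d -> R) c z eta : (forall e, f e <= c - c * g e) ->
  ring_mean p lambda f z eta <= c - c * ring_mean p lambda g z eta.
Proof.
move=> h; apply: le_trans (ring_mean_le pJ lambda_gt0 (g := fun e => c - c * g e) _ _) _ => //.
rewrite -[X in _ <= X - _](ring_mean_cst pJ lambda_gt0 c z eta) /ring_mean.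
rewrite [X in _ <= _ - X]mulrDr mulr_sumr opprD addrACA -sumrB lerD //; first by lra.
by apply: ler_sum => s _; lra.
Qed.

Section Strikes.
Variables (y s : site) (K : nat).
Hypothesis hs : s \in steps.
Let x := y + s.

Definition strike (m : nat) (e e' : config d) : bool :=
  [&& (K <= m)%N, (active (e' y) < active (e y))%N & (0 < active (e' x))%N].

Definition strikes (k : nat) (eta : nat -> config d) : nat :=
  (\sum_(i < k) strike (drops y i eta) (eta i) (eta i.+1))%N.

Lemma strikes_upd k eta e : strikes k.+1 (upd eta k e) =
  (strikes k eta + strike (drops y k eta) (eta k) e)%N.
Proof.
rewrite /strikes big_ord_recr /=; congr (_ + _)%N; last first.
  rewrite {2 3}/upd leqnn ltnn (@drops_eq _ _ _ eta) // => i ik.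
  by rewrite /upd ik.
apply: eq_bigr => i _; have ik := ltn_ord i; rewrite {2 3}/upd ik (ltnW ik).
rewrite (@drops_eq _ _ _ eta) // => j ji.
by rewrite /upd (leq_trans ji (ltnW ik)).
Qed.

Lemma strikes_eq k eta eta' : (forall i, (i <= k)%N -> eta i = eta' i) ->
  strikes k eta = strikes k eta'.
Proof.
move=> h; apply: eq_bigr => i _; rewrite !h // 1?ltnW // (@drops_eq _ _ _ eta') // => j ji.
by apply: h; apply: leq_trans ji (ltnW _).
Qed.

Lemma discrete_strikes k : discrete_rv (fun o => strikes k (history o)).
Proof.
elim: k => [|k IH].
  rewrite (_ : (fun _ => _) = (fun=> 0%N)); first exact: discrete_rv_cst.
  by apply/funext => o; rewrite /strikes big_ord0.
pose F (a : nat * (nat * (nat * (nat * nat)))) : nat :=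
  (a.1 + [&& (K <= a.2.1)%N, (a.2.2.1 < a.2.2.2.1)%N & (0 < a.2.2.2.2)%N])%N.
rewrite (_ : (fun _ => _) = F \o (fun o => (strikes k (history o), (drops y k (history o),
   (active (Y k.+1 o y), (active (Y k o y), active (Y k.+1 o x))))))).
  apply: discrete_rv_comp; apply: discrete_rv_pair => //.
  apply: discrete_rv_pair; first exact: discrete_drops.
  by do 2 (apply: discrete_rv_pair; first exact: discrete_active); exact: discrete_active.
by apply/funext => o; rewrite /strikes big_ord_recr.
Qed.

(* At each decrease at [y], a particle is sent to [y + s] with conditional
   probability at least [p s / (1 + lambda)]. *)
Lemma pr_no_strike n :
  pr P [set o | exists k, strikes k (history o) = 0%N /\ (K + n <= drops y k (history o))%N]
    <= (1 - p s / (1 + lambda)) ^+ n.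
Proof.
have l0 := ltW lambda_gt0; have l1 : 0 < 1 + lambda by rewrite ltr_wpDl.
have p_ge0 t : 0 <= p t by case: pJ.
set rho := 1 - _; set kappa := p s / _ in rho *.
have kappa0 : 0 <= kappa by rewrite divr_ge0 // ltW.
have kappa1 : kappa <= 1.
  rewrite ler_pdivrMr // mul1r; apply: (@le_trans _ _ 1); last by rewrite lerDl.
  by rewrite -(jump_sum1 pJ) (big_rem s hs) /= lerDl sumr_ge0.
have rho0 : 0 <= rho by rewrite subr_ge0.
have rho1 : rho <= 1 by rewrite gerBl.
(* The exponent is the number of decreases still to come before there are [K + n], but stays [n]
   during the first [K], when strikes are not recorded. *)
pose phi m : R := rho ^+ (n - (m - K)).
pose Psi k eta : R := if strikes k eta == 0%N then phi (drops y k eta) else 0.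
have phi0 m : 0 <= phi m by rewrite exprn_ge0.
have phi1 m : phi m <= 1 by rewrite exprn_ile1.
have Psi0 k eta : 0 <= Psi k eta by rewrite /Psi; case: ifP.
have -> : rho ^+ n = (\sum_j Psi 0%N (fun=> init j)) / L%:R.
  rewrite (eq_bigr (fun=> rho ^+ n)); last first.
    by move=> j _; rewrite /Psi /strikes /phi /drops !big_ord0 subn0.
  by rewrite sumr_const card_ord -[X in X / _]mulr_natr mulfK // pnatr_eq0 -lt0n.
apply: (@pr_hit_le (fun k eta => strikes k eta = 0%N /\ (K + n <= drops y k eta)%N) Psi)
  => [k eta eta' h [h1 h2]|k|//|k eta _ [st Kn]|k eta v].
- by rewrite -(drops_eq _ h) -(strikes_eq h).
- apply: measurableI.
    exact: (discrete_rv_pred (fun c => c = 0%N) (discrete_strikes k)).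
  exact: (discrete_rv_pred (fun c => (K + n <= c)%N) (discrete_drops y k)).
- rewrite /Psi st eqxx /phi (_ : (n - _ = 0)%N) ?expr0 //; lia.
have me := v k (leqnn k); set D := drops y k eta; pose h e := Psi k.+1 (upd eta k e).
have hE e : h e = if (strikes k eta == 0%N) && ~~ strike D (eta k) e
    then phi (D + (active (e y) < active (eta k y)))%N else 0.
  by rewrite /h /Psi strikes_upd drops_upd addn_eq0 eqb0.
rewrite -/h; have [st|st] := eqVneq (strikes k eta) 0%N; last first.
  rewrite (_ : h = fun=> 0); last by apply/funext => e; rewrite hE (negPf st).
  by rewrite (chain_mean_cst pJ lambda_gt0 _ me).
have PsiE : Psi k eta = phi D by rewrite /Psi st eqxx.
rewrite PsiE; apply: (chain_mean_le_cst lambda_gt0 me).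
  by rewrite hE st /strike ltnn andbF addn0.
have hle e : h e <= phi (D + (active (e y) < active (eta k y)))%N.
  by rewrite hE; case: ifP.
move=> z az; have [zy|zy] := eqVneq z y; last first.
  rewrite -(ring_mean_cst pJ lambda_gt0 (phi D) z (eta k)).
  apply: (ring_mean_le pJ lambda_gt0) => [|t _]; apply: le_trans (hle _) _.
    by rewrite sleep_atE eq_sym (negPf zy) ltnn addn0.
  rewrite moveE eq_sym (negPf zy); case: ifP => _; last by rewrite ltnn addn0.
  rewrite ltnNge (_ : (_ <= _)%N) ?addn0 //.
  by case: (eta k y) => //= m; exact: leqnSn.
rewrite zy in az *; have [DK|KD] := ltnP D K.
  rewrite -(ring_mean_cst pJ lambda_gt0 (phi D) y (eta k)).
  have h' e : h e <= phi D.
    apply: le_trans (hle _) _; rewrite /phi (_ : (D + _ - K)%N = (D - K)%N) //.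
    by case: (_ < _)%N; lia.
  by apply: (ring_mean_le pJ lambda_gt0).
pose m := (n - (D - K))%N; pose g e : R := ((active (e y) < active (eta k y)) && (0 < active (e x)))%N%:R.
have h' e : h e <= rho ^+ m.-1 - rho ^+ m.-1 * g e.
  rewrite hE st eqxx /strike KD /= /g; case: andP => [_|_] /=; first by rewrite mulr1 subrr.
  rewrite mulr0 subr0 /phi; case: (_ < _)%N.
    by rewrite (_ : (n - (D + true - K))%N = m.-1) // /m; lia.
  by rewrite addn0 -/m; apply: ler_wiXn2l => //; lia.
case em : m => [|m'].
  rewrite /phi -/m em expr0 -(ring_mean_cst pJ lambda_gt0 1 y (eta k)).
  by apply: (ring_mean_le pJ lambda_gt0) => *; apply: le_trans (hle _) _.
apply: le_trans (ring_mean_le_sub _ _ h') _.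
rewrite /phi -/m em /= exprS /rho mulrBl mul1r lerD2l lerN2 mulrC.
apply: ler_wpM2l; first exact: exprn_ge0.
apply: le_trans (ring_mean_ge y (eta k) hs (f := g) _) => [|e]; last exact: ler0n.
rewrite /g !moveE !eqxx -/x (_ : x == y = false); last first.
  by rewrite /x -subr_eq0 addrAC subrr add0r (negPf (unit_steps_neq0 hs)).
rewrite (_ : (_ && _)%N = true) ?mulr1 //; apply/andP; split.
  by case: (eta k y) az => // -[|a] //= _; exact: ltnSn.
by case: (eta k x).
Qed.

End Strikes.

Section Occupation.
Variables (y : site) (K : nat).

Definition early (k : nat) (eta : nat -> config d) : bool :=
  (0 < active (eta k y))%N && (drops y k eta < K)%N.

Lemma early_eq k eta eta' : (forall i, (i <= k)%N -> eta i = eta' i) ->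
  early k eta = early k eta'.
Proof. by move=> h; rewrite /early (drops_eq _ h) h. Qed.

(** As the law describes only the events [h < H i], time is measured by counting the multiples of
    [eps] below [H i]: without a cutoff, [eps] times their number exceeds [H i] by at most [eps]. *)
Definition tick (eps : R) (i m : nat) : set T :=
  [set o | early i (history o) /\ ((m%:R * eps)%:E < H i o)%E].

Lemma measurable_tick eps i m : measurable (tick eps i m).
Proof.
apply: measurableI; last exact: measurable_H_gt.
exact: (discrete_rv_pred (fun a : nat * nat => (0 < a.1)%N && (a.2 < K)%N)
  (discrete_rv_pair (discrete_active i y) (discrete_drops y i))).
Qed.

Lemma sum_geometric_le (r eps : R) M : 0 < r -> 0 < eps ->
  \sum_(m < M) eps * expR (- (r * (m%:R * eps))) <= r^-1 + eps.
Proof.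
move=> r0 e0; set q := expR (- (r * eps)).
have q0 : 0 < q by exact: expR_gt0.
have re : 0 < r * eps by exact: mulr_gt0.
have hq : q * (1 + r * eps) <= 1.
  apply: (@le_trans _ _ (q * expR (r * eps))); last by rewrite -expRD addNr expR0.
  by rewrite ler_pM2l // expR_ge1Dx.
have q1 : q < 1 by rewrite /q -[ltRHS]expR0 ltr_expR oppr_lt0.
rewrite (eq_bigr (fun m : 'I_M => eps * q ^+ m)); last first.
  move=> m _; rewrite /q -expRM_natl; congr (_ * expR _); ring.
rewrite -mulr_sumr.
have hS : (\sum_(m < M) q ^+ m) * (1 - q) <= 1.
  rewrite (_ : _ * _ = 1 - q ^+ M) ?gerBl ?exprn_ge0 ?(ltW q0) //.
  by rewrite -[RHS]opprB subrX1; ring.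
have S0 : 0 <= \sum_(m < M) q ^+ m by apply: sumr_ge0 => m _; rewrite exprn_ge0 // ltW.
set S := \sum_(m < M) _ in hS S0 *.
have h1 : r * eps <= (1 - q) * (1 + r * eps) by nra.
have h2 : S * (r * eps) <= 1 + r * eps.
  apply: (@le_trans _ _ (S * ((1 - q) * (1 + r * eps)))); first exact: ler_wpM2l.
  by rewrite mulrA -[leRHS]mul1r ler_pM2r // addr_gt0.
rewrite -(ler_pM2l r0) mulrDr mulfV ?gt_eqF //.
by rewrite (_ : r * (eps * S) = S * (r * eps)) //; ring.
Qed.

(** An early period under total rate [r] has mean length [1 / r], and by [chain_mean_drop] it ends
    with a decrease at [y] with probability at least [1 / r]. The decreases still allowed thus pay
    for the early time, up to an error [eps] per period. *)
Lemma pr_cyl_ticks (eps : R) M n k eta : 0 < eps -> valid k eta ->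
  \sum_(i < n) \sum_(m < M) eps * pr P (cyl k eta `&` tick eps (k + i) m) <=
    weight k eta * ((K - drops y k eta)%:R + n%:R * eps).
Proof.
move=> e0; elim: n k eta => [|n IH] k eta v.
  by rewrite big_ord0 mul0r addr0 mulr_ge0 ?weight_ge0.
have me := v k (leqnn k).
have chain1 := ring_chain_sum1 pJ lambda_gt0 me.
pose D e := (active (e y) < active (eta k y))%N.
pose rs := \sum_(e <- succs (eta k)) ring_chain p lambda (eta k) e * (D e)%:R.
have rs0 : 0 <= rs.
  apply: sumr_ge0 => e _; rewrite mulr_ge0 //; exact: (ring_chain_ge0 pJ lambda_gt0 e me).
have w0 := weight_ge0 k eta.
rewrite big_ord_recl addn0.
have rest : \sum_(i < n) \sum_(m < M) eps * pr P (cyl k eta `&` tick eps (k + lift ord0 i) m)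
    <= weight k eta * \sum_(e <- succs (eta k)) ring_chain p lambda (eta k) e *
         ((K - (drops y k eta + D e))%:R + n%:R * eps).
  rewrite (eq_bigr (fun i : 'I_n => \sum_(e <- succs (eta k)) \sum_(m < M)
      eps * pr P (cyl k.+1 (upd eta k e) `&` tick eps (k.+1 + i) m))); last first.
    move=> i _; rewrite exchange_big /=; apply: eq_bigr => m _.
    rewrite (_ : (k + lift ord0 i)%N = (k.+1 + i)%N); last by rewrite lift0 addnS.
    by rewrite (cyl_split (measurable_tick eps _ m) me) mulr_sumr.
  rewrite exchange_big /= mulr_sumr big_seq [leRHS]big_seq; apply: ler_sum => e es.
  apply: le_trans (IH _ _ (valid_upd v es)) _.
  by rewrite weight_upd drops_upd mulrA.
have [ek|nek] := boolP (early k eta); last first.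
  rewrite big1 ?add0r => [|m _]; last first.
    rewrite (_ : cyl k eta `&` _ = set0) ?pr_set0 ?mulr0 //.
    apply/seteqP; split => // o [[h _] [h' _]]; case/negP: nek.
    by rewrite -(early_eq h).
  apply: le_trans rest _; apply: ler_wpM2l => //.
  apply: (@le_trans _ _ (\sum_(e <- succs (eta k)) ring_chain p lambda (eta k) e *
         ((K - drops y k eta)%:R + n.+1%:R * eps))); last by rewrite -mulr_suml chain1 mul1r.
  apply: ler_sum => e _; apply: ler_wpM2l; first exact: (ring_chain_ge0 pJ lambda_gt0 e me).
  apply: lerD; first by rewrite ler_nat; lia.
  by rewrite ler_pM2r // ler_nat.
have /andP[ay dK] := ek; set r := total_rate lambda (eta k).
have hdrop : r^-1 <= rs.
  rewrite /rs (ring_chain_mean p lambda (fun e => (D e)%:R) me).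
  exact: (chain_mean_drop pJ lambda_gt0 me ay).
have r0 : 0 < r.
  apply: lt_le_trans (rate_le_total lambda_gt0 y me).
  by rewrite /ring_rate mulr_gt0 ?ltr0n // addr_gt0.
have first : \sum_(m < M) eps * pr P (cyl k eta `&` tick eps k m)
    <= weight k eta * (r^-1 + eps).
  rewrite (eq_bigr (fun m : 'I_M => weight k eta * (eps * expR (- (r * (m%:R * eps)))))).
    by rewrite -mulr_sumr; apply: ler_wpM2l => //; exact: sum_geometric_le.
  move=> m _; rewrite mulrCA; congr (_ * _).
  have me0 : 0 <= m%:R * eps by rewrite mulr_ge0 // ltW.
  rewrite (cyl_split (measurable_tick eps _ m) me).
  rewrite (eq_bigr (fun e => weight k eta * expR (- (r * (m%:R * eps))) *
     ring_chain p lambda (eta k) e)) -?mulr_sumr ?chain1 ?mulr1 // => e _.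
  rewrite mulrAC -weight_upd.
  have -> : cyl k.+1 (upd eta k e) `&` tick eps k m =
      cyl k.+1 (upd eta k e) `&` [set o | ((m%:R * eps)%:E < H k o)%E].
    apply/seteqP; split => o [h1]; first by move=> [_ h2].
    move=> h2; split => //; split => //; rewrite (@early_eq _ _ eta) // => i ik.
    by case: h1 => h1 _; rewrite /history h1 ?leqW // /upd ik.
  by rewrite pr_cyl_gt // /rt /upd leqnn.
apply: le_trans (lerD first rest) _; rewrite -mulrDr; apply: ler_wpM2l => //.
rewrite (eq_bigr (fun e => ring_chain p lambda (eta k) e * ((K - drops y k eta)%:R + n%:R * eps)
   - ring_chain p lambda (eta k) e * (D e)%:R)); last first.
  move=> e _; rewrite -mulrBr; congr (_ * _).
  have -> : (K - drops y k eta)%:R = (K - (drops y k eta + D e))%:R + (D e)%:R :> R.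
    by rewrite -natrD; congr (_%:R); case: (D e); lia.
  ring.
rewrite sumrB -mulr_suml chain1 mul1r -/rs -[n.+1]addn1 natrD mulrDl mul1r; lra.
Qed.

Lemma sum_ticks_le (eps : R) M n : 0 < eps ->
  \sum_(i < n) \sum_(m < M) eps * pr P (tick eps i m) <= K%:R + n%:R * eps.
Proof.
move=> e0.
rewrite (eq_bigr (fun i : 'I_n => \sum_(e <- inits) \sum_(m < M)
    eps * pr P (cyl 0 (fun=> e) `&` tick eps (0 + i) m))); last first.
  move=> i _; rewrite exchange_big /=; apply: eq_bigr => m _.
  by rewrite (init_split (measurable_tick eps i m)) mulr_sumr.
rewrite exchange_big /=.
apply: (@le_trans _ _ (\sum_(e <- inits) init_law e * (K%:R + n%:R * eps))).
  rewrite big_seq [leRHS]big_seq; apply: ler_sum => e es.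
  have v : valid 0 (fun=> e) by move=> i _; exact: inits_mass.
  apply: le_trans (pr_cyl_ticks M n e0 v) _.
  by rewrite /weight big_ord0 mulr1 /drops big_ord0 subn0.
rewrite init_law_sum sumr_const card_ord -[X in X / _]mulr_natr mulfK // pnatr_eq0 -lt0n //.
Qed.

(** Chosen so that [M u k * eps k] exceeds [u]. *)
Let M u k : nat := ((Num.truncn (u : R)).+1 * k.+1)%N.
Let eps k : R := k.+1%:R^-1.

(* An outer bound of [u <= \sum_(i < n | early i) H i], which only tests [H] at
   the multiples of [eps k]. *)
Definition occupied (u : R) n : set T :=
  [set o | forall k, u <= \sum_(i < n) \sum_(m < M u k)
     eps k * (`[< tick (eps k) i m o >])%:R].

Lemma pr_occupied u : 0 < u ->
  measurable (\bigcup_n occupied u n) /\ pr P (\bigcup_n occupied u n) <= K%:R / u.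
Proof.
move=> u0.
have mt k n : measurable [set o | u <= \sum_(i < n) \sum_(m < M u k)
     eps k * (`[< tick (eps k) i m o >])%:R].
  have := measurable_weighted u (index_enum ('I_n * 'I_(M u k))%type) (fun=> eps k)
    (fun a => measurable_tick (eps k) a.1 a.2).
  by congr measurable; apply/seteqP; split => o /=; rewrite pair_bigA.
have eps0 k : 0 < eps k by rewrite invr_gt0.
have mo n : measurable (occupied u n).
  rewrite (_ : occupied u n = \bigcap_k [set o | u <= \sum_(i < n) \sum_(m < M u k)
     eps k * (`[< tick (eps k) i m o >])%:R]); first exact: bigcapT_measurable.
  by apply/seteqP; split => o h k; [move=> _|]; exact: h.
split; first exact: bigcupT_measurable.
apply: pr_bigcup_le => // [|n].
  apply: homo_leq => [A|A B C AB BC o /AB /BC //|n o h k]; first exact: subset_refl.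
  rewrite big_ord_recr /=; apply: le_trans (h k) _; rewrite lerDl.
  by apply: sumr_ge0 => m _; rewrite mulr_ge0 // ltW.
apply/ler_addgt0Pr => e e1; pose k := Num.truncn (n%:R / (e * u)).
have eu : 0 < e * u by exact: mulr_gt0.
have ke : n%:R * eps k <= e * u.
  rewrite ler_pdivrMr // mulrC -ler_pdivrMr //; exact/ltW/truncnS_gt.
rewrite -(ler_pM2r u0) mulrDl mulfVK ?gt_eqF //.
apply: le_trans (lerD (lexx _) ke); apply: le_trans (sum_ticks_le (M u k) n (eps0 k)).
rewrite pair_bigA /= mulrC.
have := @pr_markov _ _ _ P ('I_n * 'I_(M u k))%type (index_enum _) (fun=> eps k)
  (fun a => tick (eps k) a.1 a.2) (occupied u n) u (fun=> ltW (eps0 k))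
  (fun a => measurable_tick (eps k) a.1 a.2) (mo n).
apply=> o /(_ k); by rewrite pair_bigA.
Qed.

Lemma occupiedP u n (o : T) (a : nat -> R) : 0 < u ->
  (forall i, (i < n)%N -> 0 <= a i <= u) ->
  (forall i, (i < n)%N -> ((a i)%:E <= H i o)%E) ->
  (forall i, (i < n)%N -> 0 < a i -> early i (history o)) ->
  u <= \sum_(i < n) a i -> occupied u n o.
Proof.
move=> u0 a0 aH ae ua k; apply: le_trans ua _; apply: ler_sum => i _.
have /andP[ai0 aiu] := a0 i (ltn_ord i).
have e0 : 0 < eps k by rewrite invr_gt0.
have [ai|] := ltP 0 (a i); last first.
  by move=> h; apply: le_trans h _; apply: sumr_ge0 => m _; rewrite mulr_ge0 // ltW.
have aM : a i <= (M u k)%:R * eps k.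
  rewrite /M natrM mulfK ?pnatr_eq0 //; apply: le_trans aiu _.
  exact/ltW/truncnS_gt.
elim: (M u k) aM => [|m IH] aM; first by rewrite big_ord0; move: aM; rewrite mul0r.
have [h|h] := leP (a i) (m%:R * eps k).
  by rewrite big_ord_recr /=; apply: le_trans (IH h) _; rewrite lerDl mulr_ge0 // ltW.
rewrite (eq_bigr (fun=> eps k)); first by rewrite sumr_const card_ord -mulr_natl.
move=> j _; rewrite (_ : `[< _ >] = true) ?mulr1 //; apply/asboolP; split.
  exact: ae.
apply: lt_le_trans (aH i (ltn_ord i)); rewrite lte_fin; apply: le_lt_trans h.
by rewrite ler_pM2r // ler_nat -ltnS.
Qed.

End Occupation.

End FiniteSystem.

(** * Trajectories *)

Section Decreases.
Variables (d : nat) (R : realType).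
Local Notation site := 'rV[int]_d.

(* [K] successive decreases at [y], witnessed at rational times before [T]. *)
Fixpoint decreases (y : site) (K : nat) (T : rat) (w : R -> config d) : Prop :=
  if K is K'.+1 then exists q r : rat,
    [/\ [/\ 0 <= q, q < r & r <= T], decreases y K' q w &
        (active (w (ratr r) y) < active (w (ratr q) y))%N]
  else True.

Lemma decreases_le y K T T' w : T <= T' -> decreases y K T w -> decreases y K T' w.
Proof.
case: K => // K TT' [q [r [[q0 qr rT] hq hr]]]; exists q, r; split => //; split => //.
exact: le_trans TT'.
Qed.

Lemma drops_mono y m n (e : nat -> config d) : (m <= n)%N -> (drops y m e <= drops y n e)%N.
Proof.
move=> mn; rewrite -(subnK mn); elim: (n - m)%N => // k; rewrite addSn => /leq_trans; apply.
by rewrite [leqRHS]/drops big_ord_recr leq_addr.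
Qed.

Lemma drops_lt y m n (e : nat -> config d) : (m <= n)%N ->
  (active (e n y) < active (e m y))%N -> (drops y m e < drops y n e)%N.
Proof.
move=> mn; rewrite -(subnK mn); elim: (n - m)%N => [|k IH]; first by rewrite ltnn.
rewrite addSn => h; rewrite [ltnRHS]/drops big_ord_recr -/(drops y _ e) /=.
have [h'|h'] := ltnP (active (e (k + m).+1 y)) (active (e (k + m)%N y)).
  by rewrite addn1 ltnS drops_mono // leq_addl.
by rewrite addn0; apply: IH; exact: leq_ltn_trans h' h.
Qed.

Section JumpPath.
Variables (h : nat -> \bar R) (e : nat -> config d) (w : R -> config d).
Let S n : \bar R := (\sum_(i < n) h i)%E.
Hypothesis h_gt0 : forall i, (0%:E < h i)%E.
Hypothesis h_large : forall k, exists2 i, (k <= i)%N & (1%:E < h i)%E.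
Hypothesis we : forall n t, (S n <= t%:E)%E -> (t%:E < S n.+1)%E -> 0 <= t -> w t = e n.

Let SS n : S n.+1 = (S n + h n)%E. Proof. by rewrite /S big_ord_recr. Qed.

Let S0 : S 0 = 0%:E. Proof. by rewrite /S big_ord0. Qed.

Let S_ge0 n : (0%:E <= S n)%E.
Proof. by apply: sume_ge0 => i _; exact: ltW. Qed.

Let S_le m n : (m <= n)%N -> (S m <= S n)%E.
Proof.
move=> mn; rewrite -(subnK mn); elim: (n - m)%N => // k /le_trans; apply.
by rewrite addSn SS leeDl // ltW.
Qed.

Let S_large (m : nat) : exists n, (m%:R%:E <= S n)%E.
Proof.
elim: m => [|m [n hn]]; first by exists 0%N; rewrite S0.
have [i ni hi] := h_large n; exists i.+1; rewrite SS -natr1 EFinD.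
by apply: leeD; [exact: le_trans hn (S_le ni)|exact: ltW].
Qed.

Let at_ n t := (S n <= t%:E)%E && (t%:E < S n.+1)%E.

Let ex_at t : 0 <= t -> exists n, at_ n t.
Proof.
move=> t0; have ex : exists n, (t%:E < S n.+1)%E.
  have [n hn] := S_large (Num.truncn t).+1; exists n.
  apply: lt_le_trans (_ : _ < (Num.truncn t).+1%:R%:E)%E _.
    by rewrite lte_fin truncnS_gt.
  exact: le_trans hn (S_le _).
case: (ex_minnP ex) => n hn hmin; exists n; rewrite /at_ hn andbT.
case: n hn hmin => [|n] _ hmin; first by rewrite S0 lee_fin.
by rewrite leNgt; apply/negP => /hmin; rewrite ltnn.
Qed.

Let ex_rat (q : rat) : 0 <= q -> exists n, at_ n (ratr q).
Proof. by move=> q0; apply: ex_at; rewrite ler0q. Qed.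

Let at_le m n t t' : at_ m t -> at_ n t' -> t <= t' -> (m <= n)%N.
Proof.
move=> /andP[h1 _] /andP[_ h2] tt'; rewrite leqNgt; apply/negP => /S_le nm.
have := lt_le_trans h2 (le_trans nm h1); rewrite lte_fin ltNge tt' //.
Qed.

Let at_w n t : 0 <= t -> at_ n t -> w t = e n.
Proof. by move=> t0 /andP[h1 h2]; exact: we. Qed.

Let S_fin n t : (S n <= t%:E)%E -> exists s, S n = s%:E.
Proof.
move=> h1; exists (fine (S n)); rewrite fineK // ge0_fin_numE //.
exact: le_lt_trans h1 (ltry _).
Qed.

(** Holding intervals have positive length, so events tested at rational times see every state of
    the chain. *)
Let ex_rat_at n (T : rat) : (S n <= (ratr T)%:E)%E ->
  exists q : rat, [/\ 0 <= q, q <= T & at_ n (ratr q)].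
Proof.
move=> hn; have T0 : 0 <= T by rewrite -(@ler0q R) -lee_fin; exact: le_trans hn.
have [h1|h1] := ltP (ratr T)%:E (S n.+1).
  by exists T; split => //; rewrite /at_ hn h1.
have [[a Sa] [b Sb]] := (S_fin hn, S_fin h1).
have ab : a < b.
  move: (SS n) (h_gt0 n); rewrite Sa Sb; case: (h n) => [r||] //= [->]; rewrite lte_fin; lra.
have [q] := rat_in_itvoo ab; rewrite in_itv /= => /andP[aq qb]; exists q; split.
- rewrite -(@ler0q R); apply: le_trans (ltW aq).
  by rewrite -lee_fin -Sa.
- rewrite -(ler_rat R); apply: le_trans (ltW qb) _.
  by rewrite -lee_fin -Sb.
- by rewrite /at_ Sa Sb lee_fin lte_fin (ltW aq).
Qed.

Let ex_rat_between n (T T' : rat) m : 0 <= T -> T <= T' -> at_ m (ratr T) -> (m <= n)%N ->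
  (S n <= (ratr T')%:E)%E -> exists q : rat, [/\ T <= q, q <= T' & at_ n (ratr q)].
Proof.
move=> T0 TT' hm; rewrite leq_eqVlt => /orP[/eqP <- _|mn hn]; first by exists T.
have [q [q0 qT hq]] := ex_rat_at hn; exists q; split => //.
rewrite -(ler_rat R) -lee_fin; case/andP: hm => _ /ltW /le_trans; apply.
by apply: le_trans (S_le mn) _; case/andP: hq.
Qed.

Lemma decreases_drops y K (T : rat) n : 0 <= T -> at_ n (ratr T) ->
  decreases y K T w -> (K <= drops y n e)%N.
Proof.
elim: K T n => // K IH T n T0 hn [q [r [[q0 qr rT] hq hr]]].
have r0 : 0 <= r by exact: le_trans (ltW qr).
have [k hk] := ex_rat q0.
have [l hl] := ex_rat r0.
apply: leq_ltn_trans (IH _ _ q0 hk hq) _.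
apply: leq_trans (drops_mono _ _ (at_le hl hn _)); last by rewrite ler_rat.
apply: drops_lt; first by apply: at_le hk hl _; rewrite ler_rat ltW.
by rewrite -(at_w _ hk) ?ler0q // -(at_w _ hl) ?ler0q.
Qed.

Lemma drops_decreases y K (T : rat) n : (S n <= (ratr T)%:E)%E ->
  (K <= drops y n e)%N -> decreases y K T w.
Proof.
elim: n K T => [|n IH] K T hT; first by rewrite /drops big_ord0 leqn0 => /eqP ->.
have hT' := le_trans (S_le (leqnSn n)) hT.
rewrite {1}/drops big_ord_recr -/(drops y n e) /=; case dr: (_ < _)%N; last first.
  by rewrite addn0; exact: IH.
rewrite addn1 leq_eqVlt ltnS => /orP[/eqP ->|]; last exact: IH.
have [q [q0 qT hq]] := ex_rat_at hT'; have [r [r0 rT hr]] := ex_rat_at hT.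
exists q, r; split; last by rewrite (at_w _ hq) ?ler0q // (at_w _ hr) ?ler0q.
  split => //; rewrite -(ltr_rat R) -lte_fin; case/andP: hq => _ /lt_le_trans; apply.
  by case/andP: hr.
by apply: IH => //; case/andP: hq.
Qed.

Lemma jump_path_state (T : rat) : 0 <= T -> exists n, w (ratr T) = e n.
Proof.
move=> T0; have [n hn] := ex_rat T0; exists n; apply: at_w => //.
by rewrite ler0q.
Qed.

Lemma few_drops_of_stable (W : seq site) x K (T : rat) : 0 <= T ->
  (forall y, y \in W -> active (w (ratr T) y) = 0%N) -> ~ decreases x K T w ->
  exists k, stable W (e k) /\ (drops x k e < K)%N.
Proof.
move=> T0 hW hD; have [n hn] := ex_rat T0.
exists n; split.
  by apply/allP => y /hW; rewrite (at_w _ hn) ?ler0q // => ->.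
rewrite ltnNge; apply/negP => hK; apply: hD; apply: drops_decreases hK.
by case/andP: hn.
Qed.

(** A strike comes after [K] decreases, hence after time [T], and leaves [y + s] active on a holding
    interval, where some rational time reveals it. *)
Lemma no_strike_of_inactive y s K n (T T' : rat) : 0 <= T -> T <= T' ->
  ~ decreases y K T w -> decreases y (K + n) T' w ->
  (forall q : rat, T <= q -> q <= T' -> active (w (ratr q) (y + s)) = 0%N) ->
  exists k, strikes y s K k e = 0%N /\ (K + n <= drops y k e)%N.
Proof.
move=> T0 TT' hD hD' hx; have T'0 := le_trans T0 TT'.
have [m hm] := ex_rat T0.
have [k hk] := ex_rat T'0.
have dm : (drops y m e < K)%N.
  rewrite ltnNge; apply/negP => hK; apply: hD; apply: drops_decreases hK.
  by case/andP: hm.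
exists k; split; last exact: decreases_drops hD'.
apply/eqP; rewrite sum_nat_eq0; apply/forallP => i /=; rewrite eqb0.
apply/negP => /and3P[Ki _ ax].
have mi : (m <= i.+1)%N.
  rewrite leqW // leqNgt; apply/negP => /ltnW /(drops_mono y e).
  by rewrite leqNgt (leq_trans dm Ki).
have hi : (S i.+1 <= (ratr T')%:E)%E.
  by case/andP: hk => h1 _; apply: le_trans (S_le (ltn_ord i)) h1.
have [q [Tq qT hq]] := ex_rat_between T0 TT' hm mi hi.
by move: ax; rewrite -(at_w _ hq) ?ler0q ?(le_trans T0) // hx.
Qed.

Lemma early_of_active y K (T T' : rat) : 0 <= T -> T < T' ->
  ~ decreases y K T' w ->
  (forall q : rat, T <= q -> q <= T' -> (0 < active (w (ratr q) y))%N) ->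
  exists n (a : nat -> R), [/\ forall i, 0 <= a i <= ratr (T' - T),
    forall i, ((a i)%:E <= h i)%E,
    forall i, (i < n)%N -> 0 < a i -> early y K i e &
    \sum_(i < n) a i = ratr (T' - T)].
Proof.
move=> T0 TT' hD hy; have T'0 : 0 <= T' by exact: le_trans (ltW TT').
have [m hm] := ex_rat T0.
have [k hk] := ex_rat T'0.
have dk : (drops y k e < K)%N.
  rewrite ltnNge; apply/negP => hK; apply: hD; apply: drops_decreases hK.
  by case/andP: hk.
rewrite raddfB /=; set t : R := ratr T in hm *; set t' : R := ratr T' in hk *.
have tt' : t < t' by rewrite ltr_rat.
(* The [i]th ring time clipped to [[t, t']], so that [c i.+1 - c i] is the time spent in state [i]
   within that window. *)
pose c i : R := if (S i <= t%:E)%E then t else if (t'%:E <= S i)%E then t' else fine (S i).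
have c_itv i : t <= c i <= t'.
  rewrite /c; case: (leP (S i) t%:E) => h1; first by rewrite lexx ltW.
  case: (leP t'%:E (S i)) => h2; first by rewrite lexx ltW.
  have [s Ss] := S_fin (ltW h2); move: h1 h2; rewrite Ss !lte_fin /= => h1 h2.
  by rewrite !ltW.
have hc i : [/\ c i <= c i.+1, ((c i.+1 - c i)%:E <= h i)%E &
    c i < c i.+1 -> (S i < t'%:E)%E /\ (t%:E < S i.+1)%E].
  have := S_le (leqnSn i); have := h_gt0 i; have := SS i; have := S_ge0 i.
  have [h2|h2] := leP t'%:E (S i).
    move=> _ _ hi h3; have h4 := le_trans h2 h3.
    have e1 j : (t'%:E <= S j)%E -> c j = t'.
      by move=> hj; rewrite /c hj leNgt (lt_le_trans _ hj) // lte_fin.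
    by rewrite !e1 // subrr ltxx; split => //; exact: ltW.
  have [s Ss] := S_fin (ltW h2); rewrite /c Ss; move: h2; rewrite Ss lte_fin => st'.
  case: (h i) => [r||] // _ -> r0 _; last first.
    have -> : (s%:E + +oo <= t%:E)%E = false by [].
    have -> : (t'%:E <= s%:E + +oo)%E = true by exact: leey.
    clear r0; rewrite /= !lee_fin; case: (leP s t) => h1; case: (leP t' s) => h2;
      by split; [lra|exact: leey|split => //; exact: ltry].
  have {}r0 : 0 < r by rewrite -lte_fin.
  rewrite -EFinD !lee_fin !lte_fin /= (leNgt t' s) st' /=.
  case: (leP s t) => h1; case: (leP (s + r) t) => h3; case: (leP t' (s + r)) => h4;
    (split; [lra|lra|rewrite ?ltxx // => h5; split => //]); try (have : t' < t' by lra); by rewrite ?ltxx.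
exists k.+1, (fun i => c i.+1 - c i); split => [i|i|i ik|].
- by have := c_itv i; have := c_itv i.+1; case: (hc i) => h1 _ _; lra.
- by case: (hc i).
- rewrite subr_gt0; case: (hc i) => _ _ /[apply] -[h1 h2].
  have mi : (m <= i)%N.
    rewrite leqNgt; apply/negP => /S_le im; case/andP: hm => h3 _.
    by have := lt_le_trans h2 (le_trans im h3); rewrite ltxx.
  have [q [Tq qT hq]] := ex_rat_between T0 (ltW TT') hm mi (ltW h1).
  rewrite /early -(at_w _ hq) ?ler0q ?(le_trans T0) // hy //=.
  by apply: leq_ltn_trans dk; exact: drops_mono.
rewrite -(big_mkord xpredT (fun i => c i.+1 - c i)) telescope_sumr //; congr (_ - _).
  rewrite /c; case/andP: hk => _ hk; rewrite (ltW hk) leNgt (lt_trans _ hk) // lte_fin //.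
by rewrite /c S0 lee_fin ler0q T0.
Qed.

End JumpPath.

End Decreases.

(** * Window events *)

Section Window.
Variables (d : nat) (R : realType).
Local Notation site := 'rV[int]_d.

(* [window_event B t] is the sigma-algebra of this type. *)
Definition windowT (B : {fset site}) (t : R) := g_sigma_algebraType
  [set A : set (trajT d R) | exists s x a,
        [/\ 0 <= s, s <= t, x \in B & A = [set w : traj d R | w s x = a]]].

Lemma window_measurable B t (A : set (trajT d R)) : window_event B t A -> measurable A.
Proof.
apply: smallest_sub; first exact: smallest_sigma_algebra.
move=> _ [s [x [a [s0 _ _ ->]]]]; apply: sub_sigma_algebra.
by exists s, x, a.
Qed.

Lemma window_active B t s x : 0 <= s -> s <= t -> x \in B ->
  discrete_rv (fun w : windowT B t => active ((w : traj d R) s x)).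
Proof.
move=> s0 st xB.
have m a : measurable ([set w | (w : traj d R) s x = a] : set (windowT B t)).
  by apply: sub_sigma_algebra; exists s, x, a.
apply: discrete_rvP => -[|c].
  rewrite (_ : _ @^-1` _ = [set w : windowT B t | (w : traj d R) s x = Act 0] `|`
      [set w : windowT B t | (w : traj d R) s x = Sleep]); first exact: measurableU.
  apply/seteqP; split => w /=; last by case=> ->.
  by case: ((w : traj d R) s x) => [k|] /= => [->|]; [left|right].
rewrite (_ : _ @^-1` _ = [set w : windowT B t | (w : traj d R) s x = Act c.+1]) //.
by apply/seteqP; split => w /= => [|->//]; case: ((w : traj d R) s x) => [k|] //= ->.
Qed.

Lemma window_decreases B t y K (T : rat) : y \in B -> ratr T <= t ->
  measurable [set w : windowT B t | decreases y K T (w : traj d R)].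
Proof.
move=> yB; elim: K T => [|K IH] T Tt.
  by rewrite [X in measurable X](_ : _ = setT) //; apply/seteqP; split.
apply: measurable_ex_count => q; apply: measurable_ex_count => r.
have [[q0 qr rT]|h] := pselect [/\ 0 <= q, q < r & r <= T]; last first.
  by rewrite [X in measurable X](_ : _ = set0) //; apply/seteqP; split => // w [].
have r0 : 0 <= r by exact: le_trans (ltW qr).
have rt : ratr r <= t by apply: le_trans Tt; rewrite ler_rat.
have qt : ratr q <= t by apply: le_trans rt; rewrite ler_rat ltW.
rewrite [X in measurable X](_ : _ = [set w : windowT B t | decreases y K q (w : traj d R)] `&`
   [set w : windowT B t | (active ((w : traj d R) (ratr r) y) < active ((w : traj d R) (ratr q) y))%N]).
  apply: measurableI; first exact: IH.
  have hq : discrete_rv (fun w : windowT B t => active ((w : traj d R) (ratr q) y)).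
    by apply: window_active; rewrite ?ler0q.
  have hr : discrete_rv (fun w : windowT B t => active ((w : traj d R) (ratr r) y)).
    by apply: window_active; rewrite ?ler0q.
  exact: (discrete_rv_pred (fun a : nat * nat => (a.1 < a.2)%N) (discrete_rv_pair hr hq)).
by apply/seteqP; split => w /= [] //; split.
Qed.

(** [stuck], [unseen] and [busy] depend on finitely many sites and a bounded time, so that bounds on
    them pass to the infinite system. *)
Definition stuck (W : seq site) x K (T : rat) : set (trajT d R) :=
  [set w | (forall y, y \in W -> active ((w : traj d R) (ratr T) y) = 0%N) /\
           ~ decreases x K T (w : traj d R)].

Definition unseen y s K n (T T' : rat) : set (trajT d R) :=
  [set w | [/\ ~ decreases y K T (w : traj d R), decreases y (K + n) T' (w : traj d R) &
   forall q : rat, T <= q -> q <= T' -> active ((w : traj d R) (ratr q) (y + s)) = 0%N]].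

Definition busy y K (T T' : rat) : set (trajT d R) :=
  [set w | ~ decreases y K T' (w : traj d R) /\
   forall q : rat, T <= q -> q <= T' -> (0 < active ((w : traj d R) (ratr q) y))%N].

Let window_all B t (P : rat -> Prop) (a : pred nat) x : x \in B ->
  (forall q, P q -> 0 <= q /\ ratr q <= t) ->
  measurable [set w : windowT B t | forall q, P q -> a (active ((w : traj d R) (ratr q) x))].
Proof.
move=> xB hP; apply: measurable_all_count => q.
have [Pq|nPq] := pselect (P q); last first.
  by rewrite [X in measurable X](_ : _ = setT) //; apply/seteqP; split.
have [q0 qt] := hP q Pq.
rewrite [X in measurable X](_ : _ = [set w : windowT B t | a (active ((w : traj d R) (ratr q) x))]).
  have hq : discrete_rv (fun w : windowT B t => active ((w : traj d R) (ratr q) x)).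
    by apply: window_active; rewrite ?ler0q.
  exact: (discrete_rv_pred a hq).
by apply/seteqP; split => w /=; [exact|move=> h _].
Qed.

Lemma window_stuck W x K (T : rat) : 0 <= T ->
  window_event [fset u | u in x :: W]%fset (ratr T) (stuck W x K T).
Proof.
move=> T0; set B := [fset _ | _ in _]%fset.
have BW u : u \in x :: W -> u \in B by move=> h; rewrite !inE in h *.
suff m : measurable ([set w : windowT B (ratr T) |
    forall y, y \in W -> active ((w : traj d R) (ratr T) y) = 0%N] `&`
  ~` [set w : windowT B (ratr T) | decreases x K T (w : traj d R)]) by exact: m.
apply: measurableI; last first.
  by apply: measurableC; apply: window_decreases => //; apply: BW; rewrite mem_head.
apply: measurable_all_count => y; have [yW|yW] := boolP (y \in W); last first.
  by rewrite [X in measurable X](_ : _ = setT) //; apply/seteqP; split.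
rewrite [X in measurable X](_ : _ =
  [set w : windowT B (ratr T) | active ((w : traj d R) (ratr T) y) = 0%N]).
  have hT : discrete_rv (fun w : windowT B (ratr T) => active ((w : traj d R) (ratr T) y)).
    by apply: window_active; rewrite ?ler0q // BW // inE yW orbT.
  exact: (discrete_rv_pred (fun a => a = 0%N) hT).
by apply/seteqP; split => w /=; [exact|move=> h _].
Qed.

Lemma window_unseen (y s : site) K n (T T' : rat) : 0 <= T -> T <= T' ->
  window_event [fset y; (y + s)%R]%fset (ratr T') (unseen y s K n T T').
Proof.
move=> T0 TT'; set B := [fset _; _]%fset.
have yB : y \in B by rewrite !inE eqxx.
have xB : y + s \in B by rewrite !inE eqxx orbT.
pose E : set (windowT B (ratr T')) :=
  (~` [set w | decreases y K T (w : traj d R)] `&` [set w | decreases y (K + n) T' (w : traj d R)]) `&`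
  [set w | forall q, T <= q /\ q <= T' -> active ((w : traj d R) (ratr q) (y + s)) == 0%N].
suff m : measurable E.
  have -> : unseen y s K n T T' = E; last exact: m.
  apply/seteqP; split => w /=.
    by case=> h1 h2 h3; split => // q [q1 q2]; rewrite h3.
  by move=> [[h1 h2] h3]; split => // q q1 q2; apply/eqP/h3.
apply: measurableI; first apply: measurableI.
- by apply: measurableC; apply: window_decreases => //; rewrite ler_rat.
- exact: window_decreases.
apply: (@window_all _ _ (fun q => T <= q /\ q <= T') (fun a => a == 0%N)) => // q [q1 q2].
by split; [exact: le_trans q1|rewrite ler_rat].
Qed.

Lemma window_busy y K (T T' : rat) : 0 <= T ->
  window_event [fset y]%fset (ratr T') (busy y K T T').
Proof.
move=> T0; set B := [fset _]%fset; have yB : y \in B by rewrite !inE.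
pose E : set (windowT B (ratr T')) := ~` [set w | decreases y K T' (w : traj d R)] `&`
  [set w | forall q, T <= q /\ q <= T' -> (0 < active ((w : traj d R) (ratr q) y))%N].
suff m : measurable E.
  have -> : busy y K T T' = E; last exact: m.
  apply/seteqP; split => w /=.
    by case=> h1 h3; split => // q [q1 q2]; rewrite h3.
  by move=> [h1 h3]; split => // q q1 q2; apply/h3.
apply: measurableI.
- by apply: measurableC; apply: window_decreases.
apply: (@window_all _ _ (fun q => T <= q /\ q <= T') (fun a => 0 < a)%N) => // q [q1 q2].
by split; [exact: le_trans q1|rewrite ler_rat].
Qed.

End Window.

(** * Window events in finite systems *)

Section FiniteLaw.
Variables (d : nat) (R : realType) (p : 'rV[int]_d -> R).
Hypothesis pJ : jump_distribution p.
Variable lambda : R.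
Hypothesis lambda_gt0 : 0 < lambda.
Variables (L N : nat) (init : 'I_L -> config d).
Hypothesis L_gt0 : (0 < L)%N.
Hypothesis init_mass : forall j, mass_le N (init j).
Variables (mu : set (configT d) -> \bar R) (Q : probability (trajT d R) R).
Hypothesis mu_init : forall e : configT d, mu [set e] = (init_law R init e)%:E.
Hypothesis law : arw_finite_law p lambda mu Q.

(* Almost every trajectory is the jump path of its chain and waiting times. *)
Lemma finite_law_le (A : set (trajT d R)) (b : R) : measurable A ->
  (forall disp (T : measurableType disp) (P : probability T R)
     (Y : nat -> T -> configT d) (H : nat -> T -> \bar R),
     (forall n, measurable_fun [set: T] (Y n)) -> (forall n, measurable_fun [set: T] (H n)) ->
     (forall (n : nat) (eta : nat -> config d) (h : nat -> R), (forall i, 0 <= h i) ->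
        P [set o | (forall i, (i <= n)%N -> Y i o = eta i) /\
             (forall i, (i < n)%N -> ((h i)%:E < H i o)%E)] =
        (init_law R init (eta 0%N) * \prod_(i < n) (ring_chain p lambda (eta i) (eta i.+1) *
           expR (- (total_rate lambda (eta i) * h i))))%:E) ->
     exists2 E : set T, measurable E /\ pr P E <= b &
       forall o (w : traj d R), A w -> (forall i, (0%:E < H i o)%E) ->
         (forall k, exists2 i, (k <= i)%N & (1%:E < H i o)%E) ->
         (forall n (t : R), (\sum_(i < n) H i o <= t%:E)%E ->
            (t%:E < \sum_(i < n.+1) H i o)%E -> 0 <= t -> w t = Y n o) -> E o) ->
  (Q A <= b%:E)%E.
Proof.
move=> mA hE; case: law => disp [T [P [Y [H [X [[mY [mH mX]] hlaw hae QE]]]]]].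
have hlaw' n eta h : (forall i, 0 <= h i) ->
        P [set o | (forall i, (i <= n)%N -> Y i o = eta i) /\
             (forall i, (i < n)%N -> ((h i)%:E < H i o)%E)] =
        (init_law R init (eta 0%N) * \prod_(i < n) (ring_chain p lambda (eta i) (eta i.+1) *
           expR (- (total_rate lambda (eta i) * h i))))%:E.
  by move=> h0; rewrite hlaw // mu_init EFinM.
have [E [mE Eb] hEo] := hE _ _ _ _ _ mY mH hlaw'.
have mXA : measurable (X @^-1` A) by rewrite -[_ @^-1` _]setTI; exact: mX.
rewrite QE // prE // lee_fin; apply: le_trans Eb; apply: pr_le_ae => //.
have m1 : measurable [set o | exists i, ~ (0%:E < H i o)%E].
  apply: measurable_ex_count => i; apply: measurableC.
  exact: (measurable_H_gt mH).
have m2 : measurable [set o | exists k, forall i, (k <= i)%N -> (0%:E < H i o)%E /\ (H i o <= 1%:E)%E].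
  apply: measurable_ex_count => k; apply: measurable_all_count => i.
  have [ki|ki] := leqP k i; last first.
    by rewrite [X in measurable X](_ : _ = setT) //; apply/seteqP; split.
  rewrite [X in measurable X](_ : _ = [set o | (0%:E < H i o)%E /\ (H i o <= 1%:E)%E]).
    exact: (measurable_H_01 mH).
  by apply/seteqP; split => o /=; [exact|].
have a1 : {ae P, forall o, ~ [set o | exists i, ~ (0%:E < H i o)%E] o}.
  exists [set o | exists i, ~ (0%:E < H i o)%E]; split => //; last by move=> o /contrapT.
  have := H_gt0_ae pJ lambda_gt0 mY mH L_gt0 init_mass hlaw'.
  by move=> h; rewrite prE // h.
have a2 : {ae P, forall o, ~ [set o | exists k, forall i, (k <= i)%N -> (0%:E < H i o)%E /\ (H i o <= 1%:E)%E] o}.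
  exists [set o | exists k, forall i, (k <= i)%N -> (0%:E < H i o)%E /\ (H i o <= 1%:E)%E].
  split => //; last by move=> o /contrapT.
  have := H_large_ae pJ lambda_gt0 mY mH L_gt0 init_mass hlaw'.
  by move=> h; rewrite prE // h.
apply: filterS3 a1 a2 hae => o n1 n2 h3 Ao.
have h1 i : (0%:E < H i o)%E by apply: contrapT => h; apply: n1; exists i.
apply: (hEo o (X o)) => // k; apply: contrapT => hk; apply: n2; exists k => i ki; split => //.
by rewrite leNgt; apply/negP => hi; apply: hk; exists i.
Qed.

Lemma finite_stuck W x K (T : rat) : 0 <= T ->
  (Q (stuck W x K T) <= (1 - (\sum_j reach_prob p lambda W x K (init j, 0%N)) / L%:R)%:E)%E.
Proof.
move=> T0; apply: finite_law_le => [|disp T' P Y H mY mH hlaw].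
  by apply: window_measurable; exact: window_stuck.
exists [set o | exists k, stable W (history Y o k) /\ (drops x k (history Y o) < K)%N].
  split; last exact: (pr_stable_few_drops pJ lambda_gt0 mY mH L_gt0 init_mass hlaw).
  apply: measurable_ex_count => k; apply: measurableI; first exact: measurable_stable.
  exact: (discrete_rv_pred (fun c => (c < K)%N) (discrete_drops mY x k)).
move=> o w [h1 h2] H0 HL hw.
exact: (few_drops_of_stable H0 HL hw T0 h1 h2).
Qed.

Lemma finite_unseen y s K n (T T' : rat) : s \in unit_steps d -> 0 <= T -> T <= T' ->
  (Q (unseen y s K n T T') <= ((1 - p s / (1 + lambda)) ^+ n)%:E)%E.
Proof.
move=> hs T0 TT'; apply: finite_law_le => [|disp T1 P Y H mY mH hlaw].
  by apply: window_measurable; exact: window_unseen.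
exists [set o | exists k, strikes y s K k (history Y o) = 0%N /\ (K + n <= drops y k (history Y o))%N].
  split; last exact: (pr_no_strike pJ lambda_gt0 mY mH L_gt0 init_mass hlaw).
  apply: measurable_ex_count => k; apply: measurableI.
    exact: (discrete_rv_pred (fun c => c = 0%N) (discrete_strikes mY y s K k)).
  exact: (discrete_rv_pred (fun c => (K + n <= c)%N) (discrete_drops mY y k)).
move=> o w [h1 h2 h3] H0 HL hw.
exact: (no_strike_of_inactive H0 HL hw T0 TT' h1 h2 h3).
Qed.

Lemma finite_busy y K (T T' : rat) : 0 <= T -> T < T' ->
  (Q (busy y K T T') <= (K%:R / ratr (T' - T))%:E)%E.
Proof.
move=> T0 TT'; apply: finite_law_le => [|disp T1 P Y H mY mH hlaw].
  by apply: window_measurable; exact: window_busy.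
have u0 : 0 < ratr (T' - T) :> R by rewrite ltr0q subr_gt0.
exists (\bigcup_n occupied Y H y K (ratr (T' - T)) n).
  exact: (pr_occupied pJ lambda_gt0 mY mH L_gt0 init_mass hlaw).
move=> o w [h1 h2] H0 HL hw.
have [n [a [a1 a2 a3 a4]]] := early_of_active H0 HL hw T0 TT' h1 h2.
by exists n => //; apply: (occupiedP u0 (a := a)) => [i _|i _||]; [exact: a1|exact: a2|exact: a3|rewrite a4].
Qed.

End FiniteLaw.

(** * The law of a pattern with a uniform random shift *)

Section PatternLaw.
Variables (d : nat) (R : realType).
Hypothesis d_gt2 : (2 < d)%N.
Variables (L : nat) (b : nat -> bool).
Hypothesis L_gt0 : (0 < L)%N.
Local Notation site := 'rV[int]_d.
Let pat (j : nat) : configT d := pattern d_gt2 L b j.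
Let m : {measure set (configT d) -> \bar R} := msum (fun j => \d_(pat j)) L.

Definition pattern_law : probability (configT d) R := mnormalize m \d_(pat 0).

Let mE A : m A = (\sum_(j < L) (`[< A (pat j) >])%:R)%:E.
Proof.
rewrite /m /= /msum -sumEFin; apply: eq_bigr => j _; rewrite [LHS]/= diracE; congr ((_ : bool)%:R%:E).
Qed.

Lemma pattern_lawE A : pattern_law A = ((\sum_(j < L) (`[< A (pat j) >])%:R) / L%:R)%:E.
Proof.
have e1 : m setT = L%:R%:E.
  rewrite mE (eq_bigr (fun=> 1)) ?sumr_const ?card_ord // => j _.
  by rewrite asboolT.
rewrite -[LHS]/(mnormalize m \d_(pat 0) A) /mnormalize e1 eqe pnatr_eq0 eqn0Ngt L_gt0 /= EFinM.
by rewrite -mE.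
Qed.

Lemma translate_pattern z j : translate z (pat j) = pat (residue d_gt2 L j z).
Proof.
apply/funext => y; rewrite /translate /pat /pattern; congr (Act (b _)); rewrite /residue; congr `|_|%N.
rewrite (_ : first_coord d_gt2 (y + z) = first_coord d_gt2 y + first_coord d_gt2 z); last first.
  by rewrite /first_coord mxE.
rewrite gez0_abs; last by rewrite modz_ge0 //; lia.
by rewrite modzDmr addrA.
Qed.

(** Translations permute the [L] shifted patterns transitively, so an invariant event contains all
    of them or none. *)
Lemma pattern_law_ergodic : translation_ergodic pattern_law.
Proof.
split => [z A mA|A mA hA].
  rewrite !pattern_lawE -(@sum_residue d R d_gt2 L z (fun r => (`[< A (pat r) >])%:R)).
  congr ((_ / _)%:E); apply: eq_bigr => j _; congr ((_ : bool)%:R).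
  by rewrite /preimage /= translate_pattern.
have h (j : 'I_L) : `[< A (pat j) >] = `[< A (pat 0) >].
  pose z : site := \row_k (j : nat)%:Z.
  rewrite -{2}(hA z) /preimage /= translate_pattern; congr (`[< A (pat _) >]).
  by rewrite /residue /first_coord mxE addr0 modz_small //= ltz_nat ltn_ord.
rewrite pattern_lawE (eq_bigr (fun=> (`[< A (pat 0) >])%:R)) => [|j _]; last by rewrite h.
rewrite sumr_const card_ord -[X in X / _]mulr_natr mulfK ?pnatr_eq0 -?lt0n //.
by case: `[< _ >]; [right|left].
Qed.

Lemma pattern_law_all_active : all_active pattern_law.
Proof.
rewrite /all_active pattern_lawE (eq_bigr (fun=> 1)) => [|j _].
  by rewrite sumr_const card_ord mulfV // pnatr_eq0 -lt0n.
by rewrite asboolT.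
Qed.

Lemma measurable_particles x :
  measurable_fun [set: configT d] (fun eta => (particles (eta x))%:R%:E : \bar R).
Proof.
have mx a : measurable [set eta : configT d | eta x = a].
  by apply: sub_sigma_algebra; exists x, a.
have h : discrete_rv (fun eta : configT d => particles (eta x)).
  apply: discrete_rvP => c.
  have [->|c1] := eqVneq c 1%N.
    rewrite (_ : _ @^-1` _ = [set eta : configT d | eta x = Act 1] `|` [set eta : configT d | eta x = Sleep]).
      exact: measurableU.
    by apply/seteqP; split => eta /=; [case: (eta x) => [n /= ->|]; [left|right]|case=> ->].
  rewrite (_ : _ @^-1` _ = [set eta : configT d | eta x = Act c]) //.
  apply/seteqP; split => eta /=; last by move=> ->.
  by case: (eta x) => [n /= ->//|/= e]; rewrite -e eqxx in c1.
move=> _ B mB; rewrite setTI.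
exact: (discrete_rv_pred (fun n : nat => B (n%:R%:E)) h).
Qed.

Lemma density_pattern_law : density pattern_law = ((\sum_(r < L) (b r)%:R) / L%:R)%:E.
Proof.
rewrite /density (eq_measure_integral (mscale (L%:R^-1)%:nng m)); last first.
  move=> A _ _; rewrite -[RHS]/((L%:R^-1)%:E * m A)%E [LHS]pattern_lawE mE.
  by rewrite -EFinM mulrC.
rewrite ge0_integral_mscale //=; last exact: measurable_particles.
rewrite /m ge0_integral_measure_sum //; last exact: measurable_particles.
rewrite (eq_bigr (fun j : 'I_L => (particles (pat j 0))%:R%:E)) => [|j _]; last first.
  by rewrite integral_dirac //; [rewrite diracT mul1e|exact: measurable_particles].
by rewrite sumEFin -EFinM mulrC; congr ((_ / _)%:E); exact: pattern_avg.
Qed.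

Lemma pattern_law_restrict V (e : configT d) :
  pushforward pattern_law (restrict_config V) [set e] =
  (init_law R (fun j : 'I_L => restrict_config V (pat j)) e)%:E.
Proof.
by rewrite /pushforward pattern_lawE.
Qed.

Lemma mass_le_restrict (V : {fset site}) j : mass_le #|` V|%fset (restrict_config V (pat j)).
Proof.
move=> D uD; apply: (@leq_trans (\sum_(u <- D) (u \in V))%N).
  apply: leq_sum => u _; rewrite /restrict_config; case: ifP => _ //.
  by rewrite /pat /pattern /= leq_b1.
rewrite (eq_bigr (fun u => if u \in V then 1 else 0)%N) => [|u _]; last by case: ifP.
rewrite -big_mkcond sum1_count -size_filter; apply: uniq_leq_size; first exact: filter_uniq.
by move=> u; rewrite mem_filter => /andP[].
Qed.

End PatternLaw.

Section LimitLaw.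
Variables (d : nat) (R : realType) (p : 'rV[int]_d -> R) (lambda : R).
Variables (nu : probability (configT d) R) (P : probability (trajT d R) R).
Hypothesis law : arw_law p lambda nu P.

(** The limit is taken along finite sets ordered by inclusion, so only the volumes containing [V0]
    matter. *)
Lemma limit_law_le B t (A : set (trajT d R)) (b : R) (V0 : seq 'rV[int]_d) : 0 <= t -> window_event B t A ->
  (forall (V : {fset 'rV[int]_d}) Q, {subset V0 <= V} ->
     arw_finite_law p lambda (pushforward nu (restrict_config V)) Q -> (Q A <= b%:E)%E) ->
  pr P A <= b.
Proof.
move=> t0 wA h; rewrite -lee_fin -prE; last exact: window_measurable wA.
case: law => PV hPV hlim; have c := hlim B t A t0 wA.
have FT : ProperFilter (@totally 'rV[int]_d) := totally_filter.
rewrite -(cvg_lim _ c) //; apply: lime_le; first exact: cvgP c.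
exists [fset v | v in V0]%fset => // V /= V0V; apply: h; last exact: hPV.
by move=> v vV0; apply: (fsubsetP V0V); rewrite !inE.
Qed.

End LimitLaw.

(** * Activity of the infinite system *)

Section Eventually.
Variables (d : nat) (R : realType).

Lemma decreases_pred y K T (w : R -> config d) : decreases y K.+1 T w -> decreases y K T w.
Proof.
by move=> [q [r [[_ qr rT] hq _]]]; apply: decreases_le hq; exact: le_trans (ltW qr) rT.
Qed.

Lemma decreases_mono y K K' T (w : R -> config d) : (K <= K')%N ->
  decreases y K' T w -> decreases y K T w.
Proof. by move=> /subnK <-; elim: (K' - K)%N => // k IH /decreases_pred. Qed.

(* The supremum of the times at which the conclusion holds cannot be less than
   [T]: the path is constant on both sides of it. *)
Lemma decreases_finite y (T : rat) (w : traj d R) : exists K, ~ decreases y K T w.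
Proof.
have [T0|T0] := ltP T 0.
  by exists 1%N => -[q [r [[q0 qr rT] _ _]]]; lra.
pose A : set R := [set t | 0 <= t <= ratr T /\
  exists K, forall r : rat, ratr r <= t -> ~ decreases y K r w].
have A0 : A 0.
  split; first by rewrite lexx ler0q.
  exists 1%N => r; rewrite lerq0 => r0 [q [r' [[q0 qr rT] _ _]]]; lra.
have supA : has_sup A by split; [exists 0|exists (ratr T) => t [/andP[]]].
set u := sup A; have u0 : 0 <= u by exact: ub_le_sup supA.2 _ A0.
have uT : u <= ratr T by apply: ge_sup; [exists 0|move=> t [/andP[]]].
have [K1 hK1] : exists K, forall r : rat, ratr r < u -> ~ decreases y K r w.
  have [u_gt0|] := ltP 0 u; last first.
    move=> u0'; exists 1%N => r ru [q [r' [[q0 qr rT] _ _]]].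
    have : ratr r < 0 :> R by exact: lt_le_trans ru u0'.
    rewrite ltrq0; lra.
  have [_ /(_ u u_gt0)[a /nbhs_ballP[e /= e0 he]]] := traj_cadlag w y.
  have [t [/andP[t0 tT] [K hK]] ut] := sup_adherent e0 supA.
  exists K.+1 => r ru [q [r' [[q0 qr rT] hq]]].
  have [qt|tq] := leP (ratr q) t; first by have := hK q qt hq.
  have ha (z : rat) : t < ratr z -> ratr z < u -> w (ratr z) y = a.
    move=> tz zu; apply: he => //=; rewrite /ball /= ltr_distlC; apply/andP; split.
      exact: lt_trans ut tz.
    by apply: lt_trans zu _; rewrite ltrDl.
  have r'u : ratr r' < u by apply: le_lt_trans ru; rewrite ler_rat.
  have qr' : ratr q < ratr r' :> R by rewrite ltr_rat.
  by rewrite (ha r') ?(ha q) ?ltnn //; [exact: lt_trans r'u|exact: lt_trans qr'].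
have [hr _] := traj_cadlag w y; have [e /= e0 he] := (iffLR (nbhs_ballP _ _) (hr u u0)).
have hc (z : rat) : u <= ratr z -> ratr z < u + e -> w (ratr z) y = w u y.
  rewrite le_eqVlt => /orP[/eqP <- //|uz zu]; apply: he => //=.
  by rewrite /ball /= ltr_distlC; apply/andP; split => //; lra.
have hK2 (r : rat) : ratr r < u + e -> ~ decreases y K1.+1 r w.
  move=> ru [q [r' [[q0 qr rT] hq]]].
  have qr' : ratr q < ratr r' :> R by rewrite ltr_rat.
  have r'u : ratr r' < u + e by apply: le_lt_trans ru; rewrite ler_rat.
  have [qu|uq] := ltP (ratr q) u; first by have := hK1 q qu hq.
  by rewrite (hc r') ?(hc q) ?ltnn //; [exact: lt_trans r'u|exact: le_trans (ltW qr')].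
have [Tu|uT'] := ltP (ratr T) (u + e); first by exists K1.+1; exact: hK2.
have : A (u + e / 2).
  split; first by apply/andP; split; lra.
  by exists K1.+1 => r ru; apply: hK2; lra.
by move=> /(ub_le_sup supA.2); rewrite -/u; lra.
Qed.

Definition quiet x (n : nat) : set (trajT d R) :=
  [set w | forall q : rat, n%:R <= q -> active ((w : traj d R) (ratr q) x) = 0%N].

Definition bad x : set (trajT d R) := \bigcup_n quiet x n.

Definition few y K : set (trajT d R) := [set w | forall T : rat, ~ decreases y K T (w : traj d R)].

Lemma measurable_active (a : pred nat) (q : rat) x : 0 <= q ->
  measurable [set w : trajT d R | a (active ((w : traj d R) (ratr q) x))].
Proof.
move=> q0; apply: (@window_measurable _ _ [fset x]%fset (ratr q)).
have h : discrete_rv (fun w : windowT [fset x]%fset (ratr q : R) => active ((w : traj d R) (ratr q) x)).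
  by apply: window_active; rewrite ?ler0q // !inE.
exact: (discrete_rv_pred a h).
Qed.

Lemma measurable_decreases y K (T : rat) :
  measurable [set w : trajT d R | decreases y K T (w : traj d R)].
Proof.
apply: (@window_measurable _ _ [fset y]%fset (ratr T)).
by apply: window_decreases => //; rewrite !inE.
Qed.

Lemma measurable_from (a : pred nat) (n : nat) x : measurable [set w : trajT d R |
  forall q : rat, n%:R <= q -> a (active ((w : traj d R) (ratr q) x))].
Proof.
apply: measurable_all_count => q; have [nq|nq] := boolP (n%:R <= q); last first.
  by rewrite [X in measurable X](_ : _ = setT) //; apply/seteqP; split.
have q0 : 0 <= q by exact: le_trans nq.
rewrite [X in measurable X](_ : _ = [set w : trajT d R | a (active ((w : traj d R) (ratr q) x))]).
  exact: measurable_active.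
by apply/seteqP; split => w /=; [exact|move=> h _].
Qed.

Lemma measurable_quiet x n : measurable (quiet x n).
Proof.
rewrite (_ : quiet x n = [set w : trajT d R | forall q : rat, n%:R <= q ->
    active ((w : traj d R) (ratr q) x) == 0%N]).
  exact: (measurable_from (fun a => a == 0%N)).
by apply/seteqP; split => w h q nq; apply/eqP; exact: h.
Qed.

Lemma quiet_le x m n : (m <= n)%N -> quiet x m `<=` quiet x n.
Proof. by move=> mn w h q nq; apply: h; apply: le_trans nq; rewrite ler_nat. Qed.

Lemma measurable_bad x : measurable (bad x).
Proof. by apply: bigcupT_measurable => n; exact: measurable_quiet. Qed.

Lemma measurable_few y K : measurable (few y K).
Proof.
by apply: measurable_all_count => T; apply: measurableC; exact: measurable_decreases.
Qed.

Lemma few_le y K K' : (K <= K')%N -> few y K `<=` few y K'.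
Proof. by move=> KK w h T /(decreases_mono KK); exact: h. Qed.

Lemma bad_few x w : bad x w -> exists K, few x K w.
Proof.
(* The last decrease may end after time [n], but it must start before. *)
move=> [n _ h]; have [K hK] := decreases_finite x n%:R w; exists K.+1 => T.
move=> [q [r [[q0 qr rT] hq hd]]]; apply: hK; apply: decreases_le hq.
by rewrite leNgt; apply/negP => /ltW nq; move: hd; rewrite (h q).
Qed.

Lemma rat_le_nat (q : rat) : exists n : nat, q <= n%:R.
Proof.
by exists (Num.truncn q).+1; rewrite ltW // truncnS_gt.
Qed.

(** By right continuity, activity at a real time is seen at rational times just after it. *)
Lemma stays_activeE : @stays_active d R = ~` [set w | exists x, bad x w].
Proof.
apply/seteqP; split => w /= h.
  move=> [x [n _ hx]]; have [t [t0 nt at0]] := h x n%:R.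
  have [hr _] := traj_cadlag (w : traj d R) x.
  have [e /= e0 he] := (iffLR (nbhs_ballP _ _) (hr t t0)).
  have te : t < t + e by rewrite ltrDl.
  have [q] := rat_in_itvoo te; rewrite in_itv /= => /andP[tq qe].
  have : (w : traj d R) (ratr q) x = (w : traj d R) t x.
    by apply: he => //=; rewrite /ball /= ltr_distlC; apply/andP; split => //; lra.
  move=> eq; move: at0; rewrite -eq hx //.
  by rewrite -(ler_rat R) ratr_nat; apply: le_trans nt (ltW tq).
move=> x T; apply: contrapT => hT; apply: h; exists x.
exists (Num.truncn T).+1 => // q nq; apply/eqP; rewrite -leqn0 leqNgt; apply/negP => aq.
have q0 : 0 <= q by exact: le_trans nq.
apply: hT; exists (ratr q); split => //; first by rewrite ler0q.
apply: le_trans (ltW (truncnS_gt T)) _.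
by rewrite -(ratr_nat R) ler_rat.
Qed.

End Eventually.

Section Activity.
Variables (d : nat) (R : realType) (p : 'rV[int]_d -> R).
Hypothesis pJ : jump_distribution p.
Hypothesis d_gt2 : (2 < d)%N.
Local Notation site := 'rV[int]_d.
Variable lambda : R.
Hypothesis lambda_gt0 : 0 < lambda.
Variables (L : nat) (b : nat -> bool).
Hypothesis L_gt0 : (0 < L)%N.
Variable P : probability (trajT d R) R.
Hypothesis law : arw_law p lambda (pattern_law R d_gt2 L b) P.

Let init (V : {fset site}) (j : 'I_L) : config d := restrict_config V (pattern d_gt2 L b j).

Let init_mass (V : {fset site}) j : mass_le #|` V|%fset (init V j).
Proof. exact: mass_le_restrict. Qed.

Let init_lawE (V : {fset site}) (e : configT d) :
  pushforward (pattern_law R d_gt2 L b) (restrict_config V) [set e] =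
  (init_law R (init V) e)%:E.
Proof. exact: pattern_law_restrict. Qed.

Lemma law_stuck W x K (T : rat) c : 0 <= T ->
  (forall V : {fset site}, {subset W <= V} ->
     c <= (\sum_(j < L) reach_prob p lambda W x K (init V j, 0%N)) / L%:R) ->
  pr P (stuck W x K T) <= 1 - c.
Proof.
move=> T0 hc. apply: (limit_law_le law (V0 := W) _ (@window_stuck d R W x K T T0)).
  by rewrite ler0q.
move=> V Q WV hQ; apply: le_trans (finite_stuck pJ lambda_gt0 L_gt0 (init_mass V) (init_lawE V) hQ W x K T0) _.
by rewrite lee_fin lerD2l lerN2; exact: hc.
Qed.

Lemma law_unseen y s K n (T T' : rat) : s \in unit_steps d -> 0 <= T -> T <= T' ->
  pr P (unseen y s K n T T') <= (1 - p s / (1 + lambda)) ^+ n.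
Proof.
move=> hs T0 TT'; apply: (limit_law_le law (V0 := [::]) _ (@window_unseen d R y s K n T T' T0 TT')).
  by rewrite ler0q (le_trans T0).
move=> V Q _ hQ.
exact: (finite_unseen pJ lambda_gt0 L_gt0 (init_mass V) (init_lawE V) hQ).
Qed.

Lemma law_busy y K (T T' : rat) : 0 <= T -> T < T' ->
  pr P (busy y K T T') <= K%:R / ratr (T' - T).
Proof.
move=> T0 TT'; apply: (limit_law_le law (V0 := [::]) _ (@window_busy d R y K T T' T0)).
  by rewrite ler0q (le_trans T0) // ltW.
move=> V Q _ hQ.
exact: (finite_busy pJ lambda_gt0 L_gt0 (init_mass V) (init_lawE V) hQ).
Qed.

Let ae_of_null (N : set (trajT d R)) (Q : trajT d R -> Prop) : measurable N -> pr P N <= 0 ->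
  (forall w, ~ N w -> Q w) -> {ae P, forall w, Q w}.
Proof.
move=> mN N0 h; exists N; split => //; last by move=> w /= nQ; apply: contrapT => nN; apply: nQ; exact: h.
by rewrite prE //; congr _%:E; apply/eqP; rewrite eq_le N0 pr_ge0.
Qed.

Let null_bigcup2 (F : nat -> nat -> set (trajT d R)) : (forall m n, measurable (F m n)) ->
  (forall m n, pr P (F m n) <= 0) ->
  measurable (\bigcup_m \bigcup_n F m n) /\ pr P (\bigcup_m \bigcup_n F m n) <= 0.
Proof.
move=> mF F0; have mU m : measurable (\bigcup_n F m n) by exact: bigcupT_measurable.
split; first exact: bigcupT_measurable.
have e m n : pr P (F m n) = 0 by apply/eqP; rewrite eq_le F0 pr_ge0.
by rewrite pr_bigcup0 // => m; rewrite pr_bigcup0.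
Qed.

(* If [y + s] is eventually inactive, almost surely [y] decreases only finitely
   often: each decrease activates [y + s] with a fixed positive probability. *)
Lemma ae_bad_few y s : s \in unit_steps d -> 0 < p s ->
  {ae P, forall w, bad (y + s) w -> exists K, few y K w}.
Proof.
move=> hs ps.
pose U n K m : set (trajT d R) := (quiet (y + s) n `&` ~` [set w | decreases y K n%:R (w : traj d R)]) `&`
  [set w | exists t : nat, decreases y (K + m) (n + t)%:R (w : traj d R)].
have mA n K : measurable (quiet (y + s) n `&` ~` [set w | decreases y K n%:R (w : traj d R)]).
  apply: measurableI; first exact: measurable_quiet.
  by apply: measurableC; exact: measurable_decreases.
have mU n K m : measurable (U n K m).
  apply: measurableI => //.
  by apply: measurable_ex_count => t; exact: measurable_decreases.
pose F n K : set (trajT d R) := [set w | forall m, U n K m w].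
have mF n K : measurable (F n K) by exact: measurable_all_count.
set rho := 1 - p s / (1 + lambda).
have l1 : 0 < 1 + lambda by rewrite addr_gt0.
have ps1 : p s <= 1.
  rewrite -(jump_sum1 pJ) (big_rem s hs) /= lerDl sumr_ge0 // => t _.
  by case: pJ.
have rho0 : 0 <= rho by rewrite subr_ge0 ler_pdivrMr // mul1r (le_trans ps1) // lerDl ltW.
have rho1 : rho < 1 by rewrite ltrBlDr ltrDl divr_gt0.
have hU n K m : pr P (U n K m) <= rho ^+ m.
  have -> : U n K m = \bigcup_t ((quiet (y + s) n `&` ~` [set w | decreases y K n%:R (w : traj d R)]) `&`
      [set w | decreases y (K + m) (n + t)%:R (w : traj d R)]).
    apply/seteqP; split => w; first by move=> [h1 [t ht]]; exists t.
    by move=> [t _ [h1 ht]]; split => //; exists t.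
  have mG t : measurable ((quiet (y + s) n `&` ~` [set w | decreases y K n%:R (w : traj d R)]) `&`
      [set w | decreases y (K + m) (n + t)%:R (w : traj d R)]).
    by apply: measurableI => //; exact: measurable_decreases.
  apply: pr_bigcup_le => // [t t' tt' w [h1 h2]|t].
    by split => //; apply: decreases_le h2; rewrite ler_nat leq_add2l.
  have n0 : 0 <= n%:R :> rat by rewrite ler0n.
  have nt : n%:R <= (n + t)%:R :> rat by rewrite ler_nat leq_addr.
  apply: le_trans (law_unseen y K m hs n0 nt); apply: pr_le => //.
    by apply: window_measurable; exact: window_unseen.
  by move=> w [[h1 h2] h3]; split => // q nq _; exact: h1.
have F0 n K : pr P (F n K) <= 0.
  have c : rho ^+ m @[m --> \oo] --> (0 : R) by apply: cvg_expr; rewrite ger0_norm.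
  rewrite -(cvg_lim _ c) //; apply: limr_ge; first exact: cvgP c.
  by apply: nearW => m; apply: le_trans (hU n K m); apply: pr_le.
have [mFF FF0] := null_bigcup2 mF F0.
apply: (ae_of_null mFF FF0) => w nFw [n _ hn]; apply: contrapT => hK.
have [K hD] := decreases_finite y n%:R w.
apply: nFw; exists n => //; exists K => // m; split => //.
apply: contrapT => ht; apply: hK; exists (K + m)%N => T hT; apply: ht.
have [k hk] := rat_le_nat T; exists k; apply: decreases_le hT.
by apply: le_trans hk _; rewrite ler_nat leq_addl.
Qed.

(* After its last decrease [y] cannot remain active forever. *)
Lemma ae_few_bad y : {ae P, forall w, (exists K, few y K w) -> bad y w}.
Proof.
pose F K n : set (trajT d R) := few y K `&` [set w | forall q : rat, n%:R <= q ->
   (0 < active ((w : traj d R) (ratr q) y))%N].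
have mF K n : measurable (F K n).
  by apply: measurableI; [exact: measurable_few|exact: (measurable_from (fun a => 0 < a)%N)].
have F0 K n : pr P (F K n) <= 0.
  have h t : pr P (F K n) <= K%:R / t.+1%:R.
    have n0 : 0 <= n%:R :> rat by rewrite ler0n.
    have nt : n%:R < (n + t.+1)%:R :> rat by rewrite ltr_nat; lia.
    have := law_busy y K n0 nt.
    rewrite natrD addrAC subrr add0r ratr_nat; apply: le_trans; apply: pr_le => //.
      by apply: window_measurable; exact: window_busy.
    by move=> w [h1 h2]; split => [|q nq _]; [exact: h1|exact: h2].
  have c : K%:R * t.+1%:R^-1 @[t --> \oo] --> K%:R * (0 : R).
    by apply: cvgMr; exact: cvg_harmonic.
  rewrite -[leRHS](mulr0 K%:R) -(cvg_lim _ c) //; apply: limr_ge; first exact: cvgP c.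
  exact: nearW.
have [mFF FF0] := null_bigcup2 mF F0.
apply: (ae_of_null mFF FF0) => w nFw [K]; elim: K => [|K IH] hK; first by have := hK 0 I.
(* For [K] minimal, the [K]th decrease has occurred by some time. If [y] is active later on, it
   stays so: becoming inactive would be one decrease too many. *)
have [hK'|hK'] := pselect (few y K w); first exact: IH.
apply: contrapT => nb.
have [T hT] : exists T, decreases y K T (w : traj d R).
  by apply: contrapT => h; apply: hK' => T hT; apply: h; exists T.
have [k hk] := rat_le_nat T.
have [q kq aq] : exists2 q : rat, k%:R <= q & (0 < active ((w : traj d R) (ratr q) y))%N.
  apply: contrapT => h; apply: nb; exists k => // q kq; apply/eqP.
  by rewrite -leqn0 leqNgt; apply/negP => aq; apply: h; exists q.
have [n hn] := rat_le_nat q.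
apply: nFw; exists K.+1 => //; exists n => //; split => // r nr.
rewrite lt0n; apply/negP => /eqP ar.
have [e|qr] := eqVneq q r; first by rewrite e ar in aq.
apply: (hK r); exists q, r; split; last by rewrite ar.
  split => //; first by apply: le_trans kq; rewrite ler0n.
  by rewrite lt_neqAle qr (le_trans hn nr).
by apply: decreases_le hT; exact: le_trans kq.
Qed.

Lemma ae_bad_reach x y : reach p x y -> {ae P, forall w, bad x w -> bad y w}.
Proof.
elim=> [|{}y s hs ps _ IH]; first exact: aeW.
apply: filterS3 IH (ae_bad_few y hs ps) (ae_few_bad y) => w h1 h2 h3 /h1 /h2; exact: h3.
Qed.

Lemma ae_bad_all x (W : seq site) : (forall y, y \in W -> reach p x y) ->
  {ae P, forall w, bad x w -> forall y, y \in W -> bad y w}.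
Proof.
elim: W => [|y W IH] h; first by apply: aeW.
have h1 := ae_bad_reach (h y (mem_head _ _)).
have h2 := IH (fun z zW => h z (mem_behead (s := y :: W) zW)).
apply: filterS2 h1 h2 => w h1 h2 hx z; rewrite inE => /orP[/eqP ->|]; first exact: h1.
exact: h2.
Qed.

Section Bound.
Variable c : R.
Hypothesis phase : forall x K, exists W : seq site,
  [/\ uniq W, x \in W, (forall y, y \in W -> reach p x y) &
   forall V : {fset site}, {subset W <= V} ->
     c <= (\sum_(j < L) reach_prob p lambda W x K (init V j, 0%N)) / L%:R].

(** Two increasing unions, over the bound [K] on the decreases at [x] and over the time from which
    all of [W] is quiet; the first is harmless because [c] does not depend on [K]. *)
Lemma pr_bad_le x : pr P (bad x) <= 1 - c.
Proof.
pose G K : set (trajT d R) := bad x `&` few x K.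
have mG K : measurable (G K).
  by apply: measurableI; [exact: measurable_bad|exact: measurable_few].
have -> : bad x = \bigcup_K G K.
  apply/seteqP; split => w; last by move=> [K _ []].
  by move=> hw; have [K hK] := bad_few hw; exists K.
apply: pr_bigcup_le => // [K K' KK w [h1 h2]|K].
  by split => //; exact: few_le KK _ h2.
have [W [_ _ hW hc]] := phase x K.
pose V n : set (trajT d R) := [set w | forall y, y \in W -> quiet y n w] `&` few x K.
have mV n : measurable (V n).
  apply: measurableI; last exact: measurable_few.
  apply: measurable_all_count => y; have [yW|yW] := boolP (y \in W); last first.
    by rewrite [X in measurable X](_ : _ = setT) //; apply/seteqP; split.
  rewrite [X in measurable X](_ : _ = quiet y n); first exact: measurable_quiet.
  by apply/seteqP; split => w /=; [exact|move=> h _].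
have V1 : pr P (\bigcup_n V n) <= 1 - c.
  apply: pr_bigcup_le => // [m n mn w [h1 h2]|n].
    by split => // y yW; apply: quiet_le mn _ _; exact: h1.
  have n0 : 0 <= n%:R :> rat by rewrite ler0n.
  apply: le_trans (law_stuck n0 hc); apply: pr_le => //.
    by apply: window_measurable; exact: window_stuck.
  by move=> w [h1 h2]; split => [y yW|]; [exact: h1|exact: h2].
apply: le_trans V1; apply: pr_le_ae => //; first exact: bigcupT_measurable.
apply: filterS (ae_bad_all hW) => w h [/h hb hf].
have [n hn] : exists n, forall y, y \in W -> quiet y n w.
  elim: (W) hb => [|y W' IH] hb; first by exists 0%N.
  have [n hn] := IH (fun z zW => hb z (mem_behead (s := y :: W') zW)).
  have [m _ hm] := hb y (mem_head _ _); exists (maxn m n) => z; rewrite inE => /orP[/eqP ->|zW].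
    exact: quiet_le (leq_maxl m n) _ hm.
  exact: quiet_le (leq_maxr m n) _ (hn z zW).
by exists n.
Qed.

Lemma pr_ex_bad_le : measurable [set w : trajT d R | exists x, bad x w] /\
  pr P [set w | exists x, bad x w] <= 1 - c.
Proof.
have m : measurable [set w : trajT d R | exists x, bad x w].
  by apply: measurable_ex_count => x; exact: measurable_bad.
split => //.
pose xs n : seq site := pmap choice.unpickle (iota 0 n).
pose F n : set (trajT d R) := [set w | exists x, x \in xs n /\ bad x w].
have mF n : measurable (F n).
  apply: measurable_ex_count => x; have [xn|xn] := boolP (x \in xs n); last first.
    by rewrite [X in measurable X](_ : _ = set0) //; apply/seteqP; split => // w [].
  rewrite [X in measurable X](_ : _ = bad x); first exact: measurable_bad.
  by apply/seteqP; split => w /=; [case|].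
have -> : [set w | exists x, bad x w] = \bigcup_n F n.
  apply/seteqP; split => w; last by move=> [n _ [x [_ h]]]; exists x.
  move=> [x h]; exists (choice.pickle x).+1 => //; exists x; split => //.
  rewrite mem_pmap; apply/mapP; exists (choice.pickle x); last by rewrite choice.pickleK.
  by rewrite mem_iota /= ltnSn.
apply: pr_bigcup_le => // [m' n mn w [x [xm hx]]|n].
  exists x; split => //; move: xm; rewrite !mem_pmap => /mapP[k km ->].
  by apply/mapP; exists k => //; move: km; rewrite !mem_iota; lia.
have [y hy] := reach_common_seq pJ (xs n).
apply: le_trans (pr_bad_le y); apply: pr_le_ae => //; first exact: measurable_bad.
have h : {ae P, forall w, forall x, x \in xs n -> bad x w -> bad y w}.
  elim: (xs n) hy => [|x l IH] hy; first exact: aeW.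
  have h1 := ae_bad_reach (hy x (mem_head _ _)).
  have h2 := IH (fun z zl => hy z (mem_behead (s := x :: l) zl)).
  apply: filterS2 h1 h2 => w h1 h2 z; rewrite inE => /orP[/eqP -> //|]; exact: h2.
by apply: filterS h => w h [x [xn]]; exact: h.
Qed.

Lemma pr_stays_active_ge : c <= pr P (@stays_active d R).
Proof.
have [m h] := pr_ex_bad_le; rewrite stays_activeE pr_setC //.
lra.
Qed.

End Bound.

End Activity.

(** * Bounds on the critical density *)

Section Conclusion.
Variables (d : nat) (R : realType) (p : 'rV[int]_d -> R).
Hypothesis pJ : jump_distribution p.
Hypothesis d_gt2 : (2 < d)%N.
Variable lambda : R.
Hypothesis lambda_gt0 : 0 < lambda.
Variable zc : R.
Hypothesis zcP : critical_density p lambda zc.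

Lemma critical_density_le L b : (0 < L)%N -> active_phase p d_gt2 lambda L b ->
  zc <= (\sum_(r < L) (b r)%:R) / L%:R.
Proof.
move=> L_gt0 [c c_gt0 phase]; rewrite leNgt; apply/negP => hlt.
have [P law [h _]] := zcP (pattern_law_ergodic R d_gt2 b L_gt0)
  (pattern_law_all_active R d_gt2 b L_gt0) (density_pattern_law R d_gt2 b L_gt0).
have := pr_stays_active_ge pJ lambda_gt0 L_gt0 law phase.
by rewrite /pr (h hlt) /= leNgt c_gt0.
Qed.

(** The other half of the limit at [0]. If [zc] were negative, the empty configuration, of density
    [0], would have to stay active almost surely. *)
Lemma critical_density_ge0 : 0 <= zc.
Proof.
rewrite leNgt; apply/negP => zc_lt0; pose b (r : nat) := false.
have L_gt0 : (0 < 1)%N by [].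
have [P law [_ h]] := zcP (pattern_law_ergodic R d_gt2 b L_gt0)
  (pattern_law_all_active R d_gt2 b L_gt0) (density_pattern_law R d_gt2 b L_gt0).
have {}h : P (@stays_active d R) = 1%E by apply: h; rewrite big_ord1 mul0r.
pose x0 : 'rV[int]_d := 0.
have q_le (q : rat) : 0 <= q -> pr P [set w | (0 < active ((w : traj d R) (ratr q) x0))%N] <= 0.
  move=> q0.
  have wq : window_event [fset x0]%fset (ratr q)
      ([set w | (0 < active ((w : traj d R) (ratr q) x0))%N] : set (trajT d R)).
    have hq : discrete_rv (fun w : windowT [fset x0]%fset (ratr q : R) => active ((w : traj d R) (ratr q) x0)).
      by apply: window_active; rewrite ?ler0q // !inE.
    exact: (discrete_rv_pred (fun a => 0 < a)%N hq).
  apply: (limit_law_le law (V0 := [::]) _ wq) => [|V Q _ hQ]; first by rewrite ler0q.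
  pose init (j : 'I_1) : config d := restrict_config V (pattern d_gt2 1 b j).
  have init_mass j : mass_le 0 (init j).
    move=> D _; rewrite big1 // => u _.
    by rewrite /init /restrict_config; case: ifP.
  apply: (finite_law_le pJ lambda_gt0 L_gt0 init_mass (pattern_law_restrict R d_gt2 b L_gt0 V) hQ).
    exact: window_measurable wq.
  move=> disp T P' Y H mY mH hlaw.
  exists [set o | exists k, (0 < active (history Y o k x0))%N]; last first.
    move=> o w aw H0 HL hw; have [k hk] := jump_path_state H0 HL hw q0.
    by exists k; rewrite /history -hk.
  have mk k : measurable [set o | (0 < active (history Y o k x0))%N].
    exact: (discrete_rv_pred (fun a => 0 < a)%N (discrete_active mY k x0)).
  split; first exact: measurable_ex_count.
  have := @pr_hit_le d R p pJ lambda lambda_gt0 _ _ P' Y H mY mH 1 0 init L_gt0 init_mass hlaw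
    (fun k eta => (0 < active (eta k x0))%N) (fun _ _ => 0).
  rewrite sumr_const mul0rn mul0r; apply => // [k eta eta' e|k eta v|k eta v].
  - by rewrite e.
  - have := v k (leqnn k) [:: x0] isT; rewrite big_seq1 leqn0.
    by case: (eta k x0) => [n|] //= /eqP ->.
  - by rewrite (chain_mean_cst pJ lambda_gt0 _ (v k (leqnn k))).
have : pr P (@stays_active d R) <= 0.
  pose F (q : rat) : set (trajT d R) := [set w | 0 <= q /\ (0 < active ((w : traj d R) (ratr q) x0))%N].
  have mF q : measurable (F q).
    have [q0|q0] := boolP (0 <= q); last first.
      by rewrite (_ : F q = set0) //; apply/seteqP; split => // w []; rewrite (negPf q0).
    rewrite (_ : F q = [set w | (0 < active ((w : traj d R) (ratr q) x0))%N]).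
      exact: (measurable_active (fun a => 0 < a)%N).
    by apply/seteqP; split => w //= [].
  pose G n : set (trajT d R) := if (choice.unpickle n : option rat) is Some q then F q else set0.
  have mG n : measurable (G n) by rewrite /G; case: choice.unpickle.
  have G0 n : pr P (G n) = 0.
    rewrite /G; case: choice.unpickle => [q|]; last exact: pr_set0.
    apply/eqP; rewrite eq_le pr_ge0 andbT; have [q0|q0] := boolP (0 <= q).
      apply: le_trans (q_le q q0); apply: pr_le => //; last by move=> w [].
      exact: (measurable_active (fun a => 0 < a)%N).
    by rewrite (_ : F q = set0) ?pr_set0 //; apply/seteqP; split => // w []; rewrite (negPf q0).
  rewrite -(pr_bigcup0 mG G0); apply: pr_le.
  - rewrite stays_activeE; apply: measurableC; apply: measurable_ex_count => x.
    exact: measurable_bad.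
  - exact: bigcupT_measurable.
  rewrite stays_activeE => w hw; apply: contrapT => nG; apply: hw; exists x0, 0%N => // q q0.
  apply/eqP; rewrite -leqn0 leqNgt; apply/negP => aq; apply: nG.
  by exists (choice.pickle q); [exact: I|rewrite /G choice.pickleK; split].
by rewrite /pr h /= ler10.
Qed.

End Conclusion.

Unset Implicit Arguments.

Theorem theorem7p2 (R : realType) (d : nat) (p : 'rV[int]_d -> R)
    (zeta_c : R -> R) :
  (2 < d)%N ->
  jump_distribution p ->
  (forall lambda : R, 0 < lambda -> critical_density p lambda (zeta_c lambda)) ->
  (forall lambda : R, 0 < lambda -> zeta_c lambda < 1) /\
  (zeta_c lambda @[lambda --> (0:R)^'+] --> (0:R)).
Proof.
move=> d_gt2 pJ zcP; have [F [F_ge0 F_sup]] := green_bound d_gt2 pJ.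
split => [lambda lambda_gt0|].
  have [L [b [L_gt0 dens phase]]] := active_phase_lt1 pJ d_gt2 F_ge0 F_sup lambda_gt0.
  exact: le_lt_trans (critical_density_le pJ lambda_gt0 (zcP _ lambda_gt0) L_gt0 phase) dens.
apply/cvgrPdist_le => eps eps_gt0.
have [L [lambda0 [L_gt0 lambda0_gt0 dens phase]]] := active_phase_small pJ d_gt2 F_ge0 F_sup eps_gt0.
near=> lambda.
have lambda_gt0 : 0 < lambda by near: lambda; exact: nbhs_right_gt.
have lambda_lt : lambda < lambda0 by near: lambda; exact: nbhs_right_lt.
rewrite sub0r normrN ger0_norm; last exact: (critical_density_ge0 pJ d_gt2 lambda_gt0 (zcP _ lambda_gt0)).
apply: le_trans dens; apply: (critical_density_le pJ lambda_gt0 (zcP _ lambda_gt0) L_gt0).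
exact: phase.
Unshelve. all: by end_near.
Qed.
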